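(* Let $k\ge 1$ and $n\ge 1$ be integers, and let $A=\{a_1,\dots,a_k\}$, $B=\{b_1,\dots,b_k\}$, $C=\{c_1,\dots,c_k\}$, $D=\{d_1,\dots,d_k\}$ be families of complex numbers, with $E=A+D$ denoting the union of $A$ and $D$ (a family of $2k$ elements). Assume $|c_i|<1$ and $|d_i|<1$ for all $i$, and that $d_1,\dots,d_k$ are distinct. Let $$\phi(e^{i\theta})=\prod_{i=1}^{k}\frac{(1-a_i e^{-i\theta})(1-b_i e^{i\theta})}{(1-c_i e^{-i\theta})(1-d_i e^{i\theta})}.$$ Then $$\det\bigl(T_n(\phi)+H_n(\phi)\bigr)=\sum_{\substack{S\subset E,\ T\subset B\\ |S|=|T|}}(-1)^{|S|}\Bigl(\prod_{s\in S}s^{\,n-1}\Bigr)\Bigl(\prod_{b\in T}b^{\,n}\Bigr)\prod_{d\in D}(1+d)\prod_{s\in S}(1-s)\prod_{b\in B-T}(1-b)$$ $$\qquad\times\ \frac{Z_S(D)\,Z(C,D)\,Z(E-S+T^{-1},\,B-T+S^{-1})}{Z(E-S+T^{-1},\,D)\,Z(B-T+S^{-1},\,C)\,Z_O(B-T+S^{-1})}.$$ (In the symbol $Z_S(D)$ the subscript is part of the name of the function $Z_S$ and does not refer to the summation set $S$.) At parameter values where individual summands are undefined, the right-hand side is understood as the continuous extension, in the parameters, of the rational expression given by the whole sum.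
   Context: For a function $\phi$ on the unit circle, $\phi_m=\frac1{2\pi}\int_0^{2\pi}\phi(e^{i\theta})e^{-im\theta}\,d\theta$ denotes its $m$-th Fourier coefficient, $m\in\mathbb Z$. $T_n(\phi)+H_n(\phi)$ is the $n\times n$ matrix whose $(i,j)$ entry is $\phi_{i-j}+\phi_{i+j+1}$, $0\le i,j\le n-1$. For finite families (indexed sets) of complex numbers $X=\{x_1,\dots,x_p\}$ and $Y=\{y_1,\dots,y_q\}$ define $$Z(X,Y)=\prod_{x\in X,\,y\in Y}(1-xy)^{-1},\qquad Z_S(X)=\prod_{1\le i\le j\le p}(1-x_ix_j)^{-1},\qquad Z_O(X)=\prod_{1\le i<j\le p}(1-x_ix_j)^{-1},$$ with empty products equal to $1$. For $S\subset X$, $X-S$ is the complement of $S$ in $X$; $X+Y$ is the union of $X$ and $Y$ (as families); $T^{-1}$ is the family of inverses $t^{-1}$, $t\in T$. Thus $E-S+T^{-1}$ is the union of $E-S$ and $T^{-1}$, and $B-T+S^{-1}$ is the union of $B-T$ and $S^{-1}$. Subsets are subfamilies (i.e. determined by subsets of the index set), and $|S|$ is the number of elements. *)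

(* Defs.v *)
From HB Require Import structures.
From mathcomp Require Import all_boot all_order all_algebra.
From mathcomp Require Import all_classical all_reals all_analysis.
From mathcomp Require Import complex.

Set Implicit Arguments.
Unset Strict Implicit.
Unset Printing Implicit Defensive.

Import Order.TTheory GRing.Theory Num.Theory.
Import numFieldNormedType.Exports.

Local Open Scope classical_set_scope.
Local Open Scope ring_scope.
Local Open Scope complex_scope.

(* MathComp-Analysis puts the norm topology on R[i]^o only; as it does itself
   for realType, numClosedFieldType, etc., we copy it to the carrier. *)
HB.instance Definition _ (R : realType) := NormedModule.copy R[i] R[i]^o.

Section Fourier.
Context {R : realType}.

Definition expi (theta : R) : R[i] := cos theta +i* sin theta.

Definition cintegral (I : set R) (f : R -> R[i]) : R[i] :=
  (\int[lebesgue_measure]_(x in I) complex.Re (f x))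
    +i* (\int[lebesgue_measure]_(x in I) complex.Im (f x)).

Definition fourier_coef (phi : R[i] -> R[i]) (m : int) : R[i] :=
  ((2 * pi)^-1)%:C *
    cintegral `[0, 2 * pi] (fun t => phi (expi t) * expi (- (m%:~R * t))).

Definition toeplitz_plus_hankel (n : nat) (phi : R[i] -> R[i]) : 'M[R[i]]_n :=
  \matrix_(i < n, j < n)
    (fourier_coef phi (i%:Z - j%:Z) + fourier_coef phi (i%:Z + j%:Z + 1)).

(* On the unit circle z = e^(i theta) and z^-1 = e^(- i theta). *)
Definition symbol (k : nat) (A B C D : 'rV[R[i]]_k) (z : R[i]) : R[i] :=
  \prod_(i < k) (((1 - A 0 i * z^-1) * (1 - B 0 i * z)) /
                 ((1 - C 0 i * z^-1) * (1 - D 0 i * z))).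

End Fourier.

(* Families are sequences; the union X + Y of families is X ++ Y, and all the
   products below are insensitive to the order of the elements. *)
Section Families.
Context {R : realType}.
Local Notation K := (R[i]).
Implicit Types X Y : seq K.

Definition family (m : nat) (x : 'rV[K]_m) : seq K := [seq x 0 i | i : 'I_m].

Definition subfamily (m : nat) (x : 'rV[K]_m) (S : {set 'I_m}) : seq K :=
  [seq x 0 i | i in S].

Definition inv_family X : seq K := [seq x^-1 | x <- X].

Definition Z X Y : K := \prod_(x <- X) \prod_(y <- Y) (1 - x * y)^-1.

Definition Z_S X : K :=
  \prod_(i < size X) \prod_(j < size X | (i <= j)%N) (1 - X`_i * X`_j)^-1.

Definition Z_O X : K :=
  \prod_(i < size X) \prod_(j < size X | (i < j)%N) (1 - X`_i * X`_j)^-1.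

Definition Z_defined X Y : Prop :=
  forall x y, x \in X -> y \in Y -> 1 - x * y != 0.

Definition Z_S_defined X : Prop :=
  forall i j : 'I_(size X), (i <= j)%N -> 1 - X`_i * X`_j != 0.

Section Sum.
Context {k : nat}.
Implicit Types (A B C D : 'rV[K]_k) (S : {set 'I_(k + k)}) (T : {set 'I_k}).

Definition swapE A B D S T : seq K :=
  subfamily (row_mx A D) (~: S) ++ inv_family (subfamily B T).

Definition swapB A B D S T : seq K :=
  subfamily B (~: T) ++ inv_family (subfamily (row_mx A D) S).

Definition summand (n : nat) A B C D S T : K :=
  (-1) ^+ #|S| *
  (\prod_(s <- subfamily (row_mx A D) S) s ^+ n.-1) *
  (\prod_(b <- subfamily B T) b ^+ n) *
  (\prod_(d <- family D) (1 + d)) *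
  (\prod_(s <- subfamily (row_mx A D) S) (1 - s)) *
  (\prod_(b <- subfamily B (~: T)) (1 - b)) *
  ((Z_S (family D) * Z (family C) (family D) *
      Z (swapE A B D S T) (swapB A B D S T)) /
   (Z (swapE A B D S T) (family D) * Z (swapB A B D S T) (family C) *
      Z_O (swapB A B D S T))).

(* The factors Z of the denominator impose nothing beyond the existence of the
   inverses s^-1 and t^-1: their reciprocals are products of factors 1 - x * y,
   and, as 0^-1 = 0, dividing by Z gives that product even when it vanishes. *)
Definition summand_defined A B C D S T : Prop :=
  [/\ 0 \notin subfamily (row_mx A D) S, 0 \notin subfamily B T,
      Z_S_defined (family D), Z_defined (family C) (family D) &
      Z_defined (swapE A B D S T) (swapB A B D S T)].

(* A point of the parameter space is a quadruple (A, B, C, D). *)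
Local Notation parameters :=
  ('rV[K]_k * 'rV[K]_k * 'rV[K]_k * 'rV[K]_k)%type.

Definition rhs_sum (n : nat) (p : parameters) : K :=
  let: (A, B, C, D) := p in
  \sum_(S : {set 'I_(k + k)}) \sum_(T : {set 'I_k} | #|S| == #|T|)
    summand n A B C D S T.

Definition rhs_domain : set parameters :=
  [set p | let: (A, B, C, D) := p in
     forall S T, #|S| = #|T| -> summand_defined A B C D S T].

End Sum.
End Families.

Arguments rhs_domain {R k}.

(* v is the value at p of the continuous extension of F from G; if p is in G,
   this forces v = F p. *)
Definition continuous_extension_value (U V : topologicalType)
    (F : U -> V) (G : set U) (p : U) (v : V) : Prop :=
  closure G p /\ F q @[q --> within G (nbhs p)] --> v.

(* Main.v *)
Require Import Defs.
From HB Require Import structures.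
From mathcomp Require Import all_boot all_order all_fingroup all_algebra.
From mathcomp Require Import all_classical all_reals all_analysis.
From mathcomp Require Import complex.
From mathcomp Require Import ring zify.
Import Order.TTheory GRing.Theory Num.Theory.
Import numFieldNormedType.Exports.
Local Open Scope classical_set_scope.
Local Open Scope ring_scope.
Local Open Scope complex_scope.

Set Implicit Arguments.
Unset Strict Implicit.
Unset Printing Implicit Defensive.

(** Column j of the matrix lists the coefficients of index 0, ..., n - 1 of phi w_j,
    where w_j = z^j + z^(-j-1). Let delta be the product of the 1 - d_i z. A Bezout
    identity (Wiener_Hopf_split) writes phi w_j as P_j / delta, where P_j is a
    polynomial of degree at most j + k whose coefficient of index j + k does not
    depend on j, plus a function analytic outside the disc and zero at infinity. Hence the
    determinant is the one of the coefficients of index less than n of the P_j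
    (det_toeplitz_plus_hankel).

    As z^j + z^(-j-1) is invariant under z -> 1/z up to the factor z, the residue
    theorem gives, for each b in B, a linear form that vanishes on all P_j: a
    weighted sum of the values at the 2k points of E and at 1/b (lam_split). With k
    such forms, linear algebra (det_annihilated) turns the determinant of order n
    into a quotient of two determinants of order k, those of the forms on X^n p_i
    and on p_i, where p_0, ..., p_(k-1) is any basis of the polynomials of degree
    less than k. For p_i the product of the 1 - d_j X over j != i, the second one
    is a Cauchy determinant in the variable z + 1/z (det_lam_dbasis), and the first
    one is an explicit factor times det (1 + X Y), where X, of size k by 2k, and Y,
    of size 2k by k, are Cauchy matrices up to row and column factors
    (det_lam_shift). The factor yields the term S = T = set0 (mainterm_det).
    Expanding det (1 + X Y) into products of opposite minors gives a sum over the
    subsets S of E and T of B of equal cardinality (det_1D_subsets), and evaluating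
    the minors by Cauchy's formula gives the summand (minor_product,
    minorterm_setterm).

    This proves the identity in general position (det_generic). Through every
    point of the parameter space there is an affine path that is in general
    position for all small t != 0 (near_path_generic). The determinant is
    continuous in the parameters, because the symbol varies continuously for
    uniform convergence on the circle (cvg_det_toeplitz_plus_hankel), and the
    summands are continuous where they are defined (cvg_setterm). So the identity
    extends to the domain of the sum (det_rhs_domain), the given parameters are in
    the closure of the domain, and the continuity of the determinant gives the
    continuous extension. *)

(** * Products over pairs of indices *)

Lemma sub1r_neq0 (R : nzRingType) (x : R) : x != 1 -> 1 - x != 0.
Proof. by rewrite subr_eq0 eq_sym. Qed.

Lemma divr_neq1 (F : fieldType) (x y : F) : y != 0 -> x != y -> x / y != 1.
Proof. by move=> y0; apply: contraNneq => xy; rewrite -[x](mulfVK y0) xy mul1r. Qed.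

Lemma mulr_neq1_norm (R : numDomainType) (x y : R) : `|x| < 1 -> `|y| < 1 -> x * y != 1.
Proof.
move=> x1 y1; apply/eqP => xy; have : `|x * y| < 1 by rewrite normrM mulr_ilt1.
by rewrite xy normr1 ltxx.
Qed.

Lemma size_polyM_le (F : nzSemiRingType) (p q : {poly F}) m n :
  (size p <= m)%N -> (size q <= n.+1)%N -> (size (p * q)%R <= m + n)%N.
Proof.
move=> sp sq; apply: leq_trans (size_polyMleq _ _) _.
by case: (size p + size q)%N (leq_add sp sq) => // s; rewrite addnS.
Qed.

Lemma big_option (R : Type) (idx : R) (op : Monoid.com_law idx) (I : finType)
    (G : option I -> R) :
  \big[op/idx]_o G o = op (G None) (\big[op/idx]_i G (Some i)).
Proof.
rewrite (bigD1 None) //=; congr (op _ _).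
rewrite (reindex_omap Some id) //=; last by case.
by apply: eq_bigl => i; rewrite eqxx.
Qed.

Lemma big_option_None (R : Type) (idx : R) (op : Monoid.com_law idx) (I : finType)
    (G : option I -> R) :
  \big[op/idx]_(o | o != None) G o = \big[op/idx]_i G (Some i).
Proof.
by rewrite big_mkcond big_option /= Monoid.mul1m.
Qed.

Lemma big_option_Some (R : Type) (idx : R) (op : Monoid.com_law idx) (I : finType)
    (G : option I -> R) i :
  \big[op/idx]_(o | o != Some i) G o =
    op (G None) (\big[op/idx]_(j | j != i) G (Some j)).
Proof.
by rewrite big_mkcond big_option /=; congr (op _ _); rewrite [RHS]big_mkcond.
Qed.

Section PairProducts.
Variables (F : comNzRingType) (n : nat).
Implicit Types (f : 'I_n -> 'I_n -> F) (A : {set 'I_n}).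

Lemma prod_neq_pairs_in (P : pred 'I_n) f :
  \prod_(i | P i) \prod_(j | P j && (j != i)) f i j =
  \prod_(i | P i) \prod_(j | P j && (i < j)%N) (f i j * f j i).
Proof.
rewrite [RHS](eq_bigr _ (fun i _ => big_split _ _ _ _ _)) big_split /=.
rewrite [X in _ * X](exchange_big_dep P) /=; last by move=> i j _ /andP[].
rewrite -big_split /=; apply: eq_bigr => i Pi.
rewrite (bigID (fun j : 'I_n => (i < j)%N)) /=; congr (_ * _); apply: eq_bigl => j.
  by rewrite -val_eqE /= -andbA; congr andb; case: ltngtP.
by rewrite Pi -val_eqE /= -leqNgt -andbA; congr andb; case: ltngtP.
Qed.

(** A product over unordered pairs does not depend on how each pair is
    oriented. *)
Lemma prod_tournament (r : rel 'I_n) f :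
  (forall i, ~~ r i i) -> (forall i j, i != j -> r i j = ~~ r j i) ->
  (forall i j, f i j = f j i) ->
  \prod_i \prod_(j | r i j) f i j = \prod_(i < n) \prod_(j < n | (i < j)%N) f i j.
Proof.
move=> rr rC fC.
under eq_bigr => i _ do rewrite (bigID (fun j : 'I_n => (i < j)%N)) /=.
rewrite big_split /= [X in _ * X](exchange_big_dep xpredT) //= -big_split /=.
apply: eq_bigr => i _; rewrite [RHS](bigID (fun j => r i j)) /=; congr (_ * _).
  by apply: eq_bigl => j; rewrite andbC.
apply: eq_big => [j|j _]; last exact: fC.
case: (ltngtP i j) => [ij|ji|/val_inj ->]; last by rewrite (negPf (rr j)).
  by rewrite andbT /= rC // -val_eqE /= gtn_eqF.
by rewrite andbF.
Qed.

Lemma prod_pairs_setC A f : (forall i j, f i j = f j i) ->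
  \prod_(i < n) \prod_(j < n | (i < j)%N) f i j =
  (\prod_(i in A) \prod_(j in A | (i < j)%N) f i j) *
  (\prod_(i in ~: A) \prod_(j in ~: A | (i < j)%N) f i j) *
  (\prod_(i in A) \prod_(j in ~: A) f i j).
Proof.
move=> fC.
pose r : rel 'I_n := fun i j =>
  if i \in A then (j \in ~: A) || (i < j)%N else (j \in ~: A) && (i < j)%N.
rewrite -(@prod_tournament r) //; first last.
- move=> i j ij; rewrite /r !inE; move: ij; rewrite -val_eqE /=.
  by case: (i \in A); case: (j \in A) => //=; case: ltngtP.
- by move=> i; rewrite /r !inE ltnn; case: (i \in A).
rewrite (bigID (fun i => i \in A)) /= [RHS]mulrAC -big_split /=; congr (_ * _).
  apply: eq_bigr => i iA; rewrite /r iA [LHS](bigID (fun j => j \in A)) /=.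
  by congr (_ * _); apply: eq_bigl => j; rewrite !inE; case: (j \in A); rewrite ?andbT ?andbF.
apply: eq_big => [i|i iA]; first by rewrite inE.
by rewrite /r (negPf iA).
Qed.

Lemma prod_neq_pairs f :
  \prod_i \prod_(j | j != i) f i j =
  \prod_(i < n) \prod_(j < n | (i < j)%N) (f i j * f j i).
Proof. exact: (prod_neq_pairs_in xpredT). Qed.

Lemma prod_all_pairs f :
  \prod_i \prod_j f i j =
  \prod_i f i i * \prod_(i < n) \prod_(j < n | (i < j)%N) (f i j * f j i).
Proof.
by rewrite -prod_neq_pairs -big_split /=; apply: eq_bigr => i _; rewrite (bigD1 i).
Qed.

End PairProducts.

Lemma prod_pairs_imset (F : comNzRingType) n (f : 'I_n -> 'I_n -> F) m (h : 'I_m -> 'I_n) :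
  injective h ->
  (forall i j, f i j = f j i) ->
  \prod_(i in h @: 'I_m) \prod_(j in h @: 'I_m | (i < j)%N) f i j =
  \prod_(i < m) \prod_(j < m | (i < j)%N) f (h i) (h j).
Proof.
move=> hi fC; rewrite big_imset /=; last by move=> i j _ _ /hi.
pose r : rel 'I_m := fun i j => (h i < h j)%N.
rewrite -(@prod_tournament _ _ r (fun i j => f (h i) (h j))) //; first last.
- move=> i j ij; rewrite /r -leqNgt [RHS]leq_eqVlt (inj_eq (@ord_inj _)) (inj_eq hi).
  by rewrite (negPf ij).
- by move=> i; rewrite /r ltnn.
apply: eq_bigr => i _; rewrite big_mkcondr big_imset /=; last by move=> j l _ _ /hi.
by rewrite -big_mkcondr.
Qed.

Lemma prod_imset2 (F : comNzRingType) (I J : finType) m (f : I -> J -> F)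
    (h : 'I_m -> I) (l : 'I_m -> J) : injective h -> injective l ->
  \prod_(i in h @: 'I_m) \prod_(j in l @: 'I_m) f i j = \prod_i \prod_j f (h i) (l j).
Proof.
move=> hi li; rewrite big_imset /=; last by move=> i j _ _ /hi.
by apply: eq_bigr => i _; rewrite big_imset //= => j j' _ _ /li.
Qed.

Lemma enum_val_imset (I : finType) (A : {set I}) :
  (fun i : 'I_#|A| => enum_val i) @: 'I_#|A| = A.
Proof.
apply/setP => x; apply/imsetP/idP => [[i _ ->]|xA]; first exact: enum_valP.
by exists (enum_rank_in xA x) => //; rewrite enum_rankK_in.
Qed.

Lemma prod_setC (F : fieldType) (I : finType) (A : {set I}) (f : I -> F) :
  \prod_i f i = \prod_(i in ~: A) f i * \prod_(i in A) f i.
Proof.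
rewrite (bigID (fun i => i \in A)) /= mulrC; congr (_ * _).
by apply: eq_bigl => i; rewrite inE.
Qed.

Section Complements.
Variables (F : fieldType) (I J : finType).
Implicit Types (A : {set I}) (B : {set J}) (f : I -> J -> F).

Lemma prod_setCC A B f :
  (\prod_(i in ~: A) \prod_(j in ~: B) f i j) * (\prod_(i in A) \prod_j f i j) *
  (\prod_(j in B) \prod_i f i j) =
  (\prod_i \prod_j f i j) * (\prod_(i in A) \prod_(j in B) f i j).
Proof.
rewrite (prod_setC A) [X in _ * X = _]exchange_big [X in _ * X = _](prod_setC A) /=.
under [X in _ = X * _ * _]eq_bigr => i _ do rewrite (prod_setC B).
rewrite big_split /=; ring.
Qed.

End Complements.

Lemma prod_neq_setC (F : fieldType) (I : finType) (A : {set I}) (f : I -> I -> F) :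
  (\prod_(s in A) \prod_(i in ~: A) f s i) * (\prod_(s in A) \prod_(i in A | i != s) f s i) =
  \prod_(s in A) \prod_(i | i != s) f s i.
Proof.
rewrite -big_split /=; apply: eq_bigr => s sA.
rewrite [RHS](bigID (fun i => i \in A)) /= mulrC; congr (_ * _).
  by apply: eq_bigl => i; rewrite andbC.
apply: eq_bigl => i; rewrite inE; case: (boolP (i \in A)) => iA; rewrite ?andbF ?andbT //.
by apply/esym; apply: contraNneq iA => ->.
Qed.

(** * Expansion of det (1 + X Y) into minors *)

Section MinorExpansion.
Variable F : comNzRingType.

(** Sylvester's identity: in the block matrix (1, -A; B, 1) either off-diagonal
    block can be eliminated. *)
Lemma det_1D_mulmxC m n (A : 'M[F]_(m, n)) (B : 'M[F]_(n, m)) :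
  \det (1%:M + A *m B) = \det (1%:M + B *m A).
Proof.
have H1 : block_mx 1%:M (- A) B 1%:M =
   block_mx 1%:M 0 B 1%:M *m block_mx 1%:M (- A) 0 (1%:M + B *m A).
  by rewrite mulmx_block !(mul1mx, mul0mx, mulmx1, addr0) mulmxN addrCA addNr addr0.
have H2 : block_mx 1%:M (- A) B 1%:M =
   block_mx 1%:M (- A) 0 1%:M *m block_mx (1%:M + A *m B) 0 B 1%:M.
  by rewrite mulmx_block !(mul1mx, mul0mx, mulmx1, mulmx0, add0r) mulNmx addrK.
have := congr1 determinant H1.
by rewrite {1}H2 !det_mulmx !det_ublock !det_lblock !det1 !mulr1 !mul1r.
Qed.

(** The determinant is affine in every row, so taking each row from 1 or from K
    gives one determinant for each set T of rows taken from K; the other rows are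
    rows of 1, which leaves the principal minor on T. *)
Lemma det_1D_principal n (K : 'M[F]_n) :
  \det (1%:M + K) =
  \sum_(T : {set 'I_n})
    \det (mxsub (fun i : 'I_#|T| => enum_val i) (fun i => enum_val i) K).
Proof.
pose mix (T : {set 'I_n}) : 'M[F]_n :=
  \matrix_(i, j) (if i \in T then K i j else (i == j)%:R).
transitivity (\sum_(T : {set 'I_n}) \det (mix T)).
  rewrite /determinant exchange_big /=; apply: eq_bigr => s _.
  rewrite -mulr_sumr; congr (_ * _).
  under eq_bigr do rewrite !mxE addrC.
  rewrite bigA_distr /=; apply: eq_big => // T _.
  by apply: eq_bigr => i _; rewrite mxE.
apply: eq_bigr => T _.
pose g (a : 'I_#|T|) : 'I_n := enum_val a.
pose J : 'M[F]_(n, #|T|) := \matrix_(i, a) (i == g a)%:R.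
pose L : 'M[F]_(#|T|, n) := \matrix_(a, j) (K (g a) j - (g a == j)%:R).
(* A correction of rank #|T| to the identity: Sylvester's identity then reduces
   the size to #|T|. *)
have -> : mix T = 1%:M + J *m L.
  apply/matrixP => i j; rewrite !mxE.
  case: ifPn => iT; last first.
    rewrite big1 ?addr0 // => a _; rewrite !mxE.
    by case: eqP => [ia|]; [rewrite ia enum_valP in iT|rewrite mul0r].
  rewrite (bigD1 (enum_rank_in iT i)) //= !mxE /g enum_rankK_in // eqxx mul1r.
  rewrite big1 ?addr0 => [|a ane]; first by rewrite addrC subrK.
  rewrite !mxE; case: eqP => [ia|]; last by rewrite mul0r.
  by case/eqP: ane; apply: enum_val_inj; rewrite enum_rankK_in.
rewrite det_1D_mulmxC; congr (\det _); apply/matrixP => a b; rewrite !mxE.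
rewrite (bigD1 (g b)) //= big1 ?addr0 => [|i ib]; last first.
  by rewrite !mxE (negPf ib) mulr0.
rewrite !mxE eqxx mulr1 (inj_eq enum_val_inj) addrC subrK.
by [].
Qed.

Lemma det_mulmx_rows r m (X : 'M[F]_(r, m)) (Y : 'M[F]_(m, r)) :
  \det (X *m Y) =
  \sum_(f : {ffun 'I_r -> 'I_m}) (\prod_i X i (f i)) * \det (rowsub f Y).
Proof.
transitivity (\sum_(s : 'S_r) \sum_(f : {ffun 'I_r -> 'I_m})
    (-1) ^+ s * \prod_i (X i (f i) * Y (f i) (s i))).
  apply: eq_bigr => s _; rewrite -mulr_sumr; congr (_ * _).
  by under eq_bigr do rewrite mxE; rewrite bigA_distr_bigA.
rewrite exchange_big /=; apply: eq_bigr => f _.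
rewrite /determinant mulr_sumr; apply: eq_bigr => s _.
rewrite big_split /= mulrCA; congr (_ * (_ * _)).
by apply: eq_bigr => i _; rewrite !mxE.
Qed.

(** The sum over all maps counts every minor once for each ordering of its
    index set; keeping the orderings avoids choosing one. *)
Lemma Cauchy_Binet r m (X : 'M[F]_(r, m)) (Y : 'M[F]_(m, r)) :
  \det (X *m Y) *+ r`! =
  \sum_(f : {ffun 'I_r -> 'I_m}) \det (colsub f X) * \det (rowsub f Y).
Proof.
rewrite det_mulmx_rows -card_Sn -sumr_const.
transitivity (\sum_(s : 'S_r) \sum_(f : {ffun 'I_r -> 'I_m})
   (\prod_i X i (f (s i))) * \det (rowsub (f \o s) Y)).
  apply: eq_big => [s|s _]; first by rewrite inE.
  rewrite (reindex (fun f : {ffun 'I_r -> 'I_m} => [ffun i => f (s i)])) /=.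
    apply: eq_bigr => f _; congr (_ * _); first by apply: eq_bigr => i _; rewrite ffunE.
    by congr (\det _); apply/matrixP => i j; rewrite !mxE ffunE.
  exists (fun f : {ffun 'I_r -> 'I_m} => [ffun i => f (s^-1%g i)]) => f _;
    by apply/ffunP => i; rewrite !ffunE ?permK ?permKV.
rewrite exchange_big; apply: eq_bigr => f _ /=.
rewrite [\det (colsub _ _)]/determinant mulr_suml; apply: eq_bigr => s _.
have -> : rowsub (f \o s) Y = row_perm s (rowsub f Y).
  by apply/matrixP => i j; rewrite !mxE.
rewrite row_permE det_mulmx det_perm mulrA [_ * (-1) ^+ _]mulrC.
by congr (_ * _ * _); apply: eq_bigr => i _; rewrite !mxE.
Qed.

End MinorExpansion.

(** A set of r elements is the image of r! injections of 'I_r. *)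
Lemma sum_imset_ffun (F : numFieldType) r m (h : {set 'I_m} -> F)
    (w : {ffun 'I_r -> 'I_m} -> F) :
  (forall f : {ffun 'I_r -> 'I_m}, injective f -> w f = h (f @: 'I_r)) ->
  (forall f : {ffun 'I_r -> 'I_m}, ~ injective f -> w f = 0) ->
  \sum_f w f = (\sum_(S : {set 'I_m} | #|S| == r) h S) *+ r`!.
Proof.
move=> winj wninj.
rewrite (bigID (fun f : {ffun 'I_r -> 'I_m} => injectiveb f)) /=.
rewrite [X in _ + X]big1 ?addr0 => [|f /injectiveP/wninj //].
rewrite (partition_big (fun f : {ffun 'I_r -> 'I_m} => f @: 'I_r)
          (fun S => #|S| == r)) /=; last first.
  by move=> f /injectiveP fi; rewrite card_imset // card_ord.
rewrite -sumrMnl; apply: eq_bigr => S /eqP Sr.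
rewrite (eq_bigr (fun=> h S)); last first.
  by move=> f /andP[/injectiveP fi /eqP <-]; apply: winj.
rewrite sumr_const; congr (_ *+ _).
have := card_inj_ffuns_on 'I_r (mem S).
rewrite card_ord [#|mem S|]Sr ffactnn => <-.
apply: eq_card => f; rewrite !inE andbC unfold_in; apply: andb_id2l => /injectiveP fi.
apply/eqP/forallP => [<- i|fS]; first by rewrite imset_f.
apply/eqP; rewrite eqEcard card_imset // card_ord Sr leqnn andbT.
by apply/fintype.subsetP => _ /imsetP[i _ ->]; exact: fS.
Qed.

(** In each principal minor of X Y, the index set S is the image of the map f of
    the Cauchy-Binet sum; a product of two opposite minors depends on f only
    through this image, as swapping two values of f changes both signs. *)
Lemma det_1D_subsets (F : numFieldType) k m (X : 'M[F]_(k, m)) (Y : 'M[F]_(m, k))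
    (h : {set 'I_m} -> {set 'I_k} -> F) :
  (forall (T : {set 'I_k}) (f : {ffun 'I_#|T| -> 'I_m}), injective f ->
     \det (mxsub (fun i : 'I_#|T| => enum_val i) f X) *
     \det (mxsub f (fun i : 'I_#|T| => enum_val i) Y) = h (f @: 'I_#|T|) T) ->
  \det (1%:M + X *m Y) =
    \sum_(S : {set 'I_m}) \sum_(T : {set 'I_k} | #|S| == #|T|) h S T.
Proof.
move=> hE; rewrite det_1D_principal.
rewrite [RHS](exchange_big_dep xpredT) //=; apply: eq_bigr => T _.
have fn0 : ((#|T|)`!%:R : F) != 0 by rewrite pnatr_eq0 -lt0n fact_gt0.
apply: (mulIf fn0); rewrite !mulr_natr.
rewrite -(@sum_imset_ffun F #|T| m (fun S => h S T)
  (fun f => \det (mxsub (fun i : 'I_#|T| => enum_val i) f X) *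
            \det (mxsub f (fun i : 'I_#|T| => enum_val i) Y))).
- have -> : mxsub (fun i : 'I_#|T| => enum_val i) (fun i => enum_val i) (X *m Y) =
    rowsub (fun i : 'I_#|T| => enum_val i) X *m colsub (fun i : 'I_#|T| => enum_val i) Y.
    by apply/matrixP => i j; rewrite !mxE; apply: eq_bigr => l _; rewrite !mxE.
  rewrite Cauchy_Binet; apply: eq_bigr => f _ /=.
  by congr (_ * _); congr (\det _); apply/matrixP => i j; rewrite !mxE.
- by move=> f fi; exact: hE.
- move=> f /injectiveP /injectivePn[i [j ij fij]].
  rewrite [X in _ * X](_ : _ = 0) ?mulr0 //.
  by apply: (determinant_alternate ij) => l; rewrite !mxE fij.
Qed.

Lemma det_scale_rows (F : comNzRingType) m (u : 'I_m -> F) (A : 'I_m -> 'I_m -> F) :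
  \det (\matrix_(i, j) (u i * A i j)) = \prod_i u i * \det (\matrix_(i, j) A i j).
Proof.
have -> : \matrix_(i, j) (u i * A i j) = diag_mx (\row_i u i) *m (\matrix_(i, j) A i j).
  by apply/matrixP => i j; rewrite mul_diag_mx !mxE.
by rewrite det_mulmx det_diag; congr (_ * _); apply: eq_bigr => i _; rewrite mxE.
Qed.

Lemma det_scale_cols (F : comNzRingType) m (v : 'I_m -> F) (A : 'I_m -> 'I_m -> F) :
  \det (\matrix_(i, j) (A i j * v j)) = \det (\matrix_(i, j) A i j) * \prod_i v i.
Proof.
have -> : \matrix_(i, j) (A i j * v j) = (\matrix_(i, j) A i j) *m diag_mx (\row_i v i).
  by apply/matrixP => i j; rewrite mul_mx_diag !mxE.
by rewrite det_mulmx det_diag; congr (_ * _); apply: eq_bigr => i _; rewrite mxE.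
Qed.

(** * Lagrange interpolation and Cauchy's determinant *)

Lemma size_prod_XsubC_neq (F : nzRingType) (I : finType) (x : I -> F) i :
  size (\prod_(j | j != i) ('X - (x j)%:P)) = #|I|.
Proof.
rewrite -big_filter size_prod_XsubC size_filter.
rewrite -sum1_count (eq_bigl [in predC1 i]) // sum1_card cardC1 prednK //.
by apply/card_gt0P; exists i.
Qed.

Section Interpolation.
Variables (F : fieldType) (I : finType) (x : I -> F).
Hypothesis xinj : injective x.

Lemma Lagrange_interpolation (p : {poly F}) : (size p <= #|I|)%N ->
  p = \sum_i (p.[x i] / \prod_(j | j != i) (x i - x j)) *:
        \prod_(j | j != i) ('X - (x j)%:P).
Proof.
move=> sp; apply/eqP; rewrite -subr_eq0; apply/eqP.
set q := (X in p - X).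
have qx i : q.[x i] = p.[x i].
  rewrite /q horner_sum (bigD1 i) //= [X in _ + X]big1 ?addr0 => [|j ji].
    rewrite hornerZ horner_prod.
    under [X in _ * X]eq_bigr do rewrite hornerXsubC.
    rewrite divfK //.
    by apply/prodf_neq0 => j ji; rewrite subr_eq0 (inj_eq xinj) eq_sym.
  rewrite hornerZ horner_prod [X in _ * X](bigD1 i) 1?eq_sym //= hornerXsubC.
  by rewrite subrr mul0r mulr0.
apply: (@roots_geq_poly_eq0 _ _ [seq x i | i : I]).
- by apply/allP => _ /mapP[i _ ->]; rewrite rootE !hornerE qx subrr.
- by rewrite map_inj_uniq ?enum_uniq.
- rewrite size_map -cardE; apply: (leq_trans (size_polyD _ _)).
  rewrite size_polyN geq_max sp /=; apply: (leq_trans (size_sum _ _ _)).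
  apply/bigmax_leqP => i _; apply: (leq_trans (size_scale_leq _ _)).
  by rewrite size_prod_XsubC_neq.
Qed.

(** Comparing the coefficients of degree #|I| - 1 in the interpolation formula
    gives the residue theorem for a rational function with simple poles. *)
Lemma sum_residues_eq0 (p : {poly F}) : (size p < #|I|)%N ->
  \sum_i p.[x i] / \prod_(j | j != i) (x i - x j) = 0.
Proof.
move=> sp; have := congr1 (fun q : {poly F} => q`_(#|I|.-1))
  (Lagrange_interpolation (ltnW sp)).
rewrite nth_default; last by rewrite -ltnS prednK // (leq_ltn_trans _ sp).
rewrite coef_sum => /esym e0; rewrite -[RHS]e0; apply: eq_bigr => i _.
rewrite coefZ -[LHS]mulr1; congr (_ * _).
have /monicP <- : \prod_(j | j != i) ('X - (x j)%:P) \is monic.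
  exact: monic_prod_XsubC.
by rewrite /lead_coef size_prod_XsubC_neq.
Qed.

End Interpolation.

(** With q_j the product of the X - y_l over l != j, the matrix of the q_j(x_i)
    is the Cauchy matrix with row i multiplied by the product of all x_i - y_j,
    while that of the q_j(y_i) is diagonal. Both are a Vandermonde matrix times
    the matrix of the coefficients of the q_j, whose determinant drops out. *)
Lemma det_Cauchy (F : fieldType) n (x y : 'I_n -> F) :
  (forall i j, x i != y j) ->
  \det (\matrix_(i, j) (x i - y j)^-1) =
  \prod_(i < n) \prod_(j < n | (i < j)%N) ((x j - x i) * (y i - y j)) /
  \prod_i \prod_j (x i - y j).
Proof.
move=> xy.
have [/injectiveP yinj|/injectivePn[i [j ij yij]]] := boolP (injectiveb y); last first.
  transitivity (0 : F).
    rewrite -det_tr; apply: (determinant_alternate ij) => l.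
    by rewrite !mxE yij.
  rewrite [X in X / _](_ : _ = 0) ?mul0r //.
  wlog lij : i j ij yij / (i < j)%N => [W|].
    by move: (ij); rewrite -val_eqE neq_ltn => /orP[/W|/W]; apply; rewrite // eq_sym.
  by rewrite (bigD1 i) //= (bigD1 j) //= yij subrr mulr0 !mul0r.
pose q j : {poly F} := \prod_(l | l != j) ('X - (y l)%:P).
have qE j z : (q j).[z] = \prod_(l | l != j) (z - y l).
  by rewrite horner_prod; apply: eq_bigr => l _; rewrite hornerXsubC.
have sq j : (size (q j) <= n)%N.
  by rewrite size_prod_XsubC_neq card_ord.
pose Q : 'M[F]_n := \matrix_(l, j) (q j)`_l.
pose V (z : 'I_n -> F) := Vandermonde n (\row_i z i).
have VQ z : (V z)^T *m Q = \matrix_(i, j) (q j).[z i].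
  apply/matrixP => i j; rewrite !mxE (horner_coef_wide _ (sq j)).
  by apply: eq_bigr => l _; rewrite !mxE mulrC.
have dV z : \det (V z) = \prod_(i < n) \prod_(j < n | (i < j)%N) (z j - z i).
  by rewrite det_Vandermonde; apply: eq_bigr => i _; apply: eq_bigr => j _; rewrite !mxE.
have Vy0 : \det (V y) != 0.
  rewrite dV; apply/prodf_neq0 => i _; apply/prodf_neq0 => j ij.
  by rewrite subr_eq0 (inj_eq yinj) -val_eqE /= gtn_eqF.
have Dy : \det (V y) * \det Q = \prod_i \prod_(j | j != i) (y i - y j).
  rewrite -[\det (V y)]det_tr -det_mulmx VQ.
  rewrite (_ : \matrix_(i, j) _ = diag_mx (\row_i \prod_(j | j != i) (y i - y j))).
    by rewrite det_diag; apply: eq_bigr => i _; rewrite mxE.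
  apply/matrixP => i j; rewrite !mxE qE eq_sym; case: eqP => [->|/eqP ji].
    by rewrite mulr1n.
  by rewrite mulr0n (bigD1 i) 1?eq_sym //= subrr mul0r.
have P0 : \prod_i \prod_j (x i - y j) != 0.
  by apply/prodf_neq0 => i _; apply/prodf_neq0 => j _; rewrite subr_eq0.
have Dx : \det (V x) * \det Q =
    \prod_i \prod_j (x i - y j) * \det (\matrix_(i, j) (x i - y j)^-1).
  rewrite -[\det (V x)]det_tr -det_mulmx VQ.
  rewrite (_ : \prod_i _ = \det (diag_mx (\row_i \prod_j (x i - y j)))); last first.
    by rewrite det_diag; apply: eq_bigr => i _; rewrite mxE.
  rewrite -det_mulmx; congr (\det _); apply/matrixP => i j.
  rewrite mul_diag_mx !mxE qE [in RHS](bigD1 j) //= mulrAC mulfV ?mul1r //.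
  by rewrite subr_eq0.
apply: (mulfI P0); rewrite -Dx [RHS]mulrC divfK //.
apply: (mulfI Vy0); rewrite mulrCA Dy prod_neq_pairs !dV -!big_split /=.
apply: eq_bigr => i _; rewrite -!big_split /=; apply: eq_bigr => j _.
ring.
Qed.

(** * Minors of polynomials annihilated by linear forms *)

(** Expanding n times along the first column, which has the single nonzero entry
    tau, in row k. *)
Lemma det_staircase (F : comNzRingType) (k n N : nat) (g : nat -> nat -> F) (tau : F) :
  N = (k + n)%N ->
  (forall i j, (i < k)%N -> (j < n)%N -> g i j = 0) ->
  (forall i j, (j < i)%N -> (j < n)%N -> g (k + i)%N j = 0) ->
  (forall j, (j < n)%N -> g (k + j)%N j = tau) ->
  \det (\matrix_(i < N, j < N) g i j) =
  ((-1) ^+ k * tau) ^+ n * \det (\matrix_(i < k, j < k) g i (n + j)%N).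
Proof.
elim: n N g => [|n IHn] N g.
  by rewrite addn0 => -> _ _ _; rewrite expr0 mul1r; congr (\det _).
rewrite addnS => -> g0 glow gdiag.
have kN : (k < (k + n).+1)%N by rewrite ltnS leq_addr.
rewrite (expand_det_col _ ord0) (bigD1 (Ordinal kN)) //= big1 ?addr0; last first.
  move=> i ik; rewrite mxE /=.
  case: (ltngtP i k) => [lik|lki|eik].
  - by rewrite g0 ?mul0r.
  - by rewrite -(subnKC (ltnW lki)) glow ?mul0r // subn_gt0.
  - by case/eqP: ik; apply: val_inj.
have gk0 : g k 0 = tau by rewrite -[in LHS](addn0 k) gdiag.
rewrite mxE /= gk0 /cofactor /= addn0.
set R := row' _ _.
have -> : R = \matrix_(i < k + n, j < k + n) g (bump k i) j.+1.
  by apply/matrixP => i j; rewrite !mxE.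
rewrite (IHn (k + n)%N (fun i j => g (bump k i) j.+1)) //.
- rewrite exprS -!mulrA mulrCA; congr (_ * _); congr (_ * _); congr (_ * _).
  congr (\det _); apply/matrixP => i j; rewrite !mxE /= addSn.
  by rewrite /bump leqNgt ltn_ord.
- by move=> i j ik jn; rewrite /bump leqNgt ik g0.
- by move=> i j ji jn; rewrite /bump leq_addr add1n -addnS glow.
- by move=> j jn; rewrite /bump leq_addr add1n -addnS gdiag.
Qed.

Section AnnihilatedMinors.
Variables (F : comNzRingType) (k n : nat) (lam : nat -> {poly F} -> F).
Variables (P v : nat -> {poly F}) (tau : F).
Hypothesis lamE : forall r (p : {poly F}) N, (size p <= N)%N ->
  lam r p = \sum_(l < N) p`_l * lam r 'X^l.
Hypothesis sP : forall j, (size (P j) <= (j + k).+1)%N.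
Hypothesis tP : forall j, (P j)`_(j + k) = tau.
Hypothesis lamP : forall r j, lam r (P j) = 0.
Hypothesis sv : forall i, (size (v i) <= k)%N.

(** Evaluate the k functionals and the coefficients of degree at least k on the
    n + k polynomials P_j, X^n v_i in two ways: the functionals vanish on the
    P_j, and the P_j have a staircase of leading terms. *)
Lemma det_annihilated :
  \det (\matrix_(i < n, j < n) (P j)`_i) * \det (\matrix_(r < k, i < k) lam r (v i)) =
  ((-1) ^+ k * tau) ^+ n * \det (\matrix_(r < k, i < k) lam r ('X^n * v i)).
Proof.
pose N := (k + n)%N.
pose col j : {poly F} := if (j < n)%N then P j else 'X^n * v (j - n)%N.
have scol j : (j < N)%N -> (size (col j) <= N)%N.
  rewrite /col /N => jN; case: ltnP => jn.
    by apply: leq_trans (sP j) _; rewrite addnC -addnS leq_add2l.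
  apply: leq_trans (size_polyMleq _ _) _; rewrite size_polyXn addSn /=.
  by rewrite addnC leq_add2r.
pose Lm : 'M[F]_N := \matrix_(i < N, l < N)
  (if (i < k)%N then lam i 'X^l else (i == l)%:R).
pose Q : 'M[F]_N := \matrix_(l < N, j < N) (col j)`_l.
pose Vv : 'M[F]_k := \matrix_(l < k, i < k) (v i)`_l.
pose L0 : 'M[F]_k := \matrix_(r < k, l < k) lam r 'X^l.
have L0V : L0 *m Vv = \matrix_(r < k, i < k) lam r (v i).
  apply/matrixP => r i; rewrite !mxE (lamE _ (sv i)).
  by apply: eq_bigr => l _; rewrite !mxE mulrC.
have dL : \det Lm = \det L0.
  have -> : Lm = block_mx L0 (\matrix_(r < k, l < n) lam r 'X^(k + l)) 0 1%:M.
    rewrite -[LHS]submxK; congr block_mx; apply/matrixP => i j; rewrite !mxE /=.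
    - by rewrite ltn_ord.
    - by rewrite ltn_ord.
    - by rewrite ltnNge leq_addr /= -val_eqE /= eqn_leq leqNgt
        (leq_trans (ltn_ord j) (leq_addr _ _)).
    - by rewrite ltnNge leq_addr /= (inj_eq (@rshift_inj _ _)).
  by rewrite det_ublock det1 mulr1.
have dQ : \det Q = \det (\matrix_(i < n, j < n) (P j)`_i) * \det Vv.
  have -> : \det Q = \det (\matrix_(l < n + k, j < n + k) (col j)`_l).
    by rewrite /Q /N addnC.
  set Q' := (X in \det X).
  have -> : Q' = block_mx (\matrix_(i < n, j < n) (P j)`_i) 0
      (\matrix_(i < k, j < n) (P j)`_(n + i)) Vv.
    rewrite -[LHS]submxK; congr block_mx; apply/matrixP => i j; rewrite !mxE /=.
    - by rewrite /col ltn_ord.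
    - by rewrite /col ltnNge leq_addr /= coefXnM ltn_ord.
    - by rewrite /col ltn_ord.
    - by rewrite /col ltnNge leq_addr /= coefXnM ltnNge leq_addr /= !addKn.
  by rewrite det_lblock.
have LQ : Lm *m Q = \matrix_(i < N, j < N)
    (if (i < k)%N then lam i (col j) else (col j)`_i).
  apply/matrixP => i j; rewrite !mxE.
  case: ltnP => ik.
    rewrite (lamE i (scol _ (ltn_ord j))); apply: eq_bigr => l _.
    by rewrite !mxE ik mulrC.
  rewrite (bigD1 i) //= !mxE ltnNge ik eqxx mul1r big1 ?addr0 // => l li.
  by rewrite !mxE ltnNge ik /= eq_sym (negPf li) mul0r.
rewrite -L0V det_mulmx mulrCA -dQ -dL -det_mulmx LQ.
rewrite (@det_staircase F k n N (fun i j => if (i < k)%N then lam i (col j) else (col j)`_i) tau) //.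
- congr (_ * \det _); apply/matrixP => r i; rewrite !mxE ltn_ord.
  by rewrite /col ltnNge leq_addr addKn.
- by move=> i j ik jn; rewrite ik /col jn lamP.
- move=> i j ji jn; rewrite ltnNge leq_addr /= /col jn nth_default //.
  by apply: leq_trans (sP j) _; rewrite addnC -addnS leq_add2l.
- by move=> j jn; rewrite ltnNge leq_addr /= /col jn addnC tP.
Qed.

End AnnihilatedMinors.

(** * Reversal of polynomials *)

Section Reversal.
Variable F : comNzRingType.
Implicit Types p q : {poly F}.

Lemma coefM_top p q m n : (size p <= m.+1)%N -> (size q <= n.+1)%N ->
  (p * q)`_(m + n) = p`_m * q`_n.
Proof.
move=> sp sq; rewrite coefM.
have lm : (m < (m + n).+1)%N by rewrite ltnS leq_addr.
rewrite (bigD1 (Ordinal lm)) //= big1 ?addr0 ?addKn // => i im.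
case: (ltngtP i m) => [lim|lmi|eim].
- rewrite [q`_ _]nth_default ?mulr0 //; apply: leq_trans sq _.
  by rewrite -addnBAC ?(ltnW lim) // -[X in (X < _)%N]add0n ltn_add2r subn_gt0.
- by rewrite nth_default ?mul0r //; apply: leq_trans sp _.
- by case/eqP: im; apply: val_inj.
Qed.

(** The polynomial z^N p(1/z). *)
Definition revp N p : {poly F} := \sum_(i < N.+1) p`_i *: 'X^(N - i).

Lemma revp_is_linear N : linear (revp N).
Proof.
move=> a p q; rewrite /revp scaler_sumr -big_split /=; apply: eq_bigr => i _.
by rewrite coefD coefZ scalerDl scalerA.
Qed.
HB.instance Definition _ N := GRing.isLinear.Build F {poly F} {poly F} _ (revp N)
  (revp_is_linear N).

Lemma revpXn N i : (i <= N)%N -> revp N 'X^i = 'X^(N - i).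
Proof.
move=> iN; have iN1 : (i < N.+1)%N by [].
rewrite /revp (bigD1 (Ordinal iN1)) //= coefXn eqxx scale1r big1 ?addr0 // => j ji.
by rewrite coefXn -val_eqE /= in ji *; rewrite (negPf ji) scale0r.
Qed.

Lemma revp1 N : revp N 1 = 'X^N.
Proof. by rewrite -(expr0 'X) revpXn // subn0. Qed.

Lemma revp_1X : revp 1 'X = 1.
Proof. by rewrite -['X in LHS]expr1 revpXn. Qed.

Lemma revpM M N p q : (size p <= M.+1)%N -> (size q <= N.+1)%N ->
  revp (M + N) (p * q) = revp M p * revp N q.
Proof.
move=> sp sq; rewrite -{1}[p](coefK p) -{1}[q](coefK q).
have e K (r : {poly F}) : (size r <= K.+1)%N -> r = \sum_(i < K.+1) r`_i *: 'X^i.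
  by move=> sr; rewrite -[LHS](coefK r) poly_def (big_ord_widen _ (fun i => r`_i *: 'X^i) sr)
   big_mkcond /=; apply: eq_bigr => i _; case: ltnP => // /(nth_default 0) ->; rewrite scale0r.
rewrite !coefK {1}(e _ _ sp) {1}(e _ _ sq) mulr_suml linear_sum /= [RHS]mulr_suml.
apply: eq_bigr => i _; rewrite mulr_sumr linear_sum /= [RHS]mulr_sumr.
apply: eq_bigr => j _; rewrite -scalerAl -scalerAr scalerA linearZ /= -exprD.
have iM : (i <= M)%N by rewrite -ltnS.
have jN : (j <= N)%N by rewrite -ltnS.
rewrite revpXn ?leq_add // -scalerAl -scalerAr scalerA -exprD.
by congr (_ *: 'X^_); rewrite subnDA -addnBAC // -addnBA.
Qed.

Lemma coef_revp N p i : (i <= N)%N -> (revp N p)`_i = p`_(N - i).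
Proof.
move=> iN; rewrite /revp coef_sum.
have lN : (N - i < N.+1)%N by rewrite ltnS leq_subr.
rewrite (bigD1 (Ordinal lN)) //= coefZ coefXn subKn // eqxx mulr1 big1 ?addr0 //.
move=> j ji; rewrite coefZ coefXn; case: eqP => [e|]; last by rewrite mulr0.
by case/eqP: ji; apply: val_inj; rewrite /= e subKn // -ltnS.
Qed.

Lemma size_revp N p : (size (revp N p) <= N.+1)%N.
Proof.
apply: (leq_trans (size_sum _ _ _)); apply/bigmax_leqP => i _.
by apply: (leq_trans (size_scale_leq _ _)); rewrite size_polyXn ltnS leq_subr.
Qed.

Definition palindromic N p := (size p <= N.+1)%N /\ revp N p = p.

Lemma palindromicM M N p q :
  palindromic M p -> palindromic N q -> palindromic (M + N) (p * q).
Proof.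
move=> [sp ep] [sq eq]; split; last by rewrite revpM ?ep ?eq.
apply: leq_trans (size_polyMleq _ _) _.
by case: (size p + size q)%N (leq_add sp sq) => // s; rewrite addSn addnS.
Qed.
End Reversal.

(** * Wiener-Hopf splitting *)

Section ReciprocalPairs.
Variable F : fieldType.

Definition rootp n (z : 'I_n -> F) : {poly F} := \prod_i ('X - (z i)%:P).

Definition recp n (z : 'I_n -> F) : {poly F} := \prod_i (1 - z i *: 'X).

Lemma rootp_monic n (z : 'I_n -> F) : rootp z \is monic.
Proof. exact: monic_prod_XsubC. Qed.

Lemma size_rootp n (z : 'I_n -> F) : size (rootp z) = n.+1.
Proof. by rewrite /rootp size_prod_XsubC /index_enum -enumT size_enum_ord. Qed.

Lemma horner_rootp n (z : 'I_n -> F) x : (rootp z).[x] = \prod_i (x - z i).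
Proof. by rewrite horner_prod; apply: eq_bigr => i _; rewrite hornerXsubC. Qed.

Lemma horner_1subZX (a x : F) : (1 - a *: 'X : {poly F}).[x] = 1 - a * x.
Proof. by rewrite !hornerE. Qed.

Lemma horner_recp n (z : 'I_n -> F) x : (recp z).[x] = \prod_i (1 - z i * x).
Proof. by rewrite horner_prod; apply: eq_bigr => i _; rewrite horner_1subZX. Qed.

Lemma size_1subZX (a : F) : (size (1 - a *: 'X : {poly F})%R <= 2)%N.
Proof.
apply: leq_trans (size_polyD _ _) _; rewrite size_polyN geq_max size_poly1 /=.
by apply: leq_trans (size_scale_leq _ _) _; rewrite size_polyX.
Qed.

Lemma size_prod_1subZX (I : finType) (P : pred I) (z : I -> F) :
  (size (\prod_(i | P i) (1 - z i *: 'X) : {poly F})%R <= #|P|.+1)%N.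
Proof.
apply: leq_trans (size_prod_leq _ _) _.
rewrite leq_subLR; apply: (@leq_trans (\sum_(i | P i) 2).+1).
  by rewrite ltnS; apply: leq_sum => i _; exact: size_1subZX.
by rewrite sum_nat_const muln2 -addnn addnS.
Qed.

Lemma size_recp n (z : 'I_n -> F) : (size (recp z) <= n.+1)%N.
Proof. by have := size_prod_1subZX xpredT z; rewrite card_ord. Qed.

Lemma coef_recp_top n (z : 'I_n -> F) : (recp z)`_n = \prod_i (- z i).
Proof.
elim: n z => [|n IHn] z; first by rewrite /recp !big_ord0 coef1.
rewrite /recp !big_ord_recr /= -[X in _`_X]addn1 coefM_top ?size_1subZX //.
  by rewrite (IHn (fun i => z (widen_ord (leqnSn n) i))) coefB coef1 coefZ coefX mulr1 sub0r.
exact: (size_recp (fun i => z (widen_ord (leqnSn n) i))).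
Qed.

Lemma coef0_recp n (z : 'I_n -> F) : (recp z)`_0 = 1.
Proof.
by rewrite -horner_coef0 horner_recp big1 // => i _; rewrite mulr0 subr0.
Qed.

Lemma coprime_recp n m (d : 'I_n -> F) (c : 'I_m -> F) r :
  (forall i j, c i * d j != 1) -> coprimep (recp d) ('X^r * rootp c).
Proof.
move=> cd; rewrite coprimepMr coprimep_expr /=; last first.
  rewrite coprimepX rootE horner_coef0.
  by rewrite coef0_recp oner_eq0.
rewrite /rootp; elim/big_rec: _ => [|i q _ cq]; first exact: coprimep1.
rewrite coprimepMr cq andbT coprimep_XsubC rootE horner_recp.
by apply/prodf_neq0 => j _; rewrite subr_eq0 eq_sym mulrC cd.
Qed.

Lemma revp_rootp n (z : 'I_n -> F) : revp n (rootp z) = recp z.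
Proof.
elim: n z => [|n IHn] z.
  by rewrite /rootp /recp !big_ord0 revp1.
rewrite /rootp /recp !big_ord_recr /= -[X in revp X]addn1 revpM ?size_XsubC //.
  rewrite (IHn (fun i => z (widen_ord (leqnSn n) i))); congr (_ * _).
  by rewrite raddfB /= revp_1X -alg_polyC linearZ /= revp1 expr1.
by rewrite (size_rootp (fun i => z (widen_ord (leqnSn n) i))).
Qed.

Lemma revp_recp n (z : 'I_n -> F) : revp n (recp z) = rootp z.
Proof.
rewrite -revp_rootp; apply/polyP => i; case: (leqP i n) => ni.
  by rewrite !coef_revp ?leq_subr // subKn.
by rewrite !nth_default ?size_rootp // (leq_trans (size_revp _ _)).
Qed.

Lemma palindromic_XDXn n : palindromic n.+1 ('X^(n.+1) + 1 : {poly F}).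
Proof.
split; first by rewrite -[1]/(1%:P) size_XnaddC.
by rewrite raddfD /= revpXn // revp1 subnn expr0 addrC.
Qed.

Lemma palindromic_prod (I : finType) (P : pred I) (b : I -> F) :
  palindromic #|P|.*2 (\prod_(i | P i) (('X - (b i)%:P) * (1 - b i *: 'X))).
Proof.
have -> : #|P| = size [seq i <- index_enum I | P i].
  by rewrite size_filter -sum1_count sum1_card.
rewrite -big_filter; elim: [seq _ <- _ | _] => [|i s IHs] /=.
  rewrite big_nil; split; first by rewrite size_poly1.
  by rewrite revp1.
rewrite big_cons doubleS -[X in palindromic X]add2n; apply: palindromicM => //.
have sX : (size ('X - (b i)%:P : {poly F})%R <= 2)%N by rewrite size_XsubC.
split.
  apply: leq_trans (size_polyMleq _ _) _.
  by rewrite size_XsubC /= ltnS size_1subZX.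
rewrite -[X in revp X]addn1 revpM ?size_1subZX // mulrC.
by rewrite !raddfB /= -alg_polyC !linearZ /= revp_1X !revp1 expr1.
Qed.

End ReciprocalPairs.

Section Splitting.
Variables (F : numFieldType) (k : nat).
Implicit Types a b c d : 'I_k -> F.

(** The polynomial form of w_j = z^j + z^(-j-1). *)
Definition wpoly j : {poly F} := 'X^((j + j).+1) + 1.

(** A Bezout identity for the coprime polynomials recp d and 'X^(j.+1) * rootp c.
    Reducing modulo the second one bounds the degree of N; as N * recp d then has
    lower degree than the left-hand side, the leading term of P is the one of the
    left-hand side. *)
Lemma Wiener_Hopf_split a b c d j : (forall i l, c i * d l != 1) ->
  exists P N : {poly F},
  [/\ rootp a * recp b * wpoly j = 'X^(j.+1) * P * rootp c + N * recp d,
      (size N <= j.+1 + k)%N, (size P <= (j + k).+1)%N &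
      P`_(j + k) = \prod_i (- b i)].
Proof.
move=> cd; set f := rootp a * _ * _.
have /Bezout_eq1_coprimepP[[u v] /= uv] := coprime_recp j.+1 cd.
set Q := 'X^(j.+1) * rootp c in uv *.
have Qmon : Q \is monic by rewrite rpredM ?rootp_monic ?monicXn.
have sQ : size Q = (j.+1 + k).+1.
  by rewrite size_monicM ?monicXn ?monic_neq0 ?rootp_monic // size_polyXn size_rootp addnS.
pose N := (f * u) %% Q; pose P := f * v + ((f * u) %/ Q) * recp d.
have E : f = Q * P + N * recp d.
  rewrite -[LHS]mulr1 -uv mulrDr mulrA {1}(divp_eq (f * u) Q) -/N /P.
  ring.
have sN : (size N <= j.+1 + k)%N by rewrite -ltnS -sQ ltn_modp monic_neq0.
have sf1 : (size (rootp a * recp b)%R <= (k + k).+1)%N.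
  apply: leq_trans (size_polyMleq _ _) _; rewrite size_rootp addSn /=.
  by rewrite -addnS leq_add2l size_recp.
have sw : (size (wpoly j) <= (j + j).+2)%N.
  by rewrite /wpoly -[1]/(1%:P) size_XnaddC.
have sf : (size f <= ((k + k) + (j + j).+1).+1)%N.
  apply: leq_trans (size_polyMleq _ _) _.
  by case: (size _ + size _)%N (leq_add sf1 sw) => // s; rewrite addSn addnS.
have sNd : (size (N * recp d)%R <= j.+1 + k + k)%N.
  apply: leq_trans (size_polyMleq _ _) _.
  by case: (size _ + size _)%N (leq_add sN (size_recp d)) => // s; rewrite addnS.
have sQP : (size (Q * P)%R <= ((k + k) + (j + j).+1).+1)%N.
  rewrite (_ : Q * P = f - N * recp d); last by rewrite [X in X - _]E addrK.
  apply: leq_trans (size_polyD _ _) _; rewrite size_polyN geq_max sf.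
  by apply: leq_trans sNd _; lia.
have sP : (size P <= (j + k).+1)%N.
  have [->|P0] := eqVneq P 0; first by rewrite size_poly0.
  by move: sQP; rewrite size_monicM // sQ; lia.
exists P, N; split => //; first by rewrite E /Q; ring.
have eN : (j.+1 + k + (j + k) = (k + k) + (j + j).+1)%N.
  by lia.
have := coefM_top (p := Q) (q := P) (m := (j.+1 + k)%N) (n := (j + k)%N).
rewrite sQ => /(_ (leqnn _) sP).
have -> : Q`_(j.+1 + k) = 1 by move/monicP: Qmon; rewrite /lead_coef sQ.
rewrite mul1r eN => <-.
rewrite (_ : Q * P = f - N * recp d); last by rewrite [X in X - _]E addrK.
rewrite coefB [X in _ - X]nth_default ?subr0; last first.
  by apply: leq_trans sNd _; lia.
rewrite coefM_top // coefM_top ?size_recp ?size_rootp //.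
rewrite coef_recp_top coefD coefXn eqxx coef1 addr0 mulr1.
by have /monicP := rootp_monic a; rewrite /lead_coef size_rootp /= => ->; rewrite mul1r.
Qed.

(** For an antipalindromic f the differential f / (z^(j+1) rootp d recp d) dz
    is invariant under z -> 1/z, which exchanges the two groups of poles, so
    its residues at 0 and at the roots of rootp d add up to zero. In the
    decomposition this is the absence of a term of degree k + j in U. *)
Lemma antipalindromic_split d j (f : {poly F}) : (forall i l, d i * d l != 1) ->
  (size f <= (k + j + (k + j)).+1)%N -> revp (k + j + (k + j)) f = - f ->
  exists U V : {poly F}, f = U * recp d + V * ('X^(j.+1) * rootp d) /\
    (size U <= k + j)%N.
Proof.
move=> dd sf ef.
have /Bezout_eq1_coprimepP[[u v] /= uv] := coprime_recp j.+1 dd.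
set Q := 'X^(j.+1) * rootp d in uv *.
have Qmon : Q \is monic by rewrite rpredM ?rootp_monic ?monicXn.
have sQ : size Q = (k + j).+2.
  by rewrite size_monicM ?monicXn ?monic_neq0 ?rootp_monic // size_polyXn size_rootp; lia.
pose U := (f * u) %% Q; pose V := f * v + ((f * u) %/ Q) * recp d.
have E : f = U * recp d + V * Q.
  rewrite -[LHS]mulr1 -uv mulrDr mulrA {1}(divp_eq (f * u) Q) -/U /V.
  ring.
have sU : (size U <= (k + j).+1)%N by rewrite -ltnS -sQ ltn_modp monic_neq0.
exists U, V; split => //.
have sV : (size V <= k + j)%N.
  have [->|V0] := eqVneq V 0; first by rewrite size_poly0.
  have : (size (V * Q)%R <= (k + j + (k + j)).+1)%N.
    rewrite (_ : V * Q = f - U * recp d); last by rewrite [X in X - _]E addrC addKr.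
    apply: leq_trans (size_polyD _ _) _; rewrite size_polyN geq_max sf /=.
    by apply: leq_trans (size_polyM_le sU (size_recp d)) _; lia.
  by rewrite mulrC size_monicM // sQ; lia.
(* Reversing the decomposition of f exchanges recp d and rootp d; comparing with
   the opposite of f leaves the constant c below, for which c = - c. *)
pose U' := revp (k + j) U; pose V' := revp (k + j).-1 V.
have E' : - f = U' * ('X^j * rootp d) + V' * recp d.
  rewrite -ef {1}E raddfD /=; congr (_ + _).
    rewrite (_ : (k + j + (k + j) = (k + j) + (j + k))%N); last by lia.
    rewrite revpM //; last by apply: leq_trans (size_recp d) _; lia.
    congr (_ * _); rewrite -[recp d]mul1r revpM ?size_recp ?size_poly1 //.
    by rewrite revp1 revp_recp.
  have [V0|V0] := eqVneq V 0; first by rewrite /V' V0 mul0r !raddf0 mul0r.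
  have kj : (0 < k + j)%N by move: V0 sV; rewrite -size_poly_gt0; lia.
  rewrite (_ : (k + j + (k + j) = (k + j).-1 + (j.+1 + k))%N); last by lia.
  rewrite revpM ?prednK // ?sQ; last by lia.
  congr (_ * _); rewrite revpM ?size_polyXn ?size_rootp //.
  by rewrite revpXn // subnn expr0 mul1r revp_rootp.
have H0 : (U + V') * recp d + ('X^j * rootp d) * (V * 'X + U') = 0.
  have : f + - f = 0 by rewrite subrr.
  rewrite {1}E E' /Q exprS => <-; ring.
have sV' : (size V' <= k + j)%N.
  have [V0|V0] := eqVneq V 0; first by rewrite /V' V0 raddf0 size_poly0.
  have kj : (0 < k + j)%N by move: V0 sV; rewrite -size_poly_gt0; lia.
  by apply: leq_trans (size_revp _ _) _; rewrite prednK.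
have Qj : 'X^j * rootp d \is monic by rewrite rpredM ?rootp_monic ?monicXn.
have sQj : size ('X^j * rootp d) = (k + j).+1.
  by rewrite size_monicM ?monicXn ?monic_neq0 ?rootp_monic // size_polyXn size_rootp; lia.
have dvd : 'X^j * rootp d %| U + V'.
  rewrite -(@Gauss_dvdpl _ _ (recp d)); last by rewrite coprimep_sym coprime_recp.
  have -> : (U + V') * recp d = - (V * 'X + U') * ('X^j * rootp d).
    by apply: subr0_eq; rewrite -[RHS]H0; ring.
  exact: dvdp_mull.
have [c cE] : exists c : F, U + V' = c *: ('X^j * rootp d).
  move/dvdpP: dvd => [r rE]; have [r0|r0] := eqVneq r 0.
    by exists 0; rewrite rE r0 mul0r scale0r.
  have : (size (U + V')%R <= (k + j).+1)%N.
    by apply: leq_trans (size_polyD _ _) _; rewrite geq_max sU (leq_trans sV').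
  rewrite rE mulrC size_monicM // sQj /= => sr.
  have /size1_polyC -> : (size r <= 1)%N by rewrite -(leq_add2l (k + j)) addn1.
  by exists r`_0; rewrite mulrC mul_polyC.
have dE : V * 'X + U' = - c *: recp d.
  apply: (mulfI (monic_neq0 Qj)); apply: subr0_eq.
  by rewrite -[RHS]H0 cE -!mul_polyC polyCN; ring.
have cU : U`_(k + j) = c.
  have := congr1 (fun p : {poly F} => p`_(k + j)) cE.
  rewrite coefD coefZ [V'`_ _]nth_default // addr0 => ->.
  by have /monicP := Qj; rewrite /lead_coef sQj /= => ->; rewrite mulr1.
have cU' : U`_(k + j) = - c.
  have := congr1 (fun p : {poly F} => p`_0) dE.
  by rewrite coefD coefMX /= add0r coefZ coef0_recp mulr1 coef_revp // subn0.
have c0 : c = 0.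
  by apply/eqP; rewrite -[_ == 0](mulrn_eq0 c 2) mulr2n -{1}cU cU' addNr.
have [//|lt] := leqP (size U) (k + j).
have : lead_coef U = 0.
  by rewrite /lead_coef (_ : size U = (k + j).+1) /= ?cU ?c0 //; apply/eqP; rewrite eqn_leq sU.
by move/eqP; rewrite lead_coef_eq0 => /eqP U0; rewrite U0 size_poly0 in lt.
Qed.

End Splitting.

(** * Linear forms that vanish on the polynomials P_j *)

Section ResidueFunctionals.
Variables (F : numFieldType) (k n : nat).
Variables (e : 'I_(k + k) -> F) (b c : 'I_k -> F).
Let a i := e (lshift k i).
Let d i := e (rshift k i).
Hypothesis b0 : forall i, b i != 0.
Hypothesis binj : injective b.
Hypothesis e0 : forall i, e i != 0.
Hypothesis einj : injective e.
Hypothesis bb : forall i j, b i * b j != 1.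
Hypothesis eb : forall i j, e i * b j != 1.
Hypothesis eNb : forall i j, e i != b j.
Hypothesis ed : forall i j, e i * d j != 1.
Hypothesis bc : forall i j, b i * c j != 1.
Hypothesis cd : forall i j, c i * d j != 1.

(** None stands for the node that depends on r. *)
Definition node r (o : option 'I_(k + k)) : F := if o is Some i then e i else (b r)^-1.

(** The factor 1 - 'X has the effect that kap r, multiplied by the product of the
    1 - b_i 'X for i != r, is antipalindromic. *)
Definition kap r : {poly F} := (1 - 'X) * \prod_(j | j != r) ('X - (b j)%:P).

(** The residue at node r o of kap r * rootp c / (recp d * q), where q is the monic
    polynomial whose roots are the nodes; hence lam r p is the sum of the residues
    at the nodes after multiplication by p. *)
Definition weight r o : F :=
  (kap r * rootp c).[node r o] / (recp d).[node r o] /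
    \prod_(o' | o' != o) (node r o - node r o').

Definition lam r (p : {poly F}) : F := \sum_o weight r o * p.[node r o].

Lemma node_inj r : injective (node r).
Proof.
move=> [i|] [j|] //= ; first by move/einj ->.
- by move=> ei; have := eb i r; rewrite ei mulVf ?b0 // eqxx.
- by move=> ei; have := eb j r; rewrite -ei mulVf ?b0 // eqxx.
Qed.

Lemma recp_node r o : (recp d).[node r o] != 0.
Proof.
rewrite horner_recp; apply/prodf_neq0 => i _; rewrite subr_eq0 eq_sym.
case: o => [j|] /=; first by rewrite mulrC ed.
apply/eqP => db; have := eNb (rshift k i) r; rewrite -/(d i).
by rewrite -[d i](mulfVK (b0 r)) db mul1r eqxx.
Qed.

Lemma size_kap r : (size (kap r) <= k.+1)%N.
Proof.
have k0 := leq_ltn_trans (leq0n _) (ltn_ord r).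
have s1 : (size (1 - 'X : {poly F})%R <= 2)%N.
  by rewrite -opprB size_polyN -[1]/(1%:P) size_XsubC.
apply: leq_trans (size_polyM_le (n := k.-1) s1 _) _; last by lia.
by rewrite size_prod_XsubC_neq card_ord prednK.
Qed.

Lemma rootp_split : rootp e = rootp a * rootp d.
Proof. by rewrite /rootp big_split_ord. Qed.

Lemma recp_b r : recp b = (- b r) *: ('X - (b r)^-1%:P) * \prod_(j | j != r) (1 - b j *: 'X).
Proof.
rewrite /recp (bigD1 r) //=; congr (_ * _).
rewrite scalerBr !scaleNr opprK -[(b r)^-1%:P]alg_polyC scalerA mulfV //.
by rewrite scale1r addrC.
Qed.

Lemma kap_antipal r j :
  let f := kap r * \prod_(i | i != r) (1 - b i *: 'X) * wpoly F j in
  (size f <= (k + j + (k + j)).+1)%N /\ revp (k + j + (k + j)) f = - f.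
Proof.
pose N := #|[pred i : 'I_k | i != r]|.
have EN : (k + j + (k + j) = 1 + (N.*2 + (j + j).+1))%N.
  have : #|[pred i : 'I_k | i != r]| = k.-1 by rewrite cardC1 card_ord.
  rewrite -/N => ->; have := leq_ltn_trans (leq0n _) (ltn_ord r); lia.
have [sg eg] := palindromicM (palindromic_prod [pred i : 'I_k | i != r] b)
                 (palindromic_XDXn F (j + j)).
have -> : kap r * \prod_(i | i != r) (1 - b i *: 'X) * wpoly F j =
   (1 - 'X) * (\prod_(i | i != r) (('X - (b i)%:P) * (1 - b i *: 'X)) *
   ('X^((j + j).+1) + 1)).
  by rewrite /kap /wpoly big_split /=; ring.
rewrite EN; have s1 : (size (1 - 'X : {poly F})%R <= 2)%N.
  by rewrite -opprB size_polyN -[1]/(1%:P) size_XsubC.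
split; first exact: leq_trans (size_polyM_le s1 sg) _.
by rewrite revpM // eg -mulNr; congr (_ * _); rewrite raddfB /= revp1 revp_1X expr1 opprB.
Qed.

(** Multiplied by kap r, the left-hand side contains the antipalindromic polynomial
    of kap_antipal. Splitting this one too shows that kap r * rootp c * P takes at
    the nodes the values of Y' * recp d, where the degree of Y' is at least 2 less
    than the number of nodes; and such a Y' has residues with sum zero. *)
Lemma lam_split r j (P N : {poly F}) :
  rootp a * recp b * wpoly F j = 'X^(j.+1) * P * rootp c + N * recp d ->
  (size N <= j.+1 + k)%N -> lam r P = 0.
Proof.
move=> E sN; have [sf ef] := kap_antipal r j.
have dd i l : d i * d l != 1 by exact: ed.
have [U [V [fE sU]]] := antipalindromic_split dd sf ef.
pose q1 := 'X - (b r)^-1%:P; pose Y := (- b r) *: (q1 * rootp a * U) - kap r * N.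
have EY : 'X^(j.+1) * (kap r * rootp c * P) =
    Y * recp d + (- b r) *: (q1 * rootp a * rootp d * V) * 'X^(j.+1).
  have -> : 'X^(j.+1) * (kap r * rootp c * P) = kap r * ('X^(j.+1) * P * rootp c) by ring.
  have -> : 'X^(j.+1) * P * rootp c = rootp a * recp b * wpoly F j - N * recp d.
    by rewrite E addrK.
  have -> : kap r * (rootp a * recp b * wpoly F j - N * recp d) =
    (- b r) *: q1 * rootp a * (kap r * \prod_(i | i != r) (1 - b i *: 'X) * wpoly F j)
     - kap r * N * recp d by rewrite (recp_b r) -/q1; ring.
  by rewrite fE /Y -!mul_polyC; ring.
have dvd : 'X^(j.+1) %| Y.
  rewrite -(@Gauss_dvdpl _ _ (recp d)); last first.
    rewrite coprimep_sym.
    by have := @coprime_recp _ _ 0 d (fun=> 0) j.+1; rewrite /rootp big_ord0 mulr1; apply=> -[].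
  rewrite (_ : Y * recp d = 'X^(j.+1) * (kap r * rootp c * P -
      (- b r) *: (q1 * rootp a * rootp d * V))) ?dvdp_mulr // mulrBr EY; ring.
have [Y' YE] := dvdpP _ _ dvd.
have X0 : ('X^(j.+1) : {poly F}) != 0 by rewrite monic_neq0 ?monicXn.
have EY' : kap r * rootp c * P = Y' * recp d + (- b r) *: (q1 * rootp a * rootp d * V).
  by apply: (mulfI X0); rewrite EY YE; ring.
have sY : (size Y <= (k + j + k).+1)%N.
  apply: leq_trans (size_polyD _ _) _; rewrite size_polyN geq_max; apply/andP; split.
    apply: leq_trans (size_scale_leq _ _) _.
    have s1 : (size (q1 * rootp a)%R <= 2 + k)%N.
      by apply: size_polyM_le; rewrite ?size_XsubC ?size_rootp.
    by rewrite mulrC; apply: leq_trans (size_polyM_le sU s1) _; lia.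
  by rewrite mulrC; apply: leq_trans (size_polyM_le sN (size_kap r)) _; lia.
have sY' : (size Y' < #|{: option 'I_(k + k)}|)%N.
  rewrite card_option card_ord ltnS.
  have [->|Y0] := eqVneq Y' 0; first by rewrite size_poly0.
  move: sY; rewrite YE size_mulXn // -(leq_add2l j.+1 (size Y')) => /leq_trans; apply; lia.
rewrite -[RHS](sum_residues_eq0 (node_inj (r := r)) sY'); apply: eq_bigr => o _.
rewrite /weight mulrAC; congr (_ / _); rewrite mulrAC -hornerM EY'.
rewrite hornerD hornerZ [X in _ + X](_ : _ = 0) ?addr0.
  by rewrite hornerM mulfK ?recp_node.
rewrite !hornerM hornerXsubC; case: o => [i|] /=; last by rewrite subrr !(mul0r, mulr0).
have : (rootp e).[e i] = 0 by rewrite horner_rootp (bigD1 i) //= subrr mul0r.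
rewrite rootp_split hornerM => z; rewrite -[_ * _ * (rootp d).[_]]mulrA z.
by rewrite !(mul0r, mulr0).
Qed.

Lemma lamE r (p : {poly F}) N : (size p <= N)%N ->
  lam r p = \sum_(l < N) p`_l * lam r 'X^l.
Proof.
move=> sp; rewrite /lam; under [RHS]eq_bigr do rewrite mulr_sumr.
rewrite exchange_big /=; apply: eq_bigr => o _.
rewrite (horner_coef_wide _ sp) mulr_sumr; apply: eq_bigr => l _.
by rewrite hornerXn mulrCA.
Qed.

(** Up to scaling, the basis of the polynomials of degree less than k that is dual
    to the evaluations at the 1 / d_i. *)
Definition dbasis i : {poly F} := \prod_(j | j != i) (1 - d j *: 'X).

Lemma size_dbasis i : (size (dbasis i) <= k)%N.
Proof.
apply: leq_trans (size_prod_1subZX _ _) _.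
by rewrite cardC1 card_ord prednK // (leq_ltn_trans _ (ltn_ord i)).
Qed.

Lemma recp_dbasis i : recp d = dbasis i * (1 - d i *: 'X).
Proof. by rewrite /recp (bigD1 i) //= mulrC. Qed.

(** As dbasis i / recp d = 1 / (1 - d_i z), the sum of the residues at the nodes is
    the opposite of the residue at the only other pole, 1 / d_i. *)
Lemma lam_dbasis r i :
  lam r (dbasis i) =
   (d i)^-1 * (kap r * rootp c).[(d i)^-1] / \prod_o ((d i)^-1 - node r o).
Proof.
have d0 : d i != 0 by exact: e0.
pose x o' : F := if o' is Some o then node r o else (d i)^-1.
have dn o : node r o != (d i)^-1.
  apply/eqP => no; have := recp_node r o.
  by rewrite (recp_dbasis i) hornerM horner_1subZX no mulfV // subrr mulr0 eqxx.
have xinj : injective x.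
  move=> [u|] [u'|] //=; first by move/node_inj ->.
    by move/eqP; rewrite (negPf (dn u)).
  by move/esym/eqP; rewrite (negPf (dn u')).
have sG : (size (kap r * rootp c)%R < #|{: option (option 'I_(k + k))}|)%N.
  rewrite !card_option card_ord ltnS.
  apply: leq_trans (size_polyM_le (n := k) (size_kap r) _) _; last by rewrite addSn.
  by rewrite size_rootp.
have := sum_residues_eq0 xinj sG; rewrite big_option /= big_option_None /= => H.
have {H}H : (kap r * rootp c).[(d i)^-1] / \prod_o ((d i)^-1 - node r o) =
  - \sum_o (kap r * rootp c).[node r o] / \prod_(o' | o' != Some o) (node r o - x o').
  by apply/eqP; rewrite -addr_eq0 H.
rewrite -mulrA H mulrN mulr_sumr -sumrN; apply: eq_bigr => o _.
rewrite big_option_Some /= /weight.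
have := recp_node r o; rewrite (recp_dbasis i) hornerM horner_1subZX mulf_eq0 negb_or.
move=> /andP[p0 q0].
have -> : node r o - (d i)^-1 = - (d i)^-1 * (1 - d i * node r o) by field.
have P0 : \prod_(o' | o' != o) (node r o - node r o') != 0.
  by apply/prodf_neq0 => o' oo'; rewrite subr_eq0 (inj_eq (node_inj (r := r))) eq_sym.
by field; rewrite p0 d0 q0 P0.
Qed.

(* The forms and the basis, extended by zero to all natural indices. *)
Let lam' (r : nat) (p : {poly F}) : F := if insub r is Some i then lam i p else 0.
Let v' (i : nat) : {poly F} := if insub i is Some j then dbasis j else 0.

Let lam'E (r : 'I_k) : lam' r = lam r.
Proof. by rewrite /lam' valK. Qed.

Let v'E (i : 'I_k) : v' i = dbasis i.
Proof. by rewrite /v' valK. Qed.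

Lemma det_ratio (P N : nat -> {poly F}) :
  (forall j, rootp a * recp b * wpoly F j =
             'X^(j.+1) * P j * rootp c + N j * recp d) ->
  (forall j, (size (N j) <= j.+1 + k)%N) ->
  (forall j, (size (P j) <= (j + k).+1)%N) ->
  (forall j, (P j)`_(j + k) = \prod_i (- b i)) ->
  \det (\matrix_(i < n, j < n) (P j)`_i) *
    \det (\matrix_(r < k, i < k) lam r (dbasis i)) =
  \prod_i b i ^+ n * \det (\matrix_(r < k, i < k) lam r ('X^n * dbasis i)).
Proof.
move=> E sN sP tP.
have H := @det_annihilated F k n lam' P v' (\prod_i (- b i)).
have -> : \prod_i b i ^+ n = ((-1) ^+ k * \prod_i (- b i)) ^+ n.
  rewrite prodrXl; congr (_ ^+ n); rewrite -[in (-1) ^+ k](card_ord k) -prodr_const -big_split /=.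
  by apply: eq_bigr => i _; rewrite mulN1r opprK.
have -> : \matrix_(r < k, i < k) lam r (dbasis i) = \matrix_(r < k, i < k) lam' r (v' i).
  by apply/matrixP => r i; rewrite !mxE lam'E v'E.
have -> : \matrix_(r < k, i < k) lam r ('X^n * dbasis i) =
    \matrix_(r < k, i < k) lam' r ('X^n * v' i).
  by apply/matrixP => r i; rewrite !mxE lam'E v'E.
apply: H => //.
- move=> r p m sp; rewrite /lam'; case: insubP => [i _ _|_]; first exact: lamE.
  by rewrite big1 // => l _; rewrite mulr0.
- move=> r j; rewrite /lam'; case: insubP => [i _ _|//].
  exact: (lam_split i (E j) (sN j)).
- move=> i; rewrite /v'; case: insubP => [j _ _|_]; first exact: size_dbasis.
  by rewrite size_poly0.
Qed.

(** * The shifted forms and det (1 + X Y) *)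

(** Apart from a factor, the form lam r ('X^n * _) is the evaluation at 1 / b_r plus
    a combination of the evaluations at the e_i, with coefficients mainX r i. On
    polynomials of degree less than k, Lagrange interpolation at the 1 / b_s, with
    coefficients mainY i s, reduces the latter to the evaluations at the 1 / b_s. *)
Definition mainX : 'M[F]_(k, k + k) :=
  \matrix_(r, i) (weight r (Some i) * e i ^+ n * b r ^+ n / weight r None).

Definition mainY : 'M[F]_(k + k, k) :=
  \matrix_(i, s) \prod_(s' | s' != s) ((e i - (b s')^-1) / ((b s)^-1 - (b s')^-1)).

Let db i j : d i * b j != 1. Proof. exact: eb. Qed.
Let ab i j : a i * b j != 1. Proof. exact: eb. Qed.
Let ad i j : a i * d j != 1. Proof. exact: ed. Qed.
Let dd i j : d i * d j != 1. Proof. exact: ed. Qed.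
Let d0 i : d i != 0. Proof. exact: e0. Qed.

Let invb_sub (x : F) i : x * b i != 1 -> (b i)^-1 - x != 0.
Proof. by rewrite subr_eq0; apply: contraNneq => <-; rewrite mulVf. Qed.

Let invd_sub (x : F) i : x * d i != 1 -> (d i)^-1 - x != 0.
Proof. by rewrite subr_eq0; apply: contraNneq => <-; rewrite mulVf. Qed.

Lemma weight_NoneE r : weight r None =
  (1 - (b r)^-1) * \prod_(j | j != r) ((b r)^-1 - b j) *
  \prod_j ((b r)^-1 - c j) / (recp d).[(b r)^-1] / \prod_i ((b r)^-1 - e i).
Proof.
rewrite /weight big_option_None /= !hornerM horner_rootp horner_prod.
rewrite !hornerE; congr (_ * _ * _ / _ / _).
by apply: eq_bigr => j _; rewrite hornerXsubC.
Qed.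

Lemma weight_None_neq0 r : weight r None != 0.
Proof.
rewrite weight_NoneE !mulf_neq0 ?invr_neq0 //.
- rewrite subr_eq0 eq_sym invr_eq1; apply: contra (bb r r) => /eqP ->.
  by rewrite mulr1.
- by apply/prodf_neq0 => j _; apply: invb_sub.
- by apply/prodf_neq0 => j _; apply: invb_sub; rewrite mulrC.
- exact: (recp_node r None).
- by apply/prodf_neq0 => j _; apply: invb_sub.
Qed.

(** The matrix of the shifted forms is a diagonal matrix times 1 + mainX mainY times
    the matrix of the values at the 1 / b_s. *)
Lemma det_lam_shift :
  \prod_i b i ^+ n * \det (\matrix_(r < k, i < k) lam r ('X^n * dbasis i)) =
  \prod_r weight r None * \det (\matrix_(s < k, i < k) (dbasis i).[(b s)^-1]) *
  \det (1%:M + mainX *m mainY).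
Proof.
set B := (\matrix_(s, i) (dbasis i).[(b s)^-1]).
pose W : 'M[F]_k := diag_mx (\row_r (weight r None / b r ^+ n)).
have bn0 r : b r ^+ n != 0 by rewrite expf_neq0.
have -> : \matrix_(r < k, i < k) lam r ('X^n * dbasis i) =
    W *m ((1%:M + mainX *m mainY) *m B).
  apply/matrixP => r i; rewrite mul_diag_mx mulmxDl mul1mx -mulmxA !mxE.
  rewrite /lam big_option mulrDr /=; congr (_ + _).
    rewrite hornerM hornerXn exprVn mulrA; congr (_ * _).
  rewrite mulr_sumr; apply: eq_bigr => l _; rewrite !mxE.
  rewrite hornerM hornerXn.
  have -> : \sum_j mainY l j * B j i = (dbasis i).[e l].
    have inj : injective (fun s => (b s)^-1) by move=> s s' /invr_inj /binj.
    have sd : (size (dbasis i) <= #|'I_k|)%N by rewrite card_ord size_dbasis.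
    rewrite [in RHS](Lagrange_interpolation inj sd) horner_sum; apply: eq_bigr => j _.
    rewrite !mxE hornerZ [X in _ = _ * X]horner_prod big_split /= prodfV.
    under [X in _ = _ * X]eq_bigr do rewrite hornerXsubC.
    ring.
  field; rewrite bn0 weight_None_neq0 //.
rewrite !det_mulmx det_diag !mulrA mulrAC; congr (_ * _ * _).
by rewrite -big_split; apply: eq_bigr => i _; rewrite mxE /= mulrC divfK.
Qed.

(** * The term of the empty subsets *)

(** The term of the final sum for S = T = set0. *)
Definition mainterm : F :=
  \prod_i (1 - b i) *
  (\prod_(i < k) \prod_(j < k | (i < j)%N) (1 - b i * b j)) *
  (\prod_i \prod_j (1 - b i * c j)) *
  (\prod_i \prod_j (1 - e i * d j)) /
  ((\prod_i \prod_j (1 - e i * b j)) * (\prod_i (1 - d i)) *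
   (\prod_i \prod_j (1 - c i * d j)) *
   (\prod_(i < k) \prod_(j < k | (i < j)%N) (1 - d i * d j))).

(** Completing kap r by the missing factor 'X - b_r leaves the denominator
    (x - b_r) (x - 1 / b_r), which is x times a difference of values of jk: this is
    what makes the matrices of the forms Cauchy matrices. *)
Let jk x : F := x + x^-1.

Let jkB x y : x != 0 -> y != 0 -> jk x - jk y = (x - y) * (1 - (x * y)^-1).
Proof. by move=> x0 y0; rewrite /jk; field; rewrite x0 y0. Qed.

Let mulNeq1 (x y : F) : x != 0 -> y != 0 -> x * y != 1 -> 1 - (x * y)^-1 != 0.
Proof. by move=> x0 y0 xy; rewrite subr_eq0 eq_sym invr_eq1. Qed.

Let jk_neq (x y : F) : x != 0 -> y != 0 -> x != y -> x * y != 1 -> jk x != jk y.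
Proof.
by move=> x0 y0 xy xy1; rewrite -subr_eq0 jkB // mulf_neq0 ?subr_eq0 // -subr_eq0 mulNeq1.
Qed.

Let bNd i j : b i != d j.
Proof. by rewrite eq_sym; exact: eNb. Qed.

Let horner_1subX x : (1 - 'X : {poly F}).[x] = 1 - x.
Proof. by rewrite !hornerE. Qed.

Lemma det_dbasis_nodes :
  \det (\matrix_(s < k, i < k) (dbasis i).[(b s)^-1]) =
  \prod_s ((recp d).[(b s)^-1] * b s) *
  (\prod_(i < k) \prod_(j < k | (i < j)%N) ((b j - b i) * (d i - d j)) /
   \prod_i \prod_j (b i - d j)).
Proof.
rewrite -det_Cauchy // -det_scale_rows; congr (\det _); apply/matrixP => s i; rewrite !mxE.
rewrite (recp_dbasis i) hornerM horner_1subZX -/(d i).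
have : b s - d i != 0 by rewrite subr_eq0.
by move=> h; field; rewrite h b0.
Qed.

Let V i : F := - ((1 - (d i)^-1) * \prod_j ((d i)^-1 - b j) * \prod_j ((d i)^-1 - c j) /
  \prod_j ((d i)^-1 - e j)).

Lemma det_lam_dbasis :
  \det (\matrix_(r < k, i < k) lam r (dbasis i)) =
  (\prod_(i < k) \prod_(j < k | (i < j)%N)
     ((jk (b j) - jk (b i)) * (jk (d i) - jk (d j))) /
   \prod_i \prod_j (jk (b i) - jk (d j))) * \prod_i V i.
Proof.
rewrite -det_Cauchy; last by move=> i j; apply: jk_neq => //; rewrite mulrC.
rewrite -det_scale_cols; congr (\det _); apply/matrixP => r i; rewrite !mxE.
rewrite lam_dbasis -/(d i) big_option /=.
rewrite /V [\prod_j (_ - b j)](bigD1 r) //= !hornerM horner_1subX horner_rootp horner_prod.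
under eq_bigr do rewrite hornerXsubC.
have -> : jk (b r) - jk (d i) = - d i * (((d i)^-1 - b r) * ((d i)^-1 - (b r)^-1)).
  by rewrite /jk; field; rewrite b0 d0.
have h1 : (d i)^-1 - b r != 0 by apply: invd_sub; rewrite mulrC.
have h2 : (d i)^-1 - (b r)^-1 != 0.
  by rewrite subr_eq0 (inj_eq invr_inj) eq_sym bNd.
have h3 : \prod_j ((d i)^-1 - e j) != 0.
  by apply/prodf_neq0 => j _; apply: invd_sub.
by field; rewrite h3 d0 b0 mulN1r mulNr !subr_eq0 bNd eq_sym mulrC db.
Qed.

(** The exponent k * k + k is even. *)
Let prod_signs : \prod_(r < k) \prod_(i < k) (-1) * \prod_(r < k) (-1) = 1 :> F.
Proof.
under eq_bigr do rewrite prodr_const card_ord.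
rewrite !prodr_const card_ord -exprM -exprD -signr_odd oddD oddM.
by case: (odd k).
Qed.

Let prod_weight_recp :
  \prod_r weight r None * \prod_s ((recp d).[(b s)^-1] * b s) =
  \prod_r ((1 - (b r)^-1) * b r) *
  (\prod_(i < k) \prod_(j < k | (i < j)%N) (((b i)^-1 - b j) * ((b j)^-1 - b i))) *
  \prod_r \prod_j (((b r)^-1 - c j) / (((b r)^-1 - a j) * ((b r)^-1 - d j))).
Proof.
rewrite -(prod_neq_pairs (fun i j => (b i)^-1 - b j)) -!big_split /=.
apply: eq_bigr => r _; rewrite big_split prodfV big_split /=.
rewrite (weight_NoneE) big_split_ord /= -/(a _) -/(d _).
have h1 := recp_node r None.
have h2 : \prod_j ((b r)^-1 - a j) != 0.
  by apply/prodf_neq0 => j _; apply: invb_sub.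
have h3 : \prod_j ((b r)^-1 - d j) != 0.
  by apply/prodf_neq0 => j _; apply: invb_sub.
by field; rewrite h1 h2 h3 b0.
Qed.

Let prod2_neq0 (I J : finType) (f : I -> J -> F) :
  (forall i j, f i j != 0) -> \prod_i \prod_j f i j != 0.
Proof. by move=> f0; apply/prodf_neq0 => i _; apply/prodf_neq0 => j _. Qed.

(** Both determinants are Cauchy determinants, so this is an identity between
    products over pairs of indices. *)
Lemma mainterm_det :
  \prod_r weight r None * \det (\matrix_(s < k, i < k) (dbasis i).[(b s)^-1]) =
  mainterm * \det (\matrix_(r < k, i < k) lam r (dbasis i)).
Proof.
rewrite det_dbasis_nodes mulrA prod_weight_recp det_lam_dbasis.
(* The factors attached to a pair (b_r, d_j) are gathered in L3 and R3, those
   attached to a pair of indices i < j in L2 and R2. *)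
pose L3 r j := ((b r)^-1 - c j) / (((b r)^-1 - a j) * ((b r)^-1 - d j)) / (b r - d j).
pose R3 r j := (1 - b r * c j) / ((1 - a j * b r) * (1 - d j * b r)) *
  ((d j)^-1 - b r) / (jk (b r) - jk (d j)).
pose L2 i j := ((b i)^-1 - b j) * ((b j)^-1 - b i) * ((b j - b i) * (d i - d j)).
pose R2 i j := (1 - b i * b j) / (1 - d i * d j) *
  (((1 - d i * d j) / ((d i)^-1 - d j)) * ((1 - d j * d i) / ((d j)^-1 - d i))) *
  ((jk (b j) - jk (b i)) * (jk (d i) - jk (d j))).
transitivity (\prod_r ((1 - (b r)^-1) * b r) *
    \prod_(i < k) \prod_(j < k | (i < j)%N) L2 i j * \prod_r \prod_j L3 r j).
  rewrite /L2 /L3.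
  under [X in _ = _ * X * _]eq_bigr do rewrite big_split /=.
  under [X in _ = _ * X]eq_bigr do rewrite big_split /= prodfV.
  by rewrite !big_split /= !prodfV; ring.
have -> : \prod_r \prod_j L3 r j = \prod_r \prod_j R3 r j * \prod_(r < k) \prod_(j < k) (-1).
  rewrite -big_split; apply: eq_bigr => r _; rewrite -big_split; apply: eq_bigr => j _.
  rewrite /L3 /R3 /= jkB //.
  by field; rewrite d0 b0 !subr_eq0 bNd [b r * d j]mulrC db ![1 == _]eq_sym db ab.
have -> : \prod_(i < k) \prod_(j < k | (i < j)%N) L2 i j =
   \prod_(i < k) \prod_(j < k | (i < j)%N) R2 i j.
  apply: eq_bigr => i _; apply: eq_bigr => j ij.
  rewrite /L2 /R2 !jkB //.
  by field; rewrite !d0 !b0 mulNr subr_eq0 eq_sym dd.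
have -> : \prod_r ((1 - (b r)^-1) * b r) = \prod_r (1 - b r) * \prod_(r < k) (-1).
  by rewrite -big_split /=; apply: eq_bigr => r _; field.
transitivity (\prod_r (1 - b r) * (\prod_(i < k) \prod_(j < k | (i < j)%N) R2 i j) *
  \prod_r \prod_j R3 r j * (\prod_(r < k) \prod_(i < k) (-1) * \prod_(r < k) (-1))).
  ring.
rewrite prod_signs mulr1.
pose Pad := \prod_i \prod_j (1 - a i * d j).
pose Pcd := \prod_i \prod_j (1 - c i * d j).
pose Pdd := \prod_i \prod_j (1 - d i * d j).
pose Pab := \prod_i \prod_j (1 - a i * b j).
pose Pdb := \prod_i \prod_j (1 - d i * b j).
pose Qa := \prod_i \prod_j ((d i)^-1 - a j).
pose Qb := \prod_i \prod_j ((d i)^-1 - b j).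
pose Qc := \prod_i \prod_j ((d i)^-1 - c j).
pose Qd := \prod_i \prod_j ((d i)^-1 - d j).
pose J := \prod_i \prod_j (jk (b i) - jk (d j)).
pose JJ := \prod_(i < k) \prod_(j < k | (i < j)%N)
     ((jk (b j) - jk (b i)) * (jk (d i) - jk (d j))).
pose Tb := \prod_(i < k) \prod_(j < k | (i < j)%N) (1 - b i * b j).
pose Td := \prod_(i < k) \prod_(j < k | (i < j)%N) (1 - d i * d j).
pose Pbc := \prod_i \prod_j (1 - b i * c j).
have Qa0 : Qa != 0 by apply: prod2_neq0 => i j; exact: invd_sub.
have Qc0 : Qc != 0 by apply: prod2_neq0 => i j; exact: invd_sub.
have Qd0 : Qd != 0 by apply: prod2_neq0 => i j; exact: invd_sub.
have Pad0 : Pad != 0 by apply: prod2_neq0 => i j; exact: sub1r_neq0.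
have Pcd0 : Pcd != 0 by apply: prod2_neq0 => i j; exact: sub1r_neq0.
have Pdd0 : Pdd != 0 by apply: prod2_neq0 => i j; exact: sub1r_neq0.
have Pab0 : Pab != 0 by apply: prod2_neq0 => i j; exact: sub1r_neq0.
have Pdb0 : Pdb != 0 by apply: prod2_neq0 => i j; exact: sub1r_neq0.
have Td0 : Td != 0.
  by apply/prodf_neq0 => i _; apply/prodf_neq0 => j _; exact: sub1r_neq0.
have J0 : J != 0.
  by apply: prod2_neq0 => i j; rewrite subr_eq0 jk_neq // mulrC db.
have Pd0 : \prod_i d i != 0 by apply/prodf_neq0.
have P1d0 : \prod_i (1 - d i) != 0.
  apply/prodf_neq0 => i _; apply: sub1r_neq0; apply/eqP => d1.
  by have := dd i i; rewrite d1 mulr1 eqxx.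
have eca : Qc / Qa = Pcd / Pad.
  apply/eqP; rewrite eqr_div //; apply/eqP; rewrite /Qc /Pad /Pcd /Qa.
  rewrite [X in _ * X = _]exchange_big [X in _ = X * _]exchange_big -!big_split /=.
  apply: eq_bigr => i _; rewrite -!big_split /=; apply: eq_bigr => j _.
  by field.
have eR2 : \prod_(i < k) \prod_(j < k | (i < j)%N) R2 i j =
    Tb / Td * (Pdd / Qd / \prod_i d i) * JJ.
  have -> : Pdd / Qd / \prod_i d i = \prod_(i < k) \prod_(j < k | (i < j)%N)
      (((1 - d i * d j) / ((d i)^-1 - d j)) * ((1 - d j * d i) / ((d j)^-1 - d i))).
    apply: (mulIf Pd0); rewrite divfK //.
    have -> : \prod_i d i = \prod_i ((1 - d i * d i) / ((d i)^-1 - d i)).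
      apply: eq_bigr => i _; field.
      by rewrite d0 /= mulNr subr_eq0 eq_sym dd.
    have := prod_all_pairs (fun i j => (1 - d i * d j) / ((d i)^-1 - d j)).
    rewrite /= mulrC => <-.
    rewrite /Pdd /Qd -prodfV -big_split; apply: eq_bigr => i _ /=.
    by rewrite -prodfV -big_split.
  rewrite /Tb /Td /JJ -prodfV -!big_split /=; apply: eq_bigr => i _.
  by rewrite -prodfV -!big_split /=.
have eR3 : \prod_r \prod_j R3 r j = Pbc / (Pab * Pdb) * Qb / J.
  rewrite /Pbc /Pab /Pdb /Qb /J [X in _ / (X * _)]exchange_big.
  rewrite [X in _ / (_ * X)]exchange_big [X in _ * X / _]exchange_big.
  rewrite -big_split /= -!prodfV -!big_split /=; apply: eq_bigr => i _.
  by rewrite -big_split /= -!prodfV -!big_split /=.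
have eV : \prod_i V i = \prod_i (1 - d i) / \prod_i d i * Qb * Qc / (Qa * Qd).
  rewrite /Qb /Qc /Qa /Qd -[X in _ / X]big_split /= -!prodfV -!big_split /=.
  apply: eq_bigr => i _; rewrite /V big_split_ord /= -/(a _) -/(d _).
  have n1 : \prod_j ((d i)^-1 - a j) != 0.
    by apply/prodf_neq0 => j _; apply: invd_sub.
  have n2 : \prod_j ((d i)^-1 - d j) != 0.
    by apply/prodf_neq0 => j _; apply: invd_sub.
  by field; rewrite n1 n2 d0.
have eM : mainterm = \prod_i (1 - b i) * Tb * Pbc * (Pad * Pdd) /
    (Pab * Pdb * \prod_i (1 - d i) * Pcd * Td).
  by rewrite /mainterm !big_split_ord.
rewrite eR2 eR3 eV eM -/J -/JJ.
have -> : Qc = Pcd / Pad * Qa by rewrite -eca divfK.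
by field; rewrite Qa0 Qd0 Pad0 Pcd0 Pab0 Pdb0 Td0 J0 Pd0 P1d0.
Qed.
(** * The terms of all pairs of subsets *)

(** The product of two opposite minors of mainX and mainY has one factor for each
    element of S, of T, each pair in S, each pair in T and each element of S x T. *)
Definition termS i : F :=
  e i ^+ n.-1 * (1 - e i) * \prod_j (1 - c j / e i) * \prod_j (1 - e i * b j) *
  \prod_j (1 - b j / e i) / (\prod_j (1 - d j * e i) * \prod_(i' | i' != i) (1 - e i' / e i)).

Definition termT r : F :=
  b r ^+ n * \prod_j (1 - d j / b r) * \prod_i (1 - e i * b r) /
  ((1 - b r) * \prod_j (1 - c j * b r) *
   \prod_(j | j != r) ((1 - b j / b r) * (1 - b r * b j))).

Definition termSS i j : F :=
  (1 - e i / e j) * (1 - e j / e i) * (1 - (e i)^-1 * (e j)^-1).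

Definition termTT r s : F :=
  (1 - b r / b s) * (1 - b s / b r) * (1 - b r * b s).

Definition termST i r : F :=
  (1 - e i * b r) * (1 - (b r)^-1 * (e i)^-1) * (1 - b r / e i).

(* Row and column factors: without them, mainX and mainY are Cauchy matrices, the
   first one in the variable z + 1 / z. *)
Let X1 i : F := e i ^+ n * (1 - e i) * \prod_j (e i - b j) * \prod_j (e i - c j) /
  (\prod_j (1 - d j * e i) * \prod_(i' | i' != i) (e i - e i')) / e i.
Let X2 r : F := - (b r ^+ n / weight r None).
Let Y1 i : F := \prod_j (e i - (b j)^-1).
Let Y2 r : F := (\prod_(s | s != r) ((b r)^-1 - (b s)^-1))^-1.

Let mainXE r i : mainX r i = X2 r * (jk (b r) - jk (e i))^-1 * X1 i.
Proof.
rewrite mxE /X1 /X2 {1}/weight big_option_Some /= !hornerM horner_recp horner_rootp horner_prod.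
rewrite (_ : (1 - 'X : {poly F}).[e i] = 1 - e i); last by rewrite !hornerE.
under eq_bigr do rewrite hornerXsubC.
rewrite [\prod_j (e i - b j)](bigD1 r) //=.
have w0 : weight r None != 0 by exact: weight_None_neq0.
have n1 : e i - b r != 0 by rewrite subr_eq0.
have n2 : \prod_(i' | i' != i) (e i - e i') != 0.
  by apply/prodf_neq0 => j ji; rewrite subr_eq0 (inj_eq einj) eq_sym.
have n3 : \prod_j (1 - d j * e i) != 0.
  by apply/prodf_neq0 => j _; apply: sub1r_neq0; rewrite mulrC.
have -> : jk (b r) - jk (e i) = - (e i - b r) * (e i - (b r)^-1) / e i.
  by rewrite /jk; field; rewrite e0 b0.
have n4 : e i - (b r)^-1 != 0 by rewrite -oppr_eq0 opprB; exact: invb_sub.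
by field; rewrite w0 n1 n2 n3 e0 b0 /=; rewrite ?subr_eq0 ?eb.
Qed.

Let mainYE i r : mainY i r = Y1 i * (e i - (b r)^-1)^-1 * Y2 r.
Proof.
rewrite mxE /Y1 /Y2 big_split /= prodfV [\prod_j (e i - (b j)^-1)](bigD1 r) //=.
have n4 : e i - (b r)^-1 != 0 by rewrite -oppr_eq0 opprB; exact: invb_sub.
by rewrite [X in _ = X * _](mulrAC) mulfV // mul1r.
Qed.

Hypothesis n_gt0 : (0 < n)%N.

Let XYS i : X1 i * Y1 i = termS i * e i * \prod_j (- (b j)^-1).
Proof.
have pw : \prod_(i' | i' != i) (e i - e i') * e i =
   e i ^+ (k + k) * \prod_(i' | i' != i) (1 - e i' / e i).
  rewrite -[in e i ^+ (k + k)](card_ord (k + k)) -prodr_const [X in _ = X * _](bigD1 i) //=.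
  rewrite mulrC -mulrA -big_split /=; congr (_ * _); apply: eq_bigr => j _.
  by field.
have pb : \prod_j (e i - b j) = e i ^+ k * \prod_j (1 - b j / e i).
  rewrite -[in e i ^+ k](card_ord k) -prodr_const -big_split /=.
  by apply: eq_bigr => j _; field.
have pc : \prod_j (e i - c j) = e i ^+ k * \prod_j (1 - c j / e i).
  rewrite -[in e i ^+ k](card_ord k) -prodr_const -big_split /=.
  by apply: eq_bigr => j _; field.
have pv : Y1 i = \prod_j (- (b j)^-1) * \prod_j (1 - e i * b j).
  by rewrite -big_split; apply: eq_bigr => j _ /=; field.
rewrite pv /X1 /termS pb pc.
have n3 : \prod_j (1 - d j * e i) != 0.
  by apply/prodf_neq0 => j _; apply: sub1r_neq0; rewrite mulrC.
have n2 : \prod_(i' | i' != i) (e i - e i') != 0.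
  by apply/prodf_neq0 => j ji; rewrite subr_eq0 (inj_eq einj) eq_sym.
have n5 : \prod_(i' | i' != i) (1 - e i' / e i) != 0.
  apply/prodf_neq0 => j ji; apply: sub1r_neq0; apply: contraNneq ji => ji.
  by apply/eqP; apply: einj; rewrite -[LHS](mulfVK (e0 i)) ji mul1r.
have -> : e i ^+ n = e i ^+ n.-1 * e i by rewrite -exprSr prednK.
have -> : \prod_(i' | i' != i) (e i - e i') =
   e i ^+ k * e i ^+ k * \prod_(i' | i' != i) (1 - e i' / e i) / e i.
  by rewrite -exprD -pw mulfK.
have ek : e i ^+ k != 0 by rewrite expf_neq0.
by field; rewrite n3 n5 ek e0.
Qed.

Let XYT r : X2 r * Y2 r = termT r * \prod_(j | j != r) (- b j).
Proof.
have pe : \prod_i ((b r)^-1 - e i) = (b r)^-1 ^+ k * (b r)^-1 ^+ k * \prod_i (1 - e i * b r).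
  rewrite -exprD -[in (b r)^-1 ^+ (k + k)](card_ord (k + k)) -prodr_const -big_split /=.
  by apply: eq_bigr => j _; field.
have pc : \prod_j ((b r)^-1 - c j) = (b r)^-1 ^+ k * \prod_j (1 - c j * b r).
  rewrite -[in (b r)^-1 ^+ k](card_ord k) -prodr_const -big_split /=.
  by apply: eq_bigr => j _; field.
have pb : \prod_(j | j != r) ((b r)^-1 - b j) * (b r)^-1 =
    (b r)^-1 ^+ k * \prod_(j | j != r) (1 - b r * b j).
  rewrite -[in (b r)^-1 ^+ k](card_ord k) -prodr_const [X in _ = X * _](bigD1 r) //=.
  rewrite mulrC -mulrA -big_split /=; congr (_ * _); apply: eq_bigr => j _.
  by field.
have py : \prod_(s | s != r) ((b r)^-1 - (b s)^-1) * \prod_(j | j != r) (- b j) =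
    \prod_(j | j != r) (1 - b j / b r).
  by rewrite -big_split /=; apply: eq_bigr => j _; field; rewrite !b0.
have pd : (recp d).[(b r)^-1] = \prod_j (1 - d j / b r) by rewrite horner_recp.
have q1 : \prod_i (1 - e i * b r) != 0 by apply/prodf_neq0 => i _; exact: sub1r_neq0.
have q2 : \prod_j (1 - c j * b r) != 0.
  by apply/prodf_neq0 => i _; apply: sub1r_neq0; rewrite mulrC.
have q3 : \prod_(j | j != r) (1 - b r * b j) != 0.
  by apply/prodf_neq0 => i _; exact: sub1r_neq0.
have q4 : \prod_(j | j != r) (1 - b j / b r) != 0.
  apply/prodf_neq0 => j ji; apply: sub1r_neq0; apply: contraNneq ji => ji.
  by apply/eqP; apply: binj; rewrite -[LHS](mulfVK (b0 r)) ji mul1r.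
have q5 : 1 - b r != 0.
  apply: sub1r_neq0; apply/eqP => b1; have := bb r r; by rewrite b1 mulr1 eqxx.
have q6 : \prod_j (1 - d j / b r) != 0.
  by rewrite -pd; exact: (recp_node r None).
have q7 : \prod_(j | j != r) (- b j) != 0.
  by apply/prodf_neq0 => j _; rewrite oppr_eq0.
have bk : (b r)^-1 ^+ k != 0 by rewrite expf_neq0 // invr_neq0.
rewrite /X2 /Y2 /termT weight_NoneE pe pc pd big_split /=.
have -> : \prod_(s | s != r) ((b r)^-1 - (b s)^-1) =
   \prod_(j | j != r) (1 - b j / b r) / \prod_(j | j != r) (- b j).
  by rewrite -py mulfK.
have -> : \prod_(j | j != r) ((b r)^-1 - b j) =
   (b r)^-1 ^+ k * \prod_(j | j != r) (1 - b r * b j) * b r.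
  by rewrite -pb divfK.
set z := (b r)^-1 ^+ k in bk *.
have zi : (b r)^-1 = 1 - (1 - (b r)^-1) by ring.
have q8 : b r - 1 != 0 by rewrite -oppr_eq0 opprB.
by field; rewrite q1 q2 q3 q4 q5 q6 q7 q8 bk b0.
Qed.

Let XYST i r : X1 i * Y1 i * (X2 r * Y2 r) = termS i * termT r * - (e i / b r).
Proof.
rewrite XYS XYT [\prod_j (- (b j)^-1)](bigD1 r) //=.
have E : \prod_(j | j != r) (- (b j)^-1) * \prod_(j | j != r) (- b j) = 1.
  by rewrite -big_split big1 // => j _ /=; rewrite mulrNN mulVf.
transitivity (termS i * e i * (- (b r)^-1) * termT r *
   (\prod_(j | j != r) (- (b j)^-1) * \prod_(j | j != r) (- b j))); first by ring.
by rewrite E; ring.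
Qed.

(** Once the row and column factors are taken out, both minors are Cauchy
    determinants. *)
Lemma minor_product m (f : 'I_m -> 'I_(k + k)) (g : 'I_m -> 'I_k) :
  injective f -> injective g ->
  \det (mxsub g f (mainX)) * \det (mxsub f g (mainY)) =
  (-1) ^+ m * \prod_i termS (f i) * \prod_i termT (g i) *
  \prod_(i < m) \prod_(j < m | (i < j)%N) (termSS (f i) (f j) * termTT (g i) (g j)) /
  \prod_i \prod_j termST (f i) (g j).
Proof.
move=> fi gi.
have jeb i r : jk (b r) != jk (e i).
  by apply: jk_neq => //; [rewrite eq_sym | rewrite mulrC].
have dX : \det (mxsub g f (mainX)) =
  \prod_i X2 (g i) * \det (\matrix_(i < m, j < m) (jk (b (g i)) - jk (e (f j)))^-1) *
  \prod_i X1 (f i).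
  rewrite -det_scale_rows -det_scale_cols; congr (\det _); apply/matrixP => i j.
  by rewrite mxE mainXE !mxE.
have dY : \det (mxsub f g (mainY)) =
  \prod_i Y1 (f i) * \det (\matrix_(i < m, j < m) (e (f i) - (b (g j))^-1)^-1) *
  \prod_i Y2 (g i).
  rewrite -det_scale_rows -det_scale_cols; congr (\det _); apply/matrixP => i j.
  by rewrite mxE mainYE !mxE.
rewrite dX dY det_Cauchy; last by move=> i j; exact: jeb.
rewrite det_Cauchy; last first.
  by move=> i j; rewrite -subr_eq0 -oppr_eq0 opprB; exact: invb_sub.
(* Written with termSS, termTT and termST, the Cauchy numerators have the extra
   factors u i * u j for i < j, and the denominators have these and the u i; the
   u i are cancelled by the row and column factors. *)
pose u i := e (f i) / b (g i).
pose CX := \prod_(i < m) \prod_(j < m | (i < j)%N)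
  ((jk (b (g j)) - jk (b (g i))) * (jk (e (f i)) - jk (e (f j)))).
pose CY := \prod_(i < m) \prod_(j < m | (i < j)%N)
  ((e (f j) - e (f i)) * ((b (g i))^-1 - (b (g j))^-1)).
pose DX := \prod_i \prod_j (jk (b (g i)) - jk (e (f j))).
pose DY := \prod_i \prod_j (e (f i) - (b (g j))^-1).
pose UU := \prod_(i < m) \prod_(j < m | (i < j)%N) (u i * u j).
pose TT := \prod_(i < m) \prod_(j < m | (i < j)%N)
  (termSS (f i) (f j) * termTT (g i) (g j)).
pose ST := \prod_i \prod_j termST (f i) (g j).
rewrite -/CX -/CY -/DX -/DY -/TT -/ST.
have EC : CX * CY = TT * UU.
  rewrite /CX /CY /TT /UU -!big_split; apply: eq_bigr => i _ /=.
  rewrite -!big_split; apply: eq_bigr => j _ /=.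
  rewrite !jkB // /termSS /termTT /u.
  by field; rewrite !e0 !b0.
have ED : DX * DY = ST * (\prod_i u i * UU).
  have -> : \prod_i u i * UU = \prod_(i < m) \prod_(j < m) (e (f i) / b (g j)).
    transitivity (\prod_(i < m) \prod_(j < m) u j).
      rewrite prod_all_pairs /UU; congr (_ * _).
      by apply: eq_bigr => i _; apply: eq_bigr => j _; rewrite mulrC.
    rewrite /u; under eq_bigr do rewrite big_split /=.
    rewrite big_split /= exchange_big -big_split /=; apply: eq_bigr => i _.
    by rewrite -big_split.
  rewrite /DX exchange_big /DY /ST -!big_split; apply: eq_bigr => i _ /=.
  rewrite -!big_split; apply: eq_bigr => j _ /=.
  rewrite jkB // /termST; by field; rewrite !e0 !b0.
have u0 i : u i != 0 by rewrite mulf_neq0 ?invr_eq0.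
have DX0 : DX != 0 by apply/prodf_neq0 => i _; apply/prodf_neq0 => j _; rewrite subr_eq0.
have DY0 : DY != 0.
  apply/prodf_neq0 => i _; apply/prodf_neq0 => j _.
  by rewrite -oppr_eq0 opprB; exact: invb_sub.
have Pu0 : \prod_i u i != 0 by apply/prodf_neq0.
have UU0 : UU != 0.
  by apply/prodf_neq0 => i _; apply/prodf_neq0 => j _; rewrite mulf_neq0.
have ST0 : ST != 0.
  by move: (mulf_neq0 DX0 DY0); rewrite ED mulf_eq0 negb_or => /andP[].
have EW : \prod_i X2 (g i) * \prod_i X1 (f i) * \prod_i Y1 (f i) * \prod_i Y2 (g i) =
   (-1) ^+ m * \prod_i termS (f i) * \prod_i termT (g i) * \prod_i u i.
  rewrite -[in (-1) ^+ m](card_ord m) -prodr_const -!big_split; apply: eq_bigr => i _ /=.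
  transitivity (X1 (f i) * Y1 (f i) * (X2 (g i) * Y2 (g i))); first by ring.
  by rewrite XYST /u; ring.
transitivity ((\prod_i X2 (g i) * \prod_i X1 (f i) * \prod_i Y1 (f i) * \prod_i Y2 (g i)) *
   (CX * CY) / (DX * DY)); first by field; rewrite DX0 DY0.
rewrite EC ED EW.
by field; rewrite Pu0 UU0 ST0.
Qed.

(** The summand of the theorem, with its products over families written as products
    over indices. *)
Definition setterm (S : {set 'I_(k + k)}) (T : {set 'I_k}) : F :=
  (-1) ^+ #|S| * (\prod_(i in S) e i ^+ n.-1) * (\prod_(j in T) b j ^+ n) *
  (\prod_i (1 + d i)) * (\prod_(i in S) (1 - e i)) * (\prod_(j in ~: T) (1 - b j)) *
  ((\prod_i (1 - d i * d i) *
     \prod_(i < k) \prod_(j < k | (i < j)%N) (1 - d i * d j))^-1 *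
   (\prod_i \prod_j (1 - c i * d j))^-1 *
   ((\prod_(i in ~: S) \prod_(j in ~: T) (1 - e i * b j)) *
    (\prod_(i in ~: S) \prod_(s in S) (1 - e i / e s)) *
    (\prod_(t in T) \prod_(j in ~: T) (1 - (b t)^-1 * b j)) *
    (\prod_(t in T) \prod_(s in S) (1 - (b t)^-1 / e s)))^-1 *
   ((\prod_(i in ~: S) \prod_j (1 - e i * d j)) *
    (\prod_(t in T) \prod_j (1 - (b t)^-1 * d j))) *
   ((\prod_(j in ~: T) \prod_i (1 - b j * c i)) *
    (\prod_(s in S) \prod_i (1 - (e s)^-1 * c i))) *
   ((\prod_(i in ~: T) \prod_(j in ~: T | (i < j)%N) (1 - b i * b j)) *
    (\prod_(j in ~: T) \prod_(s in S) (1 - b j / e s)) *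
    (\prod_(i in S) \prod_(j in S | (i < j)%N) (1 - (e i)^-1 / e j)))).

(** The ratio of setterm S T to mainterm, in the form given by the minors. *)
Definition minorterm (S : {set 'I_(k + k)}) (T : {set 'I_k}) : F :=
  (-1) ^+ #|S| * \prod_(i in S) termS i * \prod_(j in T) termT j *
  ((\prod_(i in S) \prod_(j in S | (i < j)%N) termSS i j) *
   (\prod_(i in T) \prod_(j in T | (i < j)%N) termTT i j)) /
  \prod_(i in S) \prod_(j in T) termST i j.

Let b1 j : 1 - b j != 0.
Proof. by apply: sub1r_neq0; apply/eqP => bj; have := bb j j; rewrite bj mulr1 eqxx. Qed.

Let d1 j : 1 - d j != 0.
Proof. by apply: sub1r_neq0; apply/eqP => dj; have := dd j j; rewrite dj mulr1 eqxx. Qed.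

Let invM_neq1 (x y : F) : x * y != 1 -> x^-1 / y != 1.
Proof. by rewrite -invfM invr_eq1. Qed.

(** The factors of mainterm that have an index in S or T and are not in the summand
    cancel against factors of minorterm; r1 to r8 split the products over all
    indices according to membership in S and T. *)
Lemma minorterm_setterm S T : mainterm * minorterm S T = setterm S T.
Proof.
rewrite /mainterm /minorterm /setterm.
rewrite (_ : \prod_(i in S) termS i =
  \prod_(i in S) e i ^+ n.-1 * \prod_(i in S) (1 - e i) *
  (\prod_(i in S) \prod_j (1 - (e i)^-1 * c j)) *
  (\prod_(i in S) \prod_j (1 - e i * b j)) *
  (\prod_(i in S) \prod_j (1 - b j / e i)) /
  ((\prod_(i in S) \prod_j (1 - e i * d j)) *
   (\prod_(i in S) \prod_(i' | i' != i) (1 - e i' / e i)))); last first.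
  rewrite -[X in _ / X]big_split -prodfV -!big_split; apply: eq_bigr => i _ /=.
  rewrite /termS; congr (_ * _ * _ * _ / (_ * _)); apply: eq_bigr => j _;
  by rewrite ?[d _ * _]mulrC // [(e i)^-1 * _]mulrC.
rewrite (_ : \prod_(j in T) termT j =
  \prod_(j in T) b j ^+ n * (\prod_(t in T) \prod_j (1 - (b t)^-1 * d j)) *
  (\prod_(t in T) \prod_i (1 - e i * b t)) /
  (\prod_(t in T) (1 - b t) * (\prod_(t in T) \prod_i (1 - b t * c i)) *
   ((\prod_(t in T) \prod_(j | j != t) (1 - (b t)^-1 * b j)) *
    (\prod_(t in T) \prod_(j | j != t) (1 - b t * b j))))); last first.
  rewrite -!big_split -prodfV -!big_split; apply: eq_bigr => t _ /=.
  rewrite /termT; congr (_ * _ * _ / (_ * _ * _)).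
  - by apply: eq_bigr => j _; rewrite mulrC.
  - by apply: eq_bigr => j _; rewrite mulrC.
  - by rewrite -big_split; apply: eq_bigr => j _ /=; rewrite [(b t)^-1 * _]mulrC.
rewrite (_ : \prod_(i in S) \prod_(j in S | (i < j)%N) termSS i j =
  (\prod_(s in S) \prod_(i in S | i != s) (1 - e i / e s)) *
  (\prod_(i in S) \prod_(j in S | (i < j)%N) (1 - (e i)^-1 / e j))); last first.
  rewrite prod_neq_pairs_in -big_split; apply: eq_bigr => i _ /=.
  rewrite -big_split; apply: eq_bigr => j _ /=.
  by rewrite /termSS [X in X * _ = _]mulrC.
rewrite (_ : \prod_(i in T) \prod_(j in T | (i < j)%N) termTT i j =
  (\prod_(t in T) \prod_(j in T | j != t) (1 - (b t)^-1 * b j)) *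
  (\prod_(i in T) \prod_(j in T | (i < j)%N) (1 - b i * b j))); last first.
  rewrite prod_neq_pairs_in -big_split; apply: eq_bigr => i _ /=.
  rewrite -big_split; apply: eq_bigr => j _ /=.
  by rewrite /termTT; congr (_ * _); rewrite mulrC; congr (_ * _); rewrite mulrC.
rewrite (_ : \prod_(i in S) \prod_(j in T) termST i j =
  (\prod_(i in S) \prod_(j in T) (1 - e i * b j)) *
  (\prod_(t in T) \prod_(s in S) (1 - (b t)^-1 / e s)) *
  (\prod_(i in S) \prod_(j in T) (1 - b j / e i))); last first.
  rewrite [X in _ * X * _]exchange_big -!big_split; apply: eq_bigr => i _ /=.
  by rewrite -!big_split.
rewrite (_ : \prod_i (1 - d i * d i) = \prod_i (1 - d i) * \prod_i (1 + d i)); last first.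
  by rewrite -big_split; apply: eq_bigr => i _ /=; ring.
have r1 := prod_setCC S T (fun i j => 1 - e i * b j).
have r2 := prod_neq_setC S (fun s i => 1 - e i / e s).
rewrite [X in X * _ = _]exchange_big /= in r2.
have r3 := prod_neq_setC T (fun t j => 1 - (b t)^-1 * b j).
have r4 := prod_setC S (fun i => \prod_j (1 - e i * d j)).
have r5 := prod_setC T (fun j => \prod_i (1 - b j * c i)).
have r7 : (\prod_(s in S) \prod_j (1 - b j / e s)) =
    (\prod_(j in ~: T) \prod_(s in S) (1 - b j / e s)) *
    (\prod_(i in S) \prod_(j in T) (1 - b j / e i)).
  rewrite [X in _ = X * _]exchange_big -big_split; apply: eq_bigr => s _ /=.
  exact: prod_setC.
have r8 := prod_setC T (fun j => 1 - b j).
have r6 : (\prod_(i in ~: T) \prod_(j in ~: T | (i < j)%N) (1 - b i * b j)) *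
     (\prod_(t in T) \prod_(j | j != t) (1 - b t * b j)) =
  (\prod_(i < k) \prod_(j < k | (i < j)%N) (1 - b i * b j)) *
  (\prod_(i in T) \prod_(j in T | (i < j)%N) (1 - b i * b j)).
  rewrite (prod_pairs_setC T); last by move=> i j; rewrite mulrC.
  rewrite -(prod_neq_setC T) prod_neq_pairs_in.
  rewrite (_ : \prod_(i in T) \prod_(j in T | (i < j)%N)
                 ((1 - b i * b j) * (1 - b j * b i)) =
     (\prod_(i in T) \prod_(j in T | (i < j)%N) (1 - b i * b j)) *
     (\prod_(i in T) \prod_(j in T | (i < j)%N) (1 - b i * b j))); first by ring.
  rewrite -big_split; apply: eq_bigr => i _; rewrite -big_split; apply: eq_bigr => j _ /=.
  by rewrite [b j * _]mulrC.
have nST : \prod_(i in S) \prod_(j in T) (1 - e i * b j) != 0.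
  by apply/prodf_neq0 => i _; apply/prodf_neq0 => j _; exact: sub1r_neq0.
have nTT : \prod_(i in T) \prod_(j in T | (i < j)%N) (1 - b i * b j) != 0.
  by apply/prodf_neq0 => i _; apply/prodf_neq0 => j _; exact: sub1r_neq0.
have {}r1 := canRL (mulfK nST) (esym r1).
have {}r6 := canRL (mulfK nTT) (esym r6).
rewrite r1 r6 -r2 -r3 r4 r5 r7 r8.
have d1p j : 1 + d j != 0.
  rewrite addrC -[X in _ + X]opprK subr_eq0; apply/eqP => dj.
  by have := dd j j; rewrite dj mulrNN mulr1 eqxx.
have ninSC (I : finType) (A : {set I}) i s : i \in ~: A -> s \in A -> i != s.
  by rewrite inE => iA sA; apply: contraNneq iA => ->.
field.
rewrite nST nTT andbT /=.
do ?[apply/andP; split]; apply/prodf_neq0 => i iP; rewrite ?d1p ?d1 ?b1 //;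
  apply/prodf_neq0 => j jP; rewrite sub1r_neq0 // mulrC //.
- exact: invM_neq1.
- by apply: divr_neq1 => //; rewrite (inj_eq binj) (ninSC _ _ _ _ jP).
- by rewrite mulrC; apply: divr_neq1 => //; rewrite (inj_eq einj) (ninSC _ _ _ _ iP).
- by rewrite mulrC; apply: divr_neq1 => //; rewrite eq_sym eNb.
- by apply: divr_neq1 => //; rewrite (inj_eq binj); case/andP: jP.
- by rewrite mulrC; apply: divr_neq1 => //; rewrite (inj_eq einj); case/andP: jP.
Qed.

Lemma minorterm_imset (T : {set 'I_k}) (f : 'I_#|T| -> 'I_(k + k)) : injective f ->
  \det (mxsub (fun i : 'I_#|T| => enum_val i) f (mainX)) *
  \det (mxsub f (fun i : 'I_#|T| => enum_val i) (mainY)) =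
  minorterm (f @: 'I_#|T|) T.
Proof.
move=> fi; have gi : injective (fun i : 'I_#|T| => enum_val i : 'I_k).
  exact: enum_val_inj.
rewrite minor_product // /minorterm.
have -> : \prod_(i in f @: 'I_#|T|) \prod_(j in T) termST i j =
    \prod_(i < #|T|) \prod_(j < #|T|) termST (f i) (enum_val j).
  rewrite -prod_imset2 //; apply: eq_bigr => i _; apply: eq_bigl => j.
  by rewrite enum_val_imset.
have -> : \prod_(j in T) termT j = \prod_(i < #|T|) termT (enum_val i).
  rewrite -(big_imset _ (h := fun i : 'I_#|T| => enum_val i)) /=; last first.
    by move=> i j _ _; exact: enum_val_inj.
  by apply: eq_bigl => j; rewrite enum_val_imset.
have -> : \prod_(i in T) \prod_(j in T | (i < j)%N) termTT i j =
    \prod_(i < #|T|) \prod_(j < #|T| | (i < j)%N) termTT (enum_val i) (enum_val j).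
  rewrite -prod_pairs_imset //; last by move=> i j; rewrite /termTT; ring.
  by apply: eq_big => [i|i _]; [|apply: eq_bigl => j]; rewrite enum_val_imset.
rewrite card_imset // card_ord; congr (_ * _ * _ * _ / _).
  by rewrite big_imset //= => i j _ _ /fi.
rewrite prod_pairs_imset //; last by move=> i j; rewrite /termSS; ring.
by rewrite -big_split; apply: eq_bigr => i _ /=; rewrite -big_split.
Qed.

Lemma det_lam_dbasis_neq0 :
  \det (\matrix_(r < k, i < k) lam r (dbasis i)) != 0.
Proof.
rewrite det_lam_dbasis //.
rewrite !mulf_neq0 ?invr_eq0 //.
- apply/prodf_neq0 => i _; apply/prodf_neq0 => j ij.
  have jNi : j != i by rewrite -val_eqE /= gtn_eqF.
  rewrite mulf_neq0 // subr_eq0; apply: jk_neq => //; first by rewrite (inj_eq binj).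
  by rewrite (inj_eq einj) (inj_eq (@rshift_inj _ _)) eq_sym.
- apply/prodf_neq0 => i _; apply/prodf_neq0 => j _.
  by rewrite subr_eq0; apply: jk_neq => //; rewrite mulrC; exact: eb.
- apply/prodf_neq0 => i _; rewrite oppr_eq0 !mulf_neq0 ?invr_eq0 //.
  + rewrite subr_eq0 eq_sym invr_eq1 -subr_eq0 -oppr_eq0 opprB; exact: d1.
  + by apply/prodf_neq0 => j _; apply: invd_sub; rewrite mulrC; exact: eb.
  + by apply/prodf_neq0 => j _; apply: invd_sub; exact: cd.
  + by apply/prodf_neq0 => j _; apply: invd_sub; exact: ed.
Qed.

Theorem det_subset_sum (P N : nat -> {poly F}) :
  (forall j, rootp a * recp b * wpoly F j =
             'X^(j.+1) * P j * rootp c + N j * recp d) ->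
  (forall j, (size (N j) <= j.+1 + k)%N) ->
  (forall j, (size (P j) <= (j + k).+1)%N) ->
  (forall j, (P j)`_(j + k) = \prod_i (- b i)) ->
  \det (\matrix_(i < n, j < n) (P j)`_i) =
  \sum_(S : {set 'I_(k + k)}) \sum_(T : {set 'I_k} | #|S| == #|T|) setterm S T.
Proof.
move=> E sN sP tP.
have := det_ratio E sN sP tP.
rewrite det_lam_shift // mainterm_det //.
rewrite mulrAC => /(mulIf det_lam_dbasis_neq0) ->.
rewrite (@det_1D_subsets _ _ _ _ _ minorterm) => [|T f]; last exact: minorterm_imset.
rewrite mulr_sumr; apply: eq_bigr => S _; rewrite mulr_sumr; apply: eq_bigr => T _.
exact: minorterm_setterm.
Qed.

End ResidueFunctionals.

(** * The summand as a product over indices *)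

Section DefinitionsAsProducts.
Variable R : realType.
Local Notation K := (R[i]).
Implicit Types X Y : seq K.

Lemma inv_Z X Y : (Z X Y)^-1 = \prod_(x <- X) \prod_(y <- Y) (1 - x * y).
Proof.
rewrite /Z -prodfV; apply: eq_bigr => x _; rewrite -prodfV.
by apply: eq_bigr => y _; rewrite invrK.
Qed.

Lemma inv_Z_O X : (Z_O X)^-1 =
  \prod_(i < size X) \prod_(j < size X | (i < j)%N) (1 - X`_i * X`_j).
Proof.
rewrite /Z_O -prodfV; apply: eq_bigr => x _; rewrite -prodfV.
by apply: eq_bigr => y _; rewrite invrK.
Qed.

Lemma prod_pairs_cat X Y :
  \prod_(i < size (X ++ Y)) \prod_(j < size (X ++ Y) | (i < j)%N)
     (1 - (X ++ Y)`_i * (X ++ Y)`_j) =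
  (\prod_(i < size X) \prod_(j < size X | (i < j)%N) (1 - X`_i * X`_j)) *
  (\prod_(x <- X) \prod_(y <- Y) (1 - x * y)) *
  (\prod_(i < size Y) \prod_(j < size Y | (i < j)%N) (1 - Y`_i * Y`_j)).
Proof.
rewrite size_cat big_split_ord /=; congr (_ * _).
  rewrite (big_nth 0) big_mkord -big_split; apply: eq_bigr => i _ /=.
  rewrite big_mkcond big_split_ord /= -big_mkcond /=; congr (_ * _).
    by apply: eq_bigr => j _; rewrite !nth_cat !ltn_ord.
  rewrite (big_nth 0) big_mkord; apply: eq_bigr => j _.
  by rewrite ltn_addr ?ltn_ord // !nth_cat ltn_ord ltnNge leq_addr /= addKn.
apply: eq_bigr => i _; rewrite big_mkcond big_split_ord /= big1 ?mul1r => [|j _].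
  rewrite -big_mkcond /=; apply: eq_big => [j|j _]; first by rewrite ltn_add2l.
  by rewrite !nth_cat !ltnNge !leq_addr /= !addKn.
by rewrite ltnNge (leq_trans (ltnW (ltn_ord j)) (leq_addr _ _)).
Qed.

Lemma prod_pairs_image (m : nat) (A : {set 'I_m}) (h : 'I_m -> K) :
  \prod_(i < size [seq h i | i in A]) \prod_(j < size [seq h i | i in A] | (i < j)%N)
    (1 - [seq h i | i in A]`_i * [seq h i | i in A]`_j) =
  \prod_(i in A) \prod_(j in A | (i < j)%N) (1 - h i * h j).
Proof.
rewrite size_image.
transitivity (\prod_(i < #|A|) \prod_(j < #|A| | (i < j)%N)
   (1 - h (enum_val i) * h (enum_val j))).
  by apply: eq_bigr => i _; apply: eq_bigr => j _; rewrite !nth_image.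
rewrite -(@prod_pairs_imset _ _ (fun i j => 1 - h i * h j)) //=; last 2 first.
- exact: enum_val_inj.
- by move=> i j; rewrite mulrC.
by apply: eq_big => [i|i _]; [|apply: eq_bigl => j]; rewrite enum_val_imset.
Qed.

Lemma Z_S_family k (D : 'rV[K]_k) : Z_S (Defs.family D) =
  (\prod_i (1 - D 0 i * D 0 i) *
   \prod_(i < k) \prod_(j < k | (i < j)%N) (1 - D 0 i * D 0 j))^-1.
Proof.
rewrite /Z_S /Defs.family size_image card_ord.
transitivity (\prod_(i < k) \prod_(j < k | (i <= j)%N) (1 - D 0 i * D 0 j)^-1).
  have fE (i : 'I_k) : [seq D 0 i | i : 'I_k]`_i = D 0 i.
    by rewrite /image_mem (nth_map i) ?size_enum_ord // nth_ord_enum.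
  by apply: eq_bigr => i _; apply: eq_bigr => j _; rewrite !fE.
rewrite -big_split /= -prodfV; apply: eq_bigr => i _.
rewrite invfM -prodfV (bigD1 i) //=; congr (_ * _); apply: eq_bigl => j.
by rewrite ltn_neqAle andbC eq_sym.
Qed.

Lemma ZE X Y : Z X Y = (\prod_(x <- X) \prod_(y <- Y) (1 - x * y))^-1.
Proof. by rewrite -inv_Z invrK. Qed.

Lemma prod2_cat X1 X2 Y1 Y2 :
  \prod_(x <- X1 ++ X2) \prod_(y <- Y1 ++ Y2) (1 - x * y) =
  (\prod_(x <- X1) \prod_(y <- Y1) (1 - x * y)) *
  (\prod_(x <- X1) \prod_(y <- Y2) (1 - x * y)) *
  (\prod_(x <- X2) \prod_(y <- Y1) (1 - x * y)) *
  (\prod_(x <- X2) \prod_(y <- Y2) (1 - x * y)).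
Proof.
rewrite big_cat /= -[RHS]mulrA -!big_split /=.
by congr (_ * _); apply: eq_bigr => x _; rewrite big_cat.
Qed.

Lemma prod_image2 (I J : finType) (A : {pred I}) (B : {pred J}) (h : I -> K) (l : J -> K) :
  \prod_(x <- [seq h i | i in A]) \prod_(y <- [seq l j | j in B]) (1 - x * y) =
  \prod_(i in A) \prod_(j in B) (1 - h i * l j).
Proof. by rewrite big_image; apply: eq_bigr => i _; rewrite big_image. Qed.

Lemma inv_image (I : finType) (A : {pred I}) (h : I -> K) :
  [seq x^-1 | x <- [seq h i | i in A]] = [seq (h i)^-1 | i in A].
Proof. by rewrite /image_mem -map_comp. Qed.

Lemma summandE (k n : nat) (A B C D : 'rV[K]_k) S T :
  summand n A B C D S T =
  setterm n (fun i => row_mx A D 0 i) (fun i => B 0 i) (fun i => C 0 i) S T.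
Proof.
have dE i : row_mx A D 0 (rshift k i) = D 0 i by rewrite row_mxEr.
rewrite /summand /setterm /swapE /swapB Z_S_family !ZE !invfM !invrK.
rewrite inv_Z_O /inv_family /subfamily /Defs.family !inv_image.
rewrite prod_pairs_cat prod2_cat !big_cat /= !prod_pairs_image !prod_image2 !big_image !invfM.
under [X in _ = _ * _ * _ * X * _ * _ * _]eq_bigr do rewrite dE.
congr (_ * _ * _ * _ * _ * _ * _).
rewrite -!mulrA; congr (_ * _).
  by congr (_^-1); apply: eq_bigr => i _; rewrite dE.
congr (_ * _).
  by congr (_^-1); apply: eq_bigr => i _; apply: eq_bigr => j _; rewrite !dE.
congr (_ * _).
  by congr (_^-1); apply: eq_bigr => i _; apply: eq_bigr => j _; rewrite !dE.
do 5 congr (_ * _).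
  by apply: eq_bigr => i _; apply: eq_bigr => j _; rewrite !dE.
congr (_ * _).
by apply: eq_bigr => i _; apply: eq_bigr => j _; rewrite !dE.
Qed.

End DefinitionsAsProducts.

(** * Fourier coefficients *)

Section CircleIntegral.
Variable R : realType.
Local Notation K := (R[i]).
Implicit Types (g h : R -> K) (f : K -> K).

Lemma ReM (x y : K) : complex.Re (x * y) =
  complex.Re x * complex.Re y - complex.Im x * complex.Im y.
Proof. by case: x y => [a b] [c d]. Qed.

Lemma ImM (x y : K) : complex.Im (x * y) =
  complex.Re x * complex.Im y + complex.Im x * complex.Re y.
Proof. by case: x y => [a b] [c d]. Qed.

Lemma ReV (x : K) : complex.Re x^-1 =
  complex.Re x / (complex.Re x ^+ 2 + complex.Im x ^+ 2).
Proof. by case: x => [a b]. Qed.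

Lemma ImV (x : K) : complex.Im x^-1 =
  - complex.Im x / (complex.Re x ^+ 2 + complex.Im x ^+ 2).
Proof. by case: x => [a b] /=; rewrite mulNr. Qed.

(** Continuity is handled on real and imaginary parts, as the integral is. *)
Definition ccont g := continuous (fun t => complex.Re (g t) : R) /\
  continuous (fun t => complex.Im (g t) : R).

Lemma ccont_cst (a : K) : ccont (fun=> a).
Proof. by split=> t; apply: cvg_cst. Qed.

Lemma ccontD g h : ccont g -> ccont h -> ccont (fun t => g t + h t).
Proof.
move=> [gr gi] [hr hi]; split=> t.
  rewrite (_ : (fun _ => _) = (fun t => complex.Re (g t) + complex.Re (h t))).
    by apply: cvgD; [exact: gr | exact: hr].
  by apply/funext => s; case: (g s) (h s) => [? ?] [].
rewrite (_ : (fun _ => _) = (fun t => complex.Im (g t) + complex.Im (h t))).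
  by apply: cvgD; [exact: gi | exact: hi].
by apply/funext => s; case: (g s) (h s) => [? ?] [].
Qed.

Lemma ccontM g h : ccont g -> ccont h -> ccont (fun t => g t * h t).
Proof.
move=> [gr gi] [hr hi].
have E1 : (fun t => complex.Re (g t * h t)) =
    (fun t => complex.Re (g t) * complex.Re (h t) - complex.Im (g t) * complex.Im (h t)).
  by apply/funext => t; rewrite ReM.
have E2 : (fun t => complex.Im (g t * h t)) =
    (fun t => complex.Re (g t) * complex.Im (h t) + complex.Im (g t) * complex.Re (h t)).
  by apply/funext => t; rewrite ImM.
rewrite /ccont E1 E2; split=> t.
  by apply: cvgB; apply: cvgM; [exact: gr | exact: hr | exact: gi | exact: hi].
by apply: cvgD; apply: cvgM; [exact: gr | exact: hi | exact: gi | exact: hr].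
Qed.

Lemma ccontV g : (forall t, g t != 0) -> ccont g -> ccont (fun t => (g t)^-1).
Proof.
move=> g0 [gr gi].
have n0 t : complex.Re (g t) ^+ 2 + complex.Im (g t) ^+ 2 != 0.
  have := g0 t; rewrite -normr_eq0 -sqrf_eq0 -add_Re2_Im2.
  by apply: contraNneq => ->.
have nc t : (complex.Re (g x) ^+ 2 + complex.Im (g x) ^+ 2)^-1 @[x --> t] -->
    (complex.Re (g t) ^+ 2 + complex.Im (g t) ^+ 2)^-1.
  apply: cvgV; first exact: n0.
  by apply: cvgD; rewrite !expr2; apply: cvgM; [exact: gr | exact: gr | exact: gi | exact: gi].
have E1 : (fun t => complex.Re (g t)^-1) = (fun t => complex.Re (g t) *
    (complex.Re (g t) ^+ 2 + complex.Im (g t) ^+ 2)^-1).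
  by apply/funext => t; rewrite ReV.
have E2 : (fun t => complex.Im (g t)^-1) = (fun t => - complex.Im (g t) *
    (complex.Re (g t) ^+ 2 + complex.Im (g t) ^+ 2)^-1).
  by apply/funext => t; rewrite ImV.
rewrite /ccont E1 E2; split=> t.
  by apply: cvgM; [exact: gr | exact: nc].
by apply: cvgM; [apply: cvgN; exact: gi | exact: nc].
Qed.

Lemma expiD (s t : R) : expi (s + t) = expi s * expi t.
Proof. by rewrite /expi cosD sinD; congr (_ +i* _); rewrite addrC. Qed.

Lemma expi0 : expi (0 : R) = 1.
Proof. by rewrite /expi cos0 sin0. Qed.

Lemma expi_neq0 (t : R) : expi t != 0.
Proof.
apply/eqP => e0; have := expiD t (- t); rewrite subrr expi0 e0 mul0r.
by move/eqP; rewrite oner_eq0.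
Qed.

Lemma expiN (t : R) : expi (- t) = (expi t)^-1.
Proof.
by apply: (mulfI (expi_neq0 t)); rewrite -expiD subrr expi0 mulfV ?expi_neq0.
Qed.

Lemma norm_expi (t : R) : `|expi t| = 1.
Proof. by rewrite normc_def /= cos2Dsin2 sqrtr1. Qed.

Lemma sub_expi_neq0 (x : K) (t : R) : `|x| < 1 -> 1 - x * expi t != 0.
Proof.
move=> x1; rewrite subr_eq0 eq_sym; apply: contraTneq x1 => xe.
by have := congr1 Num.norm xe; rewrite normrM norm_expi mulr1 normr1 => ->; rewrite ltxx.
Qed.

Lemma sub_expiV_neq0 (x : K) (t : R) : `|x| < 1 -> 1 - x * (expi t)^-1 != 0.
Proof. by rewrite -expiN; exact: sub_expi_neq0. Qed.

Lemma ccont_expi : ccont (@expi R).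
Proof. by split=> t; [exact: continuous_cos | exact: continuous_sin]. Qed.

Lemma ccont_expi_scale (a : R) : ccont (fun t => expi (a * t)).
Proof.
split=> t /=.
  apply: (@continuous_comp _ _ _ (fun t => a * t) cos); last exact: continuous_cos.
  exact: mulrl_continuous.
apply: (@continuous_comp _ _ _ (fun t => a * t) sin); last exact: continuous_sin.
exact: mulrl_continuous.
Qed.

Local Notation circle := (`[0, 2 * pi]%classic : set R).
Local Notation mu := (@lebesgue_measure R).

Let integrable_circle (u : R -> R) : continuous u -> mu.-integrable circle (EFin \o u).
Proof.
move=> cu; apply: continuous_compact_integrable; first exact: segment_compact.
exact: continuous_subspaceT.
Qed.

Let mcircle : measurable circle.
Proof. exact: measurable_itv. Qed.

Lemma cintegralD g h : ccont g -> ccont h ->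
  cintegral circle (fun t => g t + h t) = cintegral circle g + cintegral circle h.
Proof.
move=> [gr gi] [hr hi]; rewrite /cintegral.
have E1 : (fun x => complex.Re (g x + h x)) = (fun x => complex.Re (g x) + complex.Re (h x)).
  by apply/funext => s; case: (g s) (h s) => [? ?] [].
have E2 : (fun x => complex.Im (g x + h x)) = (fun x => complex.Im (g x) + complex.Im (h x)).
  by apply/funext => s; case: (g s) (h s) => [? ?] [].
by rewrite E1 E2 !RintegralD //; exact: integrable_circle.
Qed.

Lemma cintegralZ (a : K) g : ccont g ->
  cintegral circle (fun t => a * g t) = a * cintegral circle g.
Proof.
move=> [gr gi]; case: a => [u v]; rewrite /cintegral.
have cZ (r : R) (w : R -> R) : continuous w -> continuous (fun t => r * w t).
  by move=> cw t; apply: cvgM; [exact: cvg_cst | exact: cw].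
under eq_Rintegral do rewrite ReM /=.
under [X in _ +i* X]eq_Rintegral do rewrite ImM /=.
rewrite RintegralB ?RintegralD ?RintegralZl //; try exact: integrable_circle;
  try by apply: integrable_circle; exact: cZ.
Qed.

Let two_pi_ge0 : 0 <= 2 * pi :> R.
Proof. by rewrite mulr_ge0 // pi_ge0. Qed.

Let mu_circle : fine (mu circle) = 2 * pi.
Proof.
rewrite lebesgue_measure_itv /= lte_fin; case: ltP => [_|]; first by rewrite /= subr0.
by move=> h; apply/eqP; rewrite eq_le two_pi_ge0 h.
Qed.

Let Rintegral_bound (u : R -> R) (c : R) : continuous u ->
  (forall t, circle t -> `|u t| <= c) ->
  `|\int[mu]_(t in circle) u t| <= c * (2 * pi).
Proof.
move=> cu ub; apply: le_trans (le_normr_Rintegral _ _) _ => //.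
  exact: integrable_circle.
have -> : c * (2 * pi) = \int[mu]_(t in circle) c by rewrite Rintegral_cst // mu_circle.
apply: le_Rintegral => //.
- by apply: integrable_circle => t; apply: cvg_norm; exact: cu.
- by apply: integrable_circle => t; exact: cvg_cst.
Qed.

Lemma norm_Re_le (z : K) (c : R) : `|z| <= c%:C -> `|complex.Re z| <= c.
Proof. by move=> zc; rewrite -lecR (le_trans (normc_ge_Re z)). Qed.

Lemma norm_Im_le (z : K) (c : R) : `|z| <= c%:C -> `|complex.Im z| <= c.
Proof.
move=> zc; have -> : complex.Im z = - complex.Re (z * 'i%C) by rewrite ReiNIm opprK.
by rewrite normrN; apply: norm_Re_le; rewrite normrM [`|'i%C|]normc_def /= !expr2 mul0r mul1r add0r sqrtr1 mulr1.
Qed.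

Lemma norm_complex_le (u v c : R) : `|u| <= c -> `|v| <= c -> `|u +i* v| <= (2 * c)%:C.
Proof.
move=> uc vc; have c0 : 0 <= c := le_trans (normr_ge0 _) uc.
rewrite normc_def /= lecR -[leRHS]ger0_norm ?mulr_ge0 // -sqrtr_sqr ler_wsqrtr //.
have sq (w : R) : `|w| <= c -> w ^+ 2 <= c ^+ 2.
  by move=> wc; rewrite -real_normK ?num_real // lerXn2r ?nnegrE.
apply: le_trans (lerD (sq _ uc) (sq _ vc)) _.
have c2 : 0 <= c ^+ 2 by rewrite sqr_ge0.
rewrite exprMn -[X in X + X]mul1r -mulrDl ler_wpM2r //.
by rewrite -natrX -[1 + 1]/(2%:R) ler_nat.
Qed.

Lemma cintegral_bound g (c : R) : ccont g -> (forall t, circle t -> `|g t| <= c%:C) ->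
  `|cintegral circle g| <= (2 * (c * (2 * pi)))%:C.
Proof.
move=> [gr gi] gc; apply: norm_complex_le; apply: Rintegral_bound => // t /gc.
  exact: norm_Re_le.
exact: norm_Im_le.
Qed.

Let two_pi_gt0 : 0 < 2 * pi :> R.
Proof. by rewrite mulr_gt0 // pi_gt0. Qed.

Lemma Rintegral_derivative (F u : R -> R) : continuous u ->
  (forall x : R, is_derive x 1 F (u x)) ->
  \int[mu]_(t in circle) u t = F (2 * pi) - F 0.
Proof.
move=> cu dF; have cF : continuous F.
  by move=> x; apply/differentiable_continuous/derivable1_diffP.
rewrite /Rintegral (@continuous_FTC2 _ u F) //.
- exact: continuous_subspaceT.
- split; [by [] | apply: cvg_at_right_filter | apply: cvg_at_left_filter]; exact: cF.
- by move=> x _; rewrite derive1E derive_val.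
Qed.

Lemma expi_int_period (m : int) : expi (m%:~R * (2 * pi)) = 1 :> K.
Proof.
have e1 : expi (2 * pi) = 1 :> K by rewrite /expi mulr_natl cos2pi sin2pi.
have en (n : nat) : expi (n%:R * (2 * pi)) = 1 :> K.
  elim: n => [|n IHn]; first by rewrite mul0r expi0.
  by rewrite -natr1 mulrDl mul1r expiD IHn e1 mulr1.
by case: m => n; [exact: en | rewrite NegzE intrN mulNr expiN en invr1].
Qed.

Lemma cintegral_expi (m : int) :
  cintegral circle (fun t => expi (m%:~R * t)) = (m == 0)%:R * (2 * pi)%:C.
Proof.
have [->|m0] := eqVneq m 0.
  rewrite /cintegral.
  have -> : (fun x => complex.Re (expi (0%:~R * x))) = (fun=> 1 : R).
    by apply/funext => x; rewrite mul0r /= cos0.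
  have -> : (fun x => complex.Im (expi (0%:~R * x))) = (fun=> 0 : R).
    by apply/funext => x; rewrite mul0r /= sin0.
  by rewrite !Rintegral_cst // mu_circle !mul1r mul0r.
rewrite mul0r; have mR : (m%:~R : R) != 0 by rewrite intr_eq0.
have cx : continuous (fun t : R => m%:~R * t) by exact: mulrl_continuous.
have dm (x : R) : is_derive x 1 (fun t : R => m%:~R * t) m%:~R.
  have := is_deriveZ (m%:~R : R) (is_derive_id x 1).
  by rewrite [_ *: _]mulr1.
have int1 := expi_int_period m.
have s1 : sin (m%:~R * (2 * pi)) = 0 :> R by have := congr1 (@complex.Im R) int1.
have c1 : cos (m%:~R * (2 * pi)) = 1 :> R by have := congr1 (@complex.Re R) int1.
have E1 : \int[mu]_(t in circle) cos (m%:~R * t) = 0.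
  have cc : continuous (fun t : R => cos (m%:~R * t)).
    by move=> t; apply: (continuous_comp (cx t)); exact: continuous_cos.
  have dd (x : R) : is_derive x 1 (fun t => m%:~R^-1 * sin (m%:~R * t)) (cos (m%:~R * x)).
    have := is_deriveZ (m%:~R^-1 : R) (is_derive1_comp (is_derive_sin _) (dm x)).
    by rewrite [_ *: _]mulrC mulfK.
  by rewrite (Rintegral_derivative cc dd) s1 !mulr0 sin0 mulr0 subrr.
have E2 : \int[mu]_(t in circle) sin (m%:~R * t) = 0.
  have cc : continuous (fun t : R => sin (m%:~R * t)).
    by move=> t; apply: (continuous_comp (cx t)); exact: continuous_sin.
  have dd (x : R) : is_derive x 1 (fun t => - m%:~R^-1 * cos (m%:~R * t)) (sin (m%:~R * x)).
    have := is_deriveZ (- m%:~R^-1 : R) (is_derive1_comp (is_derive_cos _) (dm x)).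
    by rewrite [_ *: _]mulrC mulNr mulrNN mulfK.
  by rewrite (Rintegral_derivative cc dd) c1 mulr0 cos0 subrr.
by rewrite /cintegral /expi /= E1 E2.
Qed.

Section Coefficients.
Implicit Types m : int.

Definition continuous_on_circle f := ccont (f \o expi).

Let ccont_mode f m : continuous_on_circle f ->
  ccont (fun t => f (expi t) * expi (- (m%:~R * t))).
Proof.
move=> cf; apply: ccontM => //.
have -> : (fun t : R => expi (- (m%:~R * t))) = (fun t : R => expi (- m%:~R * t)).
  by apply/funext => t; rewrite mulNr.
exact: (ccont_expi_scale (- m%:~R)).
Qed.

Let eq_mode f (m : int) (g : R -> K) :
  (forall t, f (expi t) * expi (- (m%:~R * t)) = g t) ->
  fourier_coef f m = ((2 * pi)^-1)%:C * cintegral circle g.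
Proof. by move=> /funext e; rewrite /fourier_coef e. Qed.

Lemma fourier_coefD f1 f2 m : continuous_on_circle f1 -> continuous_on_circle f2 ->
  fourier_coef (fun z => f1 z + f2 z) m = fourier_coef f1 m + fourier_coef f2 m.
Proof.
move=> c1 c2; rewrite {2 3}/fourier_coef -mulrDr -cintegralD; try exact: ccont_mode.
by apply: eq_mode => t; rewrite mulrDl.
Qed.

Lemma fourier_coefZ a f m : continuous_on_circle f ->
  fourier_coef (fun z => a * f z) m = a * fourier_coef f m.
Proof.
move=> cf; rewrite {2}/fourier_coef mulrCA -cintegralZ; last exact: ccont_mode.
by apply: eq_mode => t; rewrite mulrA.
Qed.

Lemma eq_fourier_coef f1 f2 m : (forall t, f1 (expi t) = f2 (expi t)) ->
  fourier_coef f1 m = fourier_coef f2 m.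
Proof.
by move=> e; apply: eq_mode => t; rewrite e.
Qed.

Lemma fourier_coef_mulz f m : fourier_coef (fun z => z * f z) m = fourier_coef f (m - 1).
Proof.
apply: eq_mode => t; rewrite [expi t * _]mulrC -mulrA -expiD.
by rewrite intrB mulrBl mul1r opprB.
Qed.

Lemma fourier_coef_mulVz f m : fourier_coef (fun z => z^-1 * f z) m = fourier_coef f (m + 1).
Proof.
rewrite -[m in LHS](addrK 1) -fourier_coef_mulz; apply: eq_fourier_coef => t.
by rewrite mulVKf ?expi_neq0.
Qed.

Lemma fourier_coef1 m : fourier_coef (fun _ : K => 1 : K) m = (m == 0)%:R.
Proof.
have -> : fourier_coef (fun _ : K => 1 : K) m =
    ((2 * pi)^-1)%:C * cintegral circle (fun t => expi ((- m)%:~R * t)).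
  by apply: eq_mode => t; rewrite mul1r intrN mulNr.
rewrite cintegral_expi oppr_eq0 mulrCA -rmorphM mulVf ?mulr1 //.
by rewrite gt_eqF.
Qed.

Lemma fourier_coef_bound f (c : R) m : continuous_on_circle f ->
  (forall t, circle t -> `|f (expi t)| <= c%:C) -> `|fourier_coef f m| <= (2 * c)%:C.
Proof.
move=> cf fc; rewrite /fourier_coef normrM.
have -> : `|((2 * pi)^-1)%:C| = ((2 * pi)^-1)%:C :> K.
  by rewrite ger0_norm // lecR invr_ge0.
have ch : ccont (fun t => f (expi t) * expi (- (m%:~R * t))).
  exact: ccont_mode.
have hb t : circle t -> `|f (expi t) * expi (- (m%:~R * t))| <= c%:C.
  by rewrite normrM norm_expi mulr1; exact: fc.
apply: le_trans (ler_wpM2l _ (cintegral_bound ch hb)) _.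
  by rewrite lecR invr_ge0.
rewrite -rmorphM lecR mulrCA [_ * (c * _)]mulrCA mulVf ?mulr1 //.
by rewrite gt_eqF.
Qed.

Lemma fourier_coef_bounded f : continuous_on_circle f ->
  exists c : R, forall m, `|fourier_coef f m| <= c%:C.
Proof.
move=> cf; have [cr ci] := cf.
have bnd (u : R -> R) : continuous u -> exists c : R, forall t, circle t -> `|u t| <= c.
  move=> cu; have cn : {within circle, continuous (fun t => `|u t|)}.
    by apply: continuous_subspaceT => t; apply: cvg_norm; exact: cu.
  by have [t _ ht] := EVT_max two_pi_ge0 cn; exists `|u t|.
have [a ha] := bnd _ cr; have [b hb] := bnd _ ci.
exists (2 * (2 * Num.max a b)) => m; apply: fourier_coef_bound => // t ct.
have -> : f (expi t) = complex.Re (f (expi t)) +i* complex.Im (f (expi t)) by case: (f _).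
apply: norm_complex_le; rewrite le_max; first by rewrite ha.
by rewrite hb // orbT.
Qed.

End Coefficients.
End CircleIntegral.

(** * Fourier coefficients of rational functions *)

Section RationalSymbols.
Variable R : realType.
Local Notation K := (R[i]).
Implicit Types (f g : K -> K) (m : int).

Lemma continuous_on_circle_cst (a : K) : continuous_on_circle (fun=> a).
Proof. exact: ccont_cst. Qed.

Lemma continuous_on_circle_id : continuous_on_circle (id : K -> K).
Proof. exact: ccont_expi. Qed.

Lemma continuous_on_circleD f g : continuous_on_circle f -> continuous_on_circle g ->
  continuous_on_circle (fun z => f z + g z).
Proof. exact: ccontD. Qed.

Lemma continuous_on_circleM f g : continuous_on_circle f -> continuous_on_circle g ->
  continuous_on_circle (fun z => f z * g z).
Proof. exact: ccontM. Qed.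

Lemma continuous_on_circleV f : (forall t, f (expi t) != 0) -> continuous_on_circle f ->
  continuous_on_circle (fun z => (f z)^-1).
Proof. exact: ccontV. Qed.

Lemma continuous_on_circle_inv : continuous_on_circle (fun z : K => z^-1).
Proof.
by apply: continuous_on_circleV continuous_on_circle_id => t; exact: expi_neq0.
Qed.

Lemma continuous_on_circleX f l : continuous_on_circle f ->
  continuous_on_circle (fun z => f z ^+ l).
Proof.
move=> cf; elim: l => [|l IHl].
  by apply: continuous_on_circle_cst.
rewrite (_ : (fun z => _) = (fun z => f z * f z ^+ l)).
  exact: continuous_on_circleM.
by apply/funext => z; rewrite exprS.
Qed.

Lemma continuous_on_circle_1sub (c : K) f : continuous_on_circle f ->
  continuous_on_circle (fun z => 1 - c * f z).
Proof.
move=> cf; rewrite (_ : (fun z => _) = (fun z => 1 + (- c) * f z)).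
  apply: continuous_on_circleD; first exact: continuous_on_circle_cst.
  exact: continuous_on_circleM (continuous_on_circle_cst _) cf.
by apply/funext => z; rewrite mulNr.
Qed.

Lemma continuous_on_circle_prod (I : Type) (s : seq I) (F : I -> K -> K) :
  (forall i, continuous_on_circle (F i)) ->
  continuous_on_circle (fun z => \prod_(i <- s) F i z).
Proof.
move=> cF; elim: s => [|x s IHs].
  rewrite (_ : (fun z => _) = (fun=> 1)); first exact: continuous_on_circle_cst.
  by apply/funext => z; rewrite big_nil.
rewrite (_ : (fun z => _) = (fun z => F x z * \prod_(i <- s) F i z)).
  exact: continuous_on_circleM.
by apply/funext => z; rewrite big_cons.
Qed.

Lemma continuous_on_circle_horner (p : {poly K}) : continuous_on_circle (horner p).
Proof.
elim/poly_ind: p => [|p c IHp].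
  rewrite (_ : horner 0 = (fun=> 0)); first exact: continuous_on_circle_cst.
  by apply/funext => z; rewrite horner0.
rewrite (_ : horner _ = (fun z => p.[z] * z + c)).
  apply: continuous_on_circleD; last exact: continuous_on_circle_cst.
  exact: continuous_on_circleM IHp continuous_on_circle_id.
by apply/funext => z; rewrite !hornerE.
Qed.

Lemma fourier_coef_mulXn f l m :
  fourier_coef (fun z => z ^+ l * f z) m = fourier_coef f (m - l%:Z).
Proof.
elim: l m => [|l IHl] m.
  by rewrite subr0; apply: eq_fourier_coef => t; rewrite expr0 mul1r.
have -> : fourier_coef (fun z => z ^+ l.+1 * f z) m =
    fourier_coef (fun z => z * (z ^+ l * f z)) m.
  by apply: eq_fourier_coef => t; rewrite exprS mulrA.
rewrite (fourier_coef_mulz (fun z => z ^+ l * f z)) IHl.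
by congr fourier_coef; rewrite -addrA -opprD -intS.
Qed.

Lemma fourier_coef_mulXV f l m :
  fourier_coef (fun z => z ^- l * f z) m = fourier_coef f (m + l%:Z).
Proof.
rewrite -[m in LHS](addrK l%:Z) -fourier_coef_mulXn; apply: eq_fourier_coef => t.
by rewrite mulVKf // expf_neq0 // expi_neq0.
Qed.

Lemma fourier_coef_mul_poly (p : {poly K}) f N m : continuous_on_circle f ->
  (size p <= N)%N ->
  fourier_coef (fun z => p.[z] * f z) m = \sum_(l < N) p`_l * fourier_coef f (m - l%:Z).
Proof.
move=> cf sp.
have -> : fourier_coef (fun z => p.[z] * f z) m =
    fourier_coef (fun z => \sum_(l < N) p`_l * (z ^+ l * f z)) m.
  apply: eq_fourier_coef => t; rewrite (horner_coef_wide _ sp) mulr_suml.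
  by apply: eq_bigr => l _; rewrite mulrA.
have cX l : continuous_on_circle (fun z => z ^+ l * f z).
  apply: continuous_on_circleM cf; exact: continuous_on_circleX continuous_on_circle_id.
have cS l' : continuous_on_circle (fun z => \sum_(l < l') p`_l * (z ^+ l * f z)).
  elim: l' => [|n IHn].
    rewrite (_ : (fun z => _) = (fun=> 0)); first exact: continuous_on_circle_cst.
    by apply/funext => z; rewrite big_ord0.
  rewrite (_ : (fun z => _) = (fun z => \sum_(l < n) p`_l * (z ^+ l * f z) +
     p`_n * (z ^+ n * f z))); last by apply/funext => z; rewrite big_ord_recr.
  apply: continuous_on_circleD => //.
  exact: continuous_on_circleM (continuous_on_circle_cst _) (cX n).
elim: N {sp} => [|N IHN].
  rewrite big_ord0 (@eq_fourier_coef _ _ (fun z => 0 * (1 : K))) => [|t].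
    by rewrite (fourier_coefZ 0 m (continuous_on_circle_cst 1)) mul0r.
  by rewrite big_ord0 mul0r.
rewrite (@eq_fourier_coef _ _ (fun z => \sum_(l < N) p`_l * (z ^+ l * f z) +
     p`_N * (z ^+ N * f z))) => [|t]; last by rewrite big_ord_recr.
rewrite (fourier_coefD m (cS N)); last first.
  exact: continuous_on_circleM (continuous_on_circle_cst _) (cX N).
rewrite IHN (fourier_coefZ _ _ (cX N)) fourier_coef_mulXn.
by rewrite big_ord_recr.
Qed.

Lemma fourier_coef_poly (p : {poly K}) m :
  fourier_coef (horner p) m = if m is Posz i then p`_i else 0.
Proof.
pose N := maxn (size p) (absz m).+1.
have sp : (size p <= N)%N by rewrite leq_maxl.
have -> : fourier_coef (horner p) m = fourier_coef (fun z => p.[z] * (1 : K)) m.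
  by apply: eq_fourier_coef => t; rewrite mulr1.
rewrite (fourier_coef_mul_poly _ (continuous_on_circle_cst 1) sp).
under eq_bigr do rewrite fourier_coef1 subr_eq0.
case: m @N sp => i N sp.
  have iN : (i < N)%N by rewrite leq_max ltnSn orbT.
  rewrite (bigD1 (Ordinal iN)) //= eqxx mulr1 big1 ?addr0 // => l li.
  rewrite eqz_nat eq_sym; move: li; rewrite -val_eqE /= => /negPf ->.
  by rewrite mulr0.
by rewrite big1 // => l _; rewrite mulr0.
Qed.

(** u_n = c^N u_(n + N) tends to 0 with N. *)
Lemma bounded_geometric_eq0 (u : nat -> K) (c : K) (b : R) : `|c| < 1 ->
  (forall n, `|u n| <= b%:C) -> (forall n, u n = c * u n.+1) -> forall n, u n = 0.
Proof.
move=> c1 ub uc n.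
have uN N : u n = c ^+ N * u (n + N)%N.
  elim: N => [|N IHN]; first by rewrite mul1r addn0.
  by rewrite exprSr -mulrA addnS -uc.
pose r := complex.Re `|c|; have rE : `|c| = r%:C by rewrite /r normc_def.
pose x := complex.Re `|u n|; have xE : `|u n| = x%:C by rewrite /x normc_def.
have r0 : 0 <= r by rewrite -lecR -rE; exact: normr_ge0.
have r1 : `|r| < 1 by rewrite ger0_norm // -ltcR -rE; exact: c1.
have xb N : x <= r ^+ N * b.
  rewrite -lecR -xE (uN N) normrM normrX rE rmorphM rmorphXn /= ler_wpM2l //.
  by rewrite -rmorphXn lecR exprn_ge0.
have cv : (fun N => r ^+ N * b) @ \oo --> (0 * b : R).
  by apply: cvgM; [exact: cvg_expr | exact: cvg_cst].
have x0 : x <= 0.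
  rewrite -(mul0r b); apply: (cvgr_to_ge cv); exact: nearW.
by apply/eqP; rewrite -normr_le0 xE lecR.
Qed.

(** The coefficients u_i, for i >= 0, of the quotient g are bounded and satisfy
    u_i = c * u_(i + 1), since those of g - c z^-1 g vanish. *)
Lemma fourier_coef_div_subV f (c : K) : `|c| < 1 -> continuous_on_circle f ->
  (forall i : nat, fourier_coef f i%:Z = 0) ->
  continuous_on_circle (fun z => f z / (1 - c * z^-1)) /\
  (forall i : nat, fourier_coef (fun z => f z / (1 - c * z^-1)) i%:Z = 0).
Proof.
move=> c1 cf f0.
have n0 t : 1 - c * (expi t)^-1 != 0 by exact: sub_expiV_neq0.
have cg : continuous_on_circle (fun z => f z / (1 - c * z^-1)).
  apply: continuous_on_circleM cf _; apply: continuous_on_circleV => //.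
  exact: continuous_on_circle_1sub continuous_on_circle_inv.
split=> //; set g := (fun z => _) in cg *.
have [b gb] := fourier_coef_bounded cg.
have rec (i : nat) : fourier_coef g i%:Z = c * fourier_coef g i.+1%:Z.
  apply/eqP; rewrite -subr_eq0 -(f0 i); apply/eqP.
  have -> : fourier_coef f i = fourier_coef (fun z => g z + - c * (z^-1 * g z)) i.
    by apply: eq_fourier_coef => t; rewrite -[LHS](divfK (n0 t)) /g; ring.
  have cVg : continuous_on_circle (fun z => z^-1 * g z).
    exact: continuous_on_circleM continuous_on_circle_inv cg.
  rewrite (fourier_coefD _ cg); last first.
    exact: continuous_on_circleM (continuous_on_circle_cst _) cVg.
  rewrite (fourier_coefZ _ _ cVg) (fourier_coef_mulVz g) mulNr.
  by rewrite (_ : i%:Z + 1 = i.+1%:Z) //; lia.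
exact: (@bounded_geometric_eq0 (fun i : nat => fourier_coef g i%:Z) c b).
Qed.

Lemma fourier_coef_div_sub f (d : K) : `|d| < 1 -> continuous_on_circle f ->
  (forall i : nat, fourier_coef f (Negz i) = 0) ->
  continuous_on_circle (fun z => f z / (1 - d * z)) /\
  (forall i : nat, fourier_coef (fun z => f z / (1 - d * z)) (Negz i) = 0).
Proof.
move=> d1 cf f0.
have n0 t : 1 - d * expi t != 0 by exact: sub_expi_neq0.
have cg : continuous_on_circle (fun z => f z / (1 - d * z)).
  apply: continuous_on_circleM cf _; apply: continuous_on_circleV => //.
  exact: continuous_on_circle_1sub continuous_on_circle_id.
split=> //; set g := (fun z => _) in cg *.
have [b gb] := fourier_coef_bounded cg.
have rec (i : nat) : fourier_coef g (Negz i) = d * fourier_coef g (Negz i.+1).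
  apply/eqP; rewrite -subr_eq0 -(f0 i); apply/eqP.
  have -> : fourier_coef f (Negz i) = fourier_coef (fun z => g z + - d * (z * g z)) (Negz i).
    by apply: eq_fourier_coef => t; rewrite -[LHS](divfK (n0 t)) /g; ring.
  have czg : continuous_on_circle (fun z => z * g z).
    exact: continuous_on_circleM continuous_on_circle_id cg.
  rewrite (fourier_coefD _ cg); last first.
    exact: continuous_on_circleM (continuous_on_circle_cst _) czg.
  rewrite (fourier_coefZ _ _ czg) (fourier_coef_mulz g) mulNr.
  by rewrite (_ : Negz i - 1 = Negz i.+1) //; lia.
exact: (@bounded_geometric_eq0 (fun i : nat => fourier_coef g (Negz i)) d b).
Qed.

Lemma fourier_coef_div_prod_subV f (I : Type) (s : seq I) (c : I -> K) :
  (forall i, `|c i| < 1) -> continuous_on_circle f ->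
  (forall i : nat, fourier_coef f i%:Z = 0) ->
  continuous_on_circle (fun z => f z / \prod_(i <- s) (1 - c i * z^-1)) /\
  (forall i : nat, fourier_coef (fun z => f z / \prod_(i <- s) (1 - c i * z^-1)) i%:Z = 0).
Proof.
move=> c1 cf f0; elim: s => [|x s [cs s0]].
  rewrite (_ : (fun z => _) = f) //; apply/funext => z.
  by rewrite big_nil divr1.
have := fourier_coef_div_subV (c1 x) cs s0.
rewrite (_ : (fun z => _ / _ / _) = (fun z => f z / \prod_(i <- x :: s) (1 - c i * z^-1))) //.
by apply/funext => z; rewrite big_cons invfM mulrA mulrAC.
Qed.

Lemma fourier_coef_div_prod_sub f (I : Type) (s : seq I) (d : I -> K) :
  (forall i, `|d i| < 1) -> continuous_on_circle f ->
  (forall i : nat, fourier_coef f (Negz i) = 0) ->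
  continuous_on_circle (fun z => f z / \prod_(i <- s) (1 - d i * z)) /\
  (forall i : nat, fourier_coef (fun z => f z / \prod_(i <- s) (1 - d i * z)) (Negz i) = 0).
Proof.
move=> d1 cf f0; elim: s => [|x s [cs s0]].
  rewrite (_ : (fun z => _) = f) //; apply/funext => z.
  by rewrite big_nil divr1.
have := fourier_coef_div_sub (d1 x) cs s0.
rewrite (_ : (fun z => _ / _ / _) = (fun z => f z / \prod_(i <- x :: s) (1 - d i * z))) //.
by apply/funext => z; rewrite big_cons invfM mulrA mulrAC.
Qed.

End RationalSymbols.

(** * From the Toeplitz plus Hankel matrix to the polynomials P_j *)

Section SymbolCoefficients.
Variables (R : realType) (k : nat).
Local Notation K := (R[i]).
Variables A B C D : 'rV[K]_k.
Hypothesis C1 : forall i, `|C 0 i| < 1.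
Hypothesis D1 : forall i, `|D 0 i| < 1.
Local Notation a := (fun i => A 0 i).
Local Notation b := (fun i => B 0 i).
Local Notation c := (fun i => C 0 i).
Local Notation d := (fun i => D 0 i).
Local Notation phi := (symbol A B C D).

Lemma symbolE (z : K) : z != 0 ->
  phi z = (rootp a * recp b).[z] / (\prod_i (z - C 0 i) * (recp d).[z]).
Proof.
move=> z0; rewrite /symbol hornerM horner_rootp !horner_recp -!big_split /= -prodfV -big_split /=.
apply: eq_bigr => i _; rewrite [z - A 0 i](_ : _ = z * (1 - A 0 i * z^-1)); last by field.
rewrite [z - C 0 i](_ : _ = z * (1 - C 0 i * z^-1)); last by field.
by rewrite !invfM -[LHS]mul1r -(mulfV z0); ring.
Qed.

Lemma continuous_on_circle_symbol : continuous_on_circle phi.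
Proof.
have cV x : continuous_on_circle (fun z : K => 1 - x * z^-1).
  exact: continuous_on_circle_1sub (continuous_on_circle_inv R).
have cI x : continuous_on_circle (fun z : K => 1 - x * z).
  exact: continuous_on_circle_1sub (continuous_on_circle_id R).
apply: continuous_on_circle_prod => i.
apply: continuous_on_circleM; first exact: continuous_on_circleM (cV _) (cI _).
apply: continuous_on_circleV => [t|]; last exact: continuous_on_circleM (cV _) (cI _).
by rewrite mulf_neq0 ?sub_expiV_neq0 ?sub_expi_neq0.
Qed.

(** Dividing the splitting identity by the denominator of phi and by the power of z
    in wpoly writes phi * (z^j + z^(-j-1)) as P / recp d, analytic in the disc, plus
    a function r analytic outside it and zero at infinity. *)
Lemma fourier_coef_split j (P N : {poly K}) :
  rootp a * recp b * wpoly K j = 'X^(j.+1) * P * rootp c + N * recp d ->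
  (size N <= j.+1 + k)%N ->
  let q := fun z => P.[z] / (recp d).[z] in
  [/\ continuous_on_circle q,
      forall i : nat, fourier_coef q (Negz i) = 0 &
      forall i : nat, fourier_coef phi (i%:Z - j%:Z) + fourier_coef phi (i%:Z + j%:Z + 1) =
                      fourier_coef q i%:Z].
Proof.
move=> E sN q.
have P0 (i : nat) : fourier_coef (horner P) (Negz i) = 0 by rewrite fourier_coef_poly.
have [cq q0] := fourier_coef_div_prod_sub (index_enum 'I_k) D1 (continuous_on_circle_horner P) P0.
have qE : (fun z => P.[z] / \prod_i (1 - D 0 i * z)) = q.
  by apply/funext => z; rewrite /q horner_recp.
rewrite qE in cq q0; split => //.
pose r z : K := z ^- (j.+1 + k) * N.[z] / \prod_i (1 - C 0 i * z^-1).
have cN : continuous_on_circle (fun z => z ^- (j.+1 + k) * N.[z]).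
  apply: continuous_on_circleM (continuous_on_circle_horner N).
  apply: continuous_on_circleV => [t|]; first by rewrite expf_neq0 ?expi_neq0.
  exact: continuous_on_circleX (continuous_on_circle_id R).
have N0 (i : nat) : fourier_coef (fun z => z ^- (j.+1 + k) * N.[z]) i%:Z = 0.
  rewrite (fourier_coef_mulXV (horner N)) fourier_coef_poly -PoszD nth_default //.
  by apply: leq_trans sN _; rewrite leq_addl.
have [cr r0] := fourier_coef_div_prod_subV (index_enum 'I_k) C1 cN N0.
rewrite -/r in cr r0.
move=> i; rewrite -(addr0 (fourier_coef q i%:Z)) -{1}(r0 i) -fourier_coefD //.
have cphi := continuous_on_circle_symbol.
have cj : continuous_on_circle (fun z => z ^+ j * phi z).
  apply: continuous_on_circleM => //.
  exact: continuous_on_circleX (continuous_on_circle_id R).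
have cj' : continuous_on_circle (fun z => z ^- j.+1 * phi z).
  apply: continuous_on_circleM => //; apply: continuous_on_circleV => [t|].
    by rewrite expf_neq0 ?expi_neq0.
  exact: continuous_on_circleX (continuous_on_circle_id R).
have -> : i%:Z + j%:Z + 1 = i%:Z + j.+1%:Z by lia.
rewrite -fourier_coef_mulXn -fourier_coef_mulXV -fourier_coefD //.
apply: eq_fourier_coef => t; set z := expi t; have z0 : z != 0 by exact: expi_neq0.
have c0 : \prod_i (z - C 0 i) != 0.
  apply/prodf_neq0 => l _; rewrite (_ : z - C 0 l = z * (1 - C 0 l * z^-1)); last by field.
  by rewrite mulf_neq0 ?sub_expiV_neq0.
have d0 : (recp d).[z] != 0.
  by rewrite horner_recp; apply/prodf_neq0 => l _; exact: sub_expi_neq0.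
have cE : \prod_i (1 - C 0 i * z^-1) = \prod_i (z - C 0 i) / z ^+ k.
  rewrite -[in z ^+ k](card_ord k) -prodr_const -prodfV -big_split /=.
  by apply: eq_bigr => l _; field.
have wE : (wpoly K j).[z] = z ^+ j.+1 * (z ^+ j + z ^- j.+1).
  by rewrite /wpoly hornerD hornerXn hornerC mulrDr -exprD mulfV ?expf_neq0.
have zj : z ^+ j.+1 != 0 by rewrite expf_neq0.
have zk : z ^+ k != 0 by rewrite expf_neq0.
rewrite -mulrDl symbolE // /q /r cE.
have := congr1 (fun p : {poly K} => p.[z]) E.
rewrite hornerD !hornerM hornerXn wE horner_rootp (horner_rootp c) => E'.
apply: (mulfI zj); rewrite exprD.
transitivity ((\prod_i (z - A 0 i) * (recp b).[z] * (z ^+ j.+1 * (z ^+ j + z ^- j.+1))) /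
   (\prod_i (z - C 0 i) * (recp d).[z])).
  by ring.
by rewrite E'; field; rewrite zj zk c0 d0.
Qed.

(** As P_j = recp d * (P_j / recp d), the coefficients of P_j of index less than n
    are obtained from column j of the matrix by multiplication with the
    unitriangular Toeplitz matrix of the coefficients of recp d. *)
Lemma det_toeplitz_plus_hankel n : exists P N : nat -> {poly K},
  [/\ forall j, rootp a * recp b * wpoly K j =
             'X^(j.+1) * P j * rootp c + N j * recp d,
      forall j, (size (N j) <= j.+1 + k)%N,
      forall j, (size (P j) <= (j + k).+1)%N,
      forall j, (P j)`_(j + k) = \prod_i (- B 0 i) &
      \det (toeplitz_plus_hankel n phi) = \det (\matrix_(i < n, j < n) (P j)`_i)].
Proof.
have cd i l : C 0 i * D 0 l != 1 by exact: mulr_neq1_norm.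
have /choice[PN PNP] : forall j, exists PN : {poly K} * {poly K},
  [/\ rootp a * recp b * wpoly K j = 'X^(j.+1) * PN.1 * rootp c + PN.2 * recp d,
      (size PN.2 <= j.+1 + k)%N, (size PN.1 <= (j + k).+1)%N &
      (PN.1)`_(j + k) = \prod_i (- B 0 i)].
  by move=> j; have [P [N H]] := @Wiener_Hopf_split _ k a b c d j cd; exists (P, N).
pose P j := (PN j).1; pose N j := (PN j).2.
have hE j : rootp a * recp b * wpoly K j = 'X^(j.+1) * P j * rootp c + N j * recp d.
  by have [] := PNP j.
have sN j : (size (N j) <= j.+1 + k)%N by have [] := PNP j.
exists P, N; split=> //; try by move=> j; have [] := PNP j.
pose L : 'M[K]_n := \matrix_(i, l) (if (l <= i)%N then (recp d)`_(i - l) else 0).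
have dL : \det L = 1.
  rewrite det_trig; last by apply/is_trig_mxP => i l il; rewrite mxE leqNgt il.
  by rewrite big1 // => i _; rewrite mxE leqnn subnn coef0_recp.
rewrite -[LHS]mul1r -dL -det_mulmx; congr (\det _); apply/matrixP => i j; rewrite !mxE.
have [cq q0 qE] := fourier_coef_split (hE j) (sN j).
set q := (fun z => _) in cq q0 qE.
have -> : (P j)`_i = fourier_coef (fun z => (recp d).[z] * q z) i%:Z.
  have := fourier_coef_poly (P j) i%:Z; rewrite /= => <-.
  apply: eq_fourier_coef => t; rewrite /q mulrC divfK //.
  by rewrite horner_recp; apply/prodf_neq0 => l _; exact: sub_expi_neq0.
have sd : (size (recp d) <= i.+1 + k.+1)%N.
  by apply: leq_trans (size_recp d) _; rewrite leq_addl.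
rewrite (fourier_coef_mul_poly _ cq sd) big_split_ord /= [X in _ = _ + X]big1 ?addr0; last first.
  move=> l _; rewrite (_ : i%:Z - (i.+1 + l)%:Z = Negz l) ?q0 ?mulr0 //; lia.
transitivity (\sum_(l < i.+1) (recp d)`_(i - l) * fourier_coef q l%:Z).
  rewrite (big_ord_widen _ (fun l => (recp d)`_(i - l) * fourier_coef q l%:Z) (ltn_ord i)).
  rewrite [RHS]big_mkcond; apply: eq_bigr => l _; rewrite !mxE qE ltnS.
  by case: ifP => // _; rewrite mul0r.
rewrite (reindex_inj rev_ord_inj) /=; apply: eq_bigr => l _.
have li : (l <= i)%N by rewrite -ltnS.
by rewrite subSS subKn // -subzn.
Qed.

End SymbolCoefficients.

(** * Continuity of the determinant in the parameters *)

Section Convergence.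
Variable R : realType.
Local Notation K := (R[i]).

Section Filters.
Context {T : Type} {F : set_system T} {FF : Filter F}.
Implicit Types (f g : T -> K).

Lemma cvg_prodr (I : Type) (s : seq I) (P : pred I) (f : I -> T -> K) (l : I -> K) :
  (forall i, P i -> f i x @[x --> F] --> l i) ->
  \prod_(i <- s | P i) f i x @[x --> F] --> \prod_(i <- s | P i) l i.
Proof.
move=> fl; apply: cvg_big => //.
by move=> [x y]; apply: cvgM; [exact: cvg_fst | exact: cvg_snd].
Qed.

Lemma cvg_sumr (I : Type) (s : seq I) (P : pred I) (f : I -> T -> K) (l : I -> K) :
  (forall i, P i -> f i x @[x --> F] --> l i) ->
  \sum_(i <- s | P i) f i x @[x --> F] --> \sum_(i <- s | P i) l i.
Proof.
move=> fl; apply: cvg_big => //.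
by move=> [x y]; apply: cvgD; [exact: cvg_fst | exact: cvg_snd].
Qed.

Lemma cvg_exprn f (l : K) n : f x @[x --> F] --> l -> f x ^+ n @[x --> F] --> l ^+ n.
Proof.
move=> fl; elim: n => [|n IHn]; first exact: cvg_cst.
rewrite (_ : (fun x => f x ^+ n.+1) = (fun x => f x * f x ^+ n)).
  by rewrite exprS; exact: (cvgM fl IHn).
by apply/funext => x; rewrite exprS.
Qed.

Lemma cvg_det n (M : T -> 'M[K]_n) (L : 'M[K]_n) :
  (forall i j, M x i j @[x --> F] --> L i j) -> \det (M x) @[x --> F] --> \det L.
Proof.
move=> ML; apply: cvg_sumr => s _; apply: cvgM; first exact: cvg_cst.
by apply: cvg_prodr => i _; exact: ML.
Qed.

(** Uniform convergence to a bounded function, in the form in which it passes to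
    products and inverses. *)
Definition ucvg (f : T -> R -> K) (g : R -> K) :=
  (exists b : K, forall t, `|g t| <= b) /\
  forall eps : K, 0 < eps -> \forall x \near F, forall t, `|g t - f x t| <= eps.

Lemma ucvg_cst (g : R -> K) (b : K) : (forall t, `|g t| <= b) -> ucvg (fun=> g) g.
Proof.
move=> gb; split; first by exists b.
by move=> eps e0; apply: nearW => x t; rewrite subrr normr0 ltW.
Qed.

Lemma ucvgM (f1 f2 : T -> R -> K) (g1 g2 : R -> K) : ucvg f1 g1 -> ucvg f2 g2 ->
  ucvg (fun x t => f1 x t * f2 x t) (fun t => g1 t * g2 t).
Proof.
move=> [[b1 gb1] u1] [[b2 gb2] u2].
have b10 : 0 <= b1 := le_trans (normr_ge0 _) (gb1 0).
have b20 : 0 <= b2 := le_trans (normr_ge0 _) (gb2 0).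
split; first by exists (b1 * b2) => t; rewrite normrM ler_pM.
move=> eps e0; pose c := b1 + (b2 + 1).
have c0 : 0 < c by rewrite ltr_wpDl // ltr_wpDl.
pose e := eps / (eps + c).
have ec : 0 < eps + c by rewrite addr_gt0.
have e'0 : 0 < e by rewrite divr_gt0.
have e'1 : e <= 1 by rewrite ler_pdivrMr // mul1r lerDl ltW.
have e'c : e * c <= eps.
  rewrite /e mulrAC ler_pdivrMr // ler_pM2l // lerDr ltW //.
near=> x.
have h1 : forall t, `|g1 t - f1 x t| <= e by near: x; exact: u1.
have h2 : forall t, `|g2 t - f2 x t| <= e by near: x; exact: u2.
move=> t.
have -> : g1 t * g2 t - f1 x t * f2 x t =
    g1 t * (g2 t - f2 x t) + (g1 t - f1 x t) * f2 x t by ring.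
apply: le_trans (ler_normD _ _) _; rewrite !normrM.
have hf2 : `|f2 x t| <= b2 + 1.
  have -> : f2 x t = g2 t - (g2 t - f2 x t) by ring.
  apply: le_trans (ler_normB _ _) _; apply: lerD; first exact: gb2.
  exact: le_trans (h2 t) e'1.
apply: le_trans e'c; rewrite /c mulrDr; apply: lerD.
  by rewrite mulrC ler_pM.
by rewrite ler_pM.
Unshelve. all: by end_near. Qed.

Lemma ucvgV (f : T -> R -> K) (g : R -> K) (m : K) : 0 < m -> (forall t, m <= `|g t|) ->
  ucvg f g -> ucvg (fun x t => (f x t)^-1) (fun t => (g t)^-1).
Proof.
move=> m0 gm [_ u]; split.
  by exists m^-1 => t; rewrite normfV lef_pV2 ?posrE // (lt_le_trans m0).
move=> eps e0; pose e := eps * m * m / 2 / (1 + eps * m).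
have em0 : 0 < 1 + eps * m by rewrite addr_gt0 // mulr_gt0.
have e'0 : 0 < e by rewrite !(divr_gt0, mulr_gt0).
near=> x.
have ht : forall t, `|g t - f x t| <= e by near: x; exact: u.
move=> t; have h := ht t.
have em2 : e <= m / 2.
  rewrite /e -[_ * m / 2]mulrA mulrAC ler_piMl ?divr_ge0 ?ltW //.
  by rewrite ltr_pdivrMr // mul1r ltrDr.
have eem : e <= eps * (m * (m / 2)).
  rewrite /e ler_pdivrMr // (_ : eps * (m * (m / 2)) = eps * m * m / 2); last by ring.
  apply: ler_peMr; first by rewrite ltW // !(divr_gt0, mulr_gt0).
  by rewrite lerDl ltW // mulr_gt0.
have f2 : m / 2 <= `|f x t|.
  rewrite -(lerD2r (m / 2)) -splitr; apply: le_trans (gm t) _.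
  have -> : g t = f x t + (g t - f x t) by ring.
  by apply: le_trans (ler_normD _ _) _; rewrite lerD2l (le_trans h).
have g0 : g t != 0 by rewrite -normr_gt0 (lt_le_trans m0).
have m20 : 0 < m / 2 by rewrite divr_gt0.
have f0 : f x t != 0 by rewrite -normr_gt0 (lt_le_trans m20).
have -> : (g t)^-1 - (f x t)^-1 = - (g t - f x t) / (g t * f x t).
  by field; rewrite g0 f0.
rewrite normrM normrN normfV ler_pdivrMr ?normr_gt0 ?mulf_neq0 //.
apply: le_trans (le_trans h eem) _; rewrite ler_pM2l // normrM.
by apply: ler_pM => //; rewrite ltW.
Unshelve. all: by end_near. Qed.

Lemma ucvg_prod (I : Type) (s : seq I) (f : I -> T -> R -> K) (g : I -> R -> K) :
  (forall i, ucvg (f i) (g i)) ->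
  ucvg (fun x t => \prod_(i <- s) f i x t) (fun t => \prod_(i <- s) g i t).
Proof.
move=> fg; elim: s => [|i s IHs].
  rewrite (_ : (fun t => _) = (fun=> 1)); last by apply/funext => t; rewrite big_nil.
  rewrite (_ : (fun x t => _) = (fun _ _ => 1)).
    by apply: (@ucvg_cst (fun=> 1) 1) => t; rewrite normr1.
  by apply/funext => x; apply/funext => t; rewrite big_nil.
rewrite (_ : (fun t => _) = (fun t => g i t * \prod_(j <- s) g j t)); last first.
  by apply/funext => t; rewrite big_cons.
rewrite (_ : (fun x t => _) = (fun x t => f i x t * \prod_(j <- s) f j x t)).
  exact: ucvgM.
by apply/funext => x; apply/funext => t; rewrite big_cons.
Qed.

Lemma ucvg_1subM (f : T -> K) (l : K) (v : R -> K) : (forall t, `|v t| = 1) ->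
  f x @[x --> F] --> l -> ucvg (fun x t => 1 - f x * v t) (fun t => 1 - l * v t).
Proof.
move=> v1 /cvgrPdist_le fl; split.
  exists (1 + `|l|) => t; apply: le_trans (ler_normB _ _) _.
  by rewrite normr1 normrM v1 mulr1.
move=> eps e0; near=> x.
have h : `|l - f x| <= eps by near: x; exact: fl.
move=> t; have -> : 1 - l * v t - (1 - f x * v t) = - ((l - f x) * v t) by ring.
by rewrite normrN normrM v1 mulr1.
Unshelve. all: by end_near. Qed.

End Filters.

End Convergence.

Section ParameterContinuity.
Variables (R : realType) (k : nat).
Local Notation K := (R[i]).
Context {T : Type} {F : set_system T} {FF : Filter F}.
Variables (A' B' C' D' : T -> 'rV[K]_k) (A B C D : 'rV[K]_k).
Hypothesis cA : forall i, A' x 0 i @[x --> F] --> A 0 i.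
Hypothesis cB : forall i, B' x 0 i @[x --> F] --> B 0 i.
Hypothesis cC : forall i, C' x 0 i @[x --> F] --> C 0 i.
Hypothesis cD : forall i, D' x 0 i @[x --> F] --> D 0 i.
Hypothesis C1 : forall i, `|C 0 i| < 1.
Hypothesis D1 : forall i, `|D 0 i| < 1.

Lemma near_norm_lt1 (f : T -> K) (l : K) : f x @[x --> F] --> l -> `|l| < 1 ->
  \forall x \near F, `|f x| < 1.
Proof.
move=> /cvgrPdist_lt fl l1; have e0 : 0 < 1 - `|l| by rewrite subr_gt0.
near=> x; have h : `|l - f x| < 1 - `|l| by near: x; exact: fl.
have -> : f x = l - (l - f x) by ring.
apply: le_lt_trans (ler_normB _ _) _.
by rewrite -ltrBrDl.
Unshelve. all: by end_near. Qed.

Lemma near_rows_lt1 : \forall x \near F,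
  (forall i, `|C' x 0 i| < 1) /\ (forall i, `|D' x 0 i| < 1).
Proof.
near=> x; split; near: x; apply: filter_forall => i.
  exact: near_norm_lt1 (@cC i) (C1 i).
exact: near_norm_lt1 (@cD i) (D1 i).
Unshelve. all: by end_near. Qed.

Lemma ucvg_symbol : ucvg (F := F) (fun x t => symbol (A' x) (B' x) (C' x) (D' x) (expi t))
  (fun t => symbol A B C D (expi t)).
Proof.
have nV (t : R) : `|(expi t)^-1| = 1 by rewrite normfV norm_expi invr1.
have low (l : K) (v : R -> K) t : `|v t| = 1 -> 1 - `|l| <= `|1 - l * v t|.
  by move=> v1; have := lerB_dist 1 (l * v t); rewrite normr1 normrM v1 mulr1.
apply: ucvg_prod => i; apply: ucvgM.
  apply: ucvgM; first exact: (ucvg_1subM (v := fun t => (expi t)^-1)).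
  exact: (ucvg_1subM (v := expi) (@norm_expi R)).
have m1 : 0 < 1 - `|C 0 i| by rewrite subr_gt0.
have m2 : 0 < 1 - `|D 0 i| by rewrite subr_gt0.
apply: (@ucvgV _ _ _ _ _ _ ((1 - `|C 0 i|) * (1 - `|D 0 i|))).
- by rewrite mulr_gt0.
- move=> t; rewrite normrM; apply: ler_pM; [exact: ltW | exact: ltW | | ].
    exact: (low _ (fun t => (expi t)^-1) _ (nV t)).
  exact: (low _ (@expi R) _ (norm_expi t)).
apply: ucvgM; first exact: (ucvg_1subM (v := fun t => (expi t)^-1)).
exact: (ucvg_1subM (v := expi) (@norm_expi R)).
Qed.

Lemma cvg_fourier_coef m :
  fourier_coef (symbol (A' x) (B' x) (C' x) (D' x)) m @[x --> F] -->
  fourier_coef (symbol A B C D) m.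
Proof.
apply/cvgrPdist_le => eps e0; have [_ u] := ucvg_symbol.
pose c := complex.Re eps / 2.
have cE : (2 * c)%:C = eps.
  rewrite /c mulrCA mulfV ?mulr1 ?pnatr_eq0 //.
  by move: e0; rewrite ltcE /= => /andP[/eqP]; case: eps {u c} => a b /= -> _.
have c0 : 0 < c%:C :> K.
  have : 0 < (2 * c)%:C :> K by rewrite cE.
  by rewrite ltcR => h; rewrite ltcR -(pmulr_rgt0 _ (ltr0n R 2)).
near=> x.
have [hC hD] : (forall i, `|C' x 0 i| < 1) /\ (forall i, `|D' x 0 i| < 1).
  by near: x; exact: near_rows_lt1.
have c1 := continuous_on_circle_symbol A B C1 D1.
have c2 := continuous_on_circle_symbol (A' x) (B' x) hC hD.
have c2' : continuous_on_circle (fun z => -1 * symbol (A' x) (B' x) (C' x) (D' x) z).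
  exact: continuous_on_circleM (continuous_on_circle_cst _) c2.
have -> : fourier_coef (symbol A B C D) m - fourier_coef (symbol (A' x) (B' x) (C' x) (D' x)) m =
  fourier_coef (fun z => symbol A B C D z + -1 * symbol (A' x) (B' x) (C' x) (D' x) z) m.
  by rewrite (fourier_coefD m c1 c2') (fourier_coefZ _ _ c2) mulN1r.
rewrite -cE; apply: fourier_coef_bound; first exact: continuous_on_circleD.
move=> t _; rewrite mulN1r; move: t; near: x; exact: u.
Unshelve. all: by end_near. Qed.

Lemma cvg_det_toeplitz_plus_hankel n :
  \det (toeplitz_plus_hankel n (symbol (A' x) (B' x) (C' x) (D' x))) @[x --> F] -->
  \det (toeplitz_plus_hankel n (symbol A B C D)).
Proof.
apply: cvg_det => i j; rewrite mxE.
pose phi x := symbol (A' x) (B' x) (C' x) (D' x).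
rewrite (_ : (fun x => _) = (fun x => fourier_coef (phi x) (i%:Z - j%:Z) +
  fourier_coef (phi x) (i%:Z + j%:Z + 1))); last by apply/funext => x; rewrite mxE.
by apply: cvgD; exact: cvg_fourier_coef.
Qed.

End ParameterContinuity.

(** * Paths in general position *)

Section GenericPath.
Variable R : realType.
Local Notation K := (R[i]).

Lemma cvg_horner {T : Type} {F : set_system T} {FF : Filter F} (q : {poly K})
    (f : T -> K) (l : K) : f t @[t --> F] --> l -> q.[f t] @[t --> F] --> q.[l].
Proof.
move=> fl; elim/poly_ind: q => [|q c IHq].
  rewrite horner0 (_ : (fun t => _) = (fun=> 0)); first exact: cvg_cst.
  by apply/funext => z; rewrite horner0.
rewrite !hornerE (_ : (fun t => _) = (fun z => q.[f z] * f z + c)); last first.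
  by apply/funext => z; rewrite !hornerE.
by apply: cvgD; [exact: (cvgM IHq fl) | exact: cvg_cst].
Qed.

Lemma cvg_dnbhs0 : (fun t : K => t) @ (0 : K)^' --> (0 : K).
Proof. by apply: cvg_within. Qed.

(** Write q = r * 'X^m with r.[0] != 0: by continuity r has no zero near 0. *)
Lemma near_horner_neq0 (q : {poly K}) : q != 0 -> \forall t \near (0 : K)^', q.[t] != 0.
Proof.
move=> q0; have [m [r r0 qE]] := multiplicity_XsubC q 0.
rewrite q0 /= in r0; rewrite qE subr0.
have FF : Filter ((0 : K)^') := @dnbhs_filter _ (0 : K).
have rl := @cvg_horner _ _ FF r _ _ cvg_dnbhs0.
have r00 : r.[0] != 0 by rewrite -rootE.
have n1 := @cvgr_neq0 _ _ _ _ FF _ _ rl r00.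
have n2 := nbhs_dnbhs_neq (0 : K).
apply: filterS2 n1 n2 => t h1 h2.
by rewrite hornerM hornerXn mulf_neq0 // expf_neq0.
Qed.

Lemma near_affine_neq (x y p q : K) : p != q ->
  \forall t \near (0 : K)^', x + p * t != y + q * t.
Proof.
move=> pq; have h : ((p - q) *: 'X + (x - y)%:P : {poly K}) != 0.
  apply/eqP => /(congr1 (fun r : {poly K} => r`_1)).
  by rewrite coefD coefZ coefX coefC mulr1 addr0 coef0 => /eqP; rewrite subr_eq0 (negPf pq).
have FF : Filter ((0 : K)^') := @dnbhs_filter _ (0 : K).
apply: filterS (near_horner_neq0 h) => t.
apply: contraNneq => e; rewrite !(hornerD, hornerN, hornerM, hornerZ, hornerX, hornerC); apply/eqP.
by transitivity (x + p * t - (y + q * t)); [ring | rewrite e subrr].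
Qed.

Lemma near_affineM_neq1 (x y p q : K) : p != 0 ->
  \forall t \near (0 : K)^', (x + p * t) * (y + q * t) != 1.
Proof.
move=> p0; have h : ((p *: 'X + x%:P) * (q *: 'X + y%:P) - 1 : {poly K}) != 0.
  (* At - x / p the first factor vanishes. *)
  apply/eqP => /(congr1 (fun r : {poly K} => r.[- x / p])).
  rewrite !(hornerD, hornerN, hornerM, hornerZ, hornerX, hornerC) mulrCA mulfV // mulr1.
  by rewrite addNr mul0r sub0r => /eqP; rewrite oppr_eq0 oner_eq0.
have FF : Filter ((0 : K)^') := @dnbhs_filter _ (0 : K).
apply: filterS (near_horner_neq0 h) => t.
apply: contraNneq => e; rewrite !(hornerD, hornerN, hornerM, hornerZ, hornerX, hornerC); apply/eqP.
by transitivity ((x + p * t) * (y + q * t) - 1); [ring | rewrite e subrr].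
Qed.

End GenericPath.

(** * Continuity of the summands *)

Section GenericPoints.
Variables (R : realType) (k n : nat).
Local Notation K := (R[i]).

Section SetTermContinuity.
Context {T : Type} {F : set_system T} {FF : Filter F}.
Implicit Types (f g : T -> K).

Let cvg_mul f g (a b : K) : f x @[x --> F] --> a -> g x @[x --> F] --> b ->
  f x * g x @[x --> F] --> a * b.
Proof. by move=> fa gb; exact: (cvgM fa gb). Qed.

Let cvg_inv f (a : K) : a != 0 -> f x @[x --> F] --> a -> (f x)^-1 @[x --> F] --> a^-1.
Proof. by move=> a0 fa; exact: (cvgV a0 fa). Qed.

Let cvg_1sub f (a : K) : f x @[x --> F] --> a -> 1 - f x @[x --> F] --> 1 - a.
Proof. by move=> fa; exact: (cvgB (cvg_cst _) fa). Qed.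

Let cvg_1add f (a : K) : f x @[x --> F] --> a -> 1 + f x @[x --> F] --> 1 + a.
Proof. by move=> fa; exact: (cvgD (cvg_cst _) fa). Qed.

Variables (e' : T -> 'I_(k + k) -> K) (b' c' : T -> 'I_k -> K).
Variables (e : 'I_(k + k) -> K) (b c : 'I_k -> K).
Hypothesis ce : forall i, e' x i @[x --> F] --> e i.
Hypothesis cb : forall i, b' x i @[x --> F] --> b i.
Hypothesis cc : forall i, c' x i @[x --> F] --> c i.

Lemma cvg_setterm (U : {set 'I_(k + k)}) (V : {set 'I_k}) :
  (forall i, i \in U -> e i != 0) -> (forall j, j \in V -> b j != 0) ->
  (forall i j, 1 - e (rshift k i) * e (rshift k j) != 0) ->
  (forall i j, 1 - c i * e (rshift k j) != 0) ->
  (forall i j, i \in ~: U -> j \in ~: V -> 1 - e i * b j != 0) ->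
  (forall i s, i \in ~: U -> s \in U -> 1 - e i / e s != 0) ->
  (forall t j, t \in V -> j \in ~: V -> 1 - (b t)^-1 * b j != 0) ->
  (forall t s, t \in V -> s \in U -> 1 - (b t)^-1 / e s != 0) ->
  setterm n (e' x) (b' x) (c' x) U V @[x --> F] --> setterm n e b c U V.
Proof.
move=> e0 b0 dd cd eb ee bb be.
have ce1 i : i \in U -> (e' x i)^-1 @[x --> F] --> (e i)^-1.
  by move=> iU; apply: cvg_inv; [exact: e0 | exact: ce].
have cb1 i : i \in V -> (b' x i)^-1 @[x --> F] --> (b i)^-1.
  by move=> iV; apply: cvg_inv; [exact: b0 | exact: cb].
have p2 (I J : finType) (P : pred I) (Q : I -> pred J) (f : T -> I -> J -> K) (l : I -> J -> K) :
    (forall i j, P i -> Q i j -> f x i j @[x --> F] --> l i j) ->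
    \prod_(i | P i) \prod_(j | Q i j) f x i j @[x --> F] -->
    \prod_(i | P i) \prod_(j | Q i j) l i j.
  by move=> fl; apply: cvg_prodr => i Pi; apply: cvg_prodr => j; exact: fl.
have m2 (f g : T -> K) (l m : K) : f x @[x --> F] --> l -> g x @[x --> F] --> m ->
    1 - f x * g x @[x --> F] --> 1 - l * m.
  by move=> fl gm; apply: cvg_1sub; exact: cvg_mul.
rewrite /setterm; apply: cvg_mul.
  apply: cvg_mul; last by apply: cvg_prodr => j _; exact: cvg_1sub.
  apply: cvg_mul; last by apply: cvg_prodr => j _; exact: cvg_1sub.
  apply: cvg_mul; last by apply: cvg_prodr => j _; exact: cvg_1add.
  apply: cvg_mul; last by apply: cvg_prodr => j _; exact: cvg_exprn.
  apply: cvg_mul; last by apply: cvg_prodr => j _; exact: cvg_exprn.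
  exact: cvg_cst.
apply: cvg_mul; last first.
  apply: cvg_mul; last by apply: p2 => i j iP /andP[jP _]; apply: m2; exact: ce1.
  apply: cvg_mul; apply: p2 => i j iP jP; apply: m2 => //; exact: ce1.
apply: cvg_mul; last by apply: cvg_mul; apply: p2 => i j iP jP; apply: m2 => //; exact: ce1.
apply: cvg_mul; last by apply: cvg_mul; apply: p2 => i j iP jP; apply: m2 => //; exact: cb1.
apply: cvg_mul; last first.
  apply: cvg_inv.
    rewrite !mulf_neq0 //; apply/prodf_neq0 => i iP; apply/prodf_neq0 => j jP;
    by [exact: eb | exact: ee | exact: bb | exact: be].
  apply: cvg_mul; last by apply: p2 => i j iP jP; apply: m2; [exact: cb1 | exact: ce1].
  apply: cvg_mul; last by apply: p2 => i j iP jP; apply: m2 => //; exact: cb1.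
  apply: cvg_mul; apply: p2 => i j iP jP; apply: m2 => //; exact: ce1.
apply: cvg_mul; last first.
  apply: cvg_inv; last by apply: p2 => i j _ _; exact: m2.
  by apply/prodf_neq0 => i _; apply/prodf_neq0 => j _; exact: cd.
apply: cvg_inv.
  rewrite mulf_neq0 //; apply/prodf_neq0 => i _; first exact: dd.
  by apply/prodf_neq0 => j _; exact: dd.
apply: cvg_mul; last by apply: p2 => i j _ _; exact: m2.
by apply: cvg_prodr => i _; exact: m2.
Qed.

End SetTermContinuity.
End GenericPoints.

(** * The identity in general position *)

Section Generic.
Variables (R : realType) (k : nat).
Local Notation K := (R[i]).
Implicit Types (A B C D : 'rV[K]_k).

(** General position of the parameters: the conditions under which the
    determinants above have nonzero denominators. *)
Record generic A B C D : Prop := Generic {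
  generic_b0 : forall i, B 0 i != 0;
  generic_binj : injective (fun i => B 0 i);
  generic_e0 : forall i, row_mx A D 0 i != 0;
  generic_einj : injective (fun i => row_mx A D 0 i);
  generic_bb : forall i j, B 0 i * B 0 j != 1;
  generic_eb : forall i j, row_mx A D 0 i * B 0 j != 1;
  generic_eNb : forall i j, row_mx A D 0 i != B 0 j;
  generic_ee : forall i j, row_mx A D 0 i * row_mx A D 0 j != 1;
  generic_bc : forall i j, B 0 i * C 0 j != 1 }.

Lemma det_generic n A B C D : (0 < n)%N ->
  (forall i, `|C 0 i| < 1) -> (forall i, `|D 0 i| < 1) -> generic A B C D ->
  \det (toeplitz_plus_hankel n (symbol A B C D)) = rhs_sum n (A, B, C, D).
Proof.
move=> n0 C1 D1 [b0 binj e0 einj bb eb eNb ee bc].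
have dE : (fun i => row_mx A D 0 (rshift k i)) = (fun i => D 0 i).
  by apply/funext => i; rewrite row_mxEr.
have aE : (fun i => row_mx A D 0 (lshift k i)) = (fun i => A 0 i).
  by apply/funext => i; rewrite row_mxEl.
have [P [N [E sN sP tP ->]]] := det_toeplitz_plus_hankel A B C1 D1 n.
rewrite (@det_subset_sum _ k n (fun i => row_mx A D 0 i) (fun i => B 0 i) (fun i => C 0 i)
  _ _ _ _ _ _ _ _ _ _ _ P N) ?aE ?dE //.
- by rewrite /rhs_sum; apply: eq_bigr => S _; apply: eq_bigr => T _; rewrite summandE.
- by move=> i j; rewrite row_mxEr; exact: mulr_neq1_norm.
Qed.

Lemma generic_rhs_domain A B C D :
  (forall i, `|C 0 i| < 1) -> (forall i, `|D 0 i| < 1) -> generic A B C D ->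
  rhs_domain (A, B, C, D).
Proof.
move=> C1 D1 [b0 binj e0 einj bb eb eNb ee bc] S T _.
split.
- by apply/negP; rewrite /subfamily => /fintype.imageP[i _ h]; have := e0 i; rewrite -h eqxx.
- by apply/negP; rewrite /subfamily => /fintype.imageP[i _ h]; have := b0 i; rewrite -h eqxx.
- move=> i j _; apply: sub1r_neq0.
  have /fintype.imageP[u _ ->] : (Defs.family D)`_i \in Defs.family D by exact: mem_nth.
  have /fintype.imageP[v _ ->] : (Defs.family D)`_j \in Defs.family D by exact: mem_nth.
  exact: mulr_neq1_norm.
- by move=> x y /fintype.imageP[u _ ->] /fintype.imageP[v _ ->]; apply: sub1r_neq0; exact: mulr_neq1_norm.
- move=> x y; rewrite !mem_cat => /orP[/fintype.imageP[i iS ->]|/mapP[z /fintype.imageP[t tT ->] ->]];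
    move=> /orP[/fintype.imageP[j jT ->]|/mapP[w /fintype.imageP[s sS ->] ->]]; apply: sub1r_neq0 => //.
  + apply: divr_neq1 => //; rewrite (inj_eq einj); apply: contraTneq iS => ->.
    by rewrite inE negbK.
  + rewrite mulrC; apply: divr_neq1 => //; rewrite (inj_eq binj); apply: contraTneq jT => ->.
    by rewrite inE negbK.
  + by rewrite -invfM invr_eq1 mulrC.
Qed.

End Generic.

(** * The identity at all parameters *)

Section Path.
Variables (R : realType) (k : nat).
Local Notation K := (R[i]).
Variables A B C D : 'rV[K]_k.

(* The slopes are the numbers 1, ..., 3 k: being nonzero and distinct, they leave no
   difference of parameters, and no product of two of them, constant in t. *)
Let slopeA : 'rV[K]_k := \row_(i < k) i.+1%:R.
Let slopeB : 'rV[K]_k := \row_(i < k) (k + k + i).+1%:R.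
Let slopeD : 'rV[K]_k := \row_(i < k) (k + i).+1%:R.
Definition pathA (t : K) := A + t *: slopeA.
Definition pathB (t : K) := B + t *: slopeB.
Definition pathD (t : K) := D + t *: slopeD.

Lemma row_mx_path t i :
  row_mx (pathA t) (pathD t) 0 i = row_mx A D 0 i + (i.+1)%:R * t.
Proof.
by case: (split_ordP i) => j ->; rewrite ?row_mxEl ?row_mxEr /pathA /pathD !mxE mulrC.
Qed.

Lemma pathBE t i : pathB t 0 i = B 0 i + ((k + k + i).+1)%:R * t.
Proof. by rewrite /pathB !mxE mulrC. Qed.

Lemma near_path_generic : \forall t \near (0 : K)^', generic (pathA t) (pathB t) C (pathD t).
Proof.
have FF : Filter ((0 : K)^') := @dnbhs_filter _ (0 : K).
have nz m : m.+1%:R != 0 :> K by rewrite pnatr_eq0.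
have nat_neq m l : m != l -> m.+1%:R != l.+1%:R :> K by rewrite eqr_nat.
have b0 : \forall t \near (0 : K)^', forall i, pathB t 0 i != 0.
  apply: filter_forall => i; apply: filterS (near_affine_neq (B 0 i) 0 (nz (k + k + i)%N)) => t.
  by rewrite mul0r addr0 pathBE.
have binj : \forall t \near (0 : K)^', forall i j, i != j -> pathB t 0 i != pathB t 0 j.
  apply: filter_forall => i; apply: filter_forall => j; have [->|ij] := eqVneq i j.
    by apply: nearW => t.
  have h : (k + k + i)%N != (k + k + j)%N by rewrite eqn_add2l.
  apply: filterS (near_affine_neq (B 0 i) (B 0 j) (nat_neq _ _ h)) => t.
  by rewrite !pathBE.
have e0 : \forall t \near (0 : K)^', forall i, row_mx (pathA t) (pathD t) 0 i != 0.
  apply: filter_forall => i; apply: filterS (near_affine_neq (row_mx A D 0 i) 0 (nz i)) => t.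
  by rewrite mul0r addr0 row_mx_path.
have einj : \forall t \near (0 : K)^', forall i j, i != j ->
    row_mx (pathA t) (pathD t) 0 i != row_mx (pathA t) (pathD t) 0 j.
  apply: filter_forall => i; apply: filter_forall => j; have [->|ij] := eqVneq i j.
    by apply: nearW => t.
  apply: filterS (near_affine_neq (row_mx A D 0 i) (row_mx A D 0 j) (nat_neq _ _ ij)) => t.
  by rewrite !row_mx_path.
have bb : \forall t \near (0 : K)^', forall i j, pathB t 0 i * pathB t 0 j != 1.
  apply: filter_forall => i; apply: filter_forall => j.
  apply: filterS (near_affineM_neq1 (B 0 i) (B 0 j) (k + k + j).+1%:R (nz (k + k + i)%N)) => t.
  by rewrite !pathBE.
have eb : \forall t \near (0 : K)^', forall i j,
    row_mx (pathA t) (pathD t) 0 i * pathB t 0 j != 1.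
  apply: filter_forall => i; apply: filter_forall => j.
  apply: filterS (near_affineM_neq1 (row_mx A D 0 i) (B 0 j) (k + k + j).+1%:R (nz i)) => t.
  by rewrite row_mx_path pathBE.
have eNb : \forall t \near (0 : K)^', forall i j,
    row_mx (pathA t) (pathD t) 0 i != pathB t 0 j.
  apply: filter_forall => i; apply: filter_forall => j.
  have h : i != (k + k + j)%N :> nat by rewrite ltn_eqF // ltn_addr.
  apply: filterS (near_affine_neq (row_mx A D 0 i) (B 0 j) (nat_neq _ _ h)) => t.
  by rewrite row_mx_path pathBE.
have ee : \forall t \near (0 : K)^', forall i j,
    row_mx (pathA t) (pathD t) 0 i * row_mx (pathA t) (pathD t) 0 j != 1.
  apply: filter_forall => i; apply: filter_forall => j.
  apply: filterS (near_affineM_neq1 (row_mx A D 0 i) (row_mx A D 0 j) j.+1%:R (nz i)) => t.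
  by rewrite !row_mx_path.
have bc : \forall t \near (0 : K)^', forall i j, pathB t 0 i * C 0 j != 1.
  apply: filter_forall => i; apply: filter_forall => j.
  apply: filterS (near_affineM_neq1 (B 0 i) (C 0 j) 0 (nz (k + k + i)%N)) => t.
  by rewrite mul0r addr0 pathBE.
near=> t; have inj (m : nat) (v : 'rV[K]_m) : (forall i j, i != j -> v 0 i != v 0 j) ->
    injective (fun i => v 0 i).
  by move=> vP i j vij; apply/eqP; apply: contraT => /vP; rewrite vij eqxx.
split => //; try (by near: t).
- by apply: inj; near: t.
- by apply: inj; near: t.
Unshelve. all: by end_near. Qed.

Lemma cvg_entry {T : Type} {F : set_system T} (g : T -> 'rV[K]_k) (L : 'rV[K]_k) i :
  g x @[x --> F] --> L -> g x 0 i @[x --> F] --> L 0 i.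
Proof. by move=> gL; exact: (cvg_comp _ _ gL (@coord_continuous _ _ _ 0 i _)). Qed.

Lemma cvg_path (M N : 'rV[K]_k) : M + t *: N @[t --> (0 : K)^'] --> M.
Proof.
have FF : Filter ((0 : K)^') := @dnbhs_filter _ (0 : K).
have h : (fun t : K => t) @ (0 : K)^' --> (0 : K) by exact: cvg_dnbhs0.
rewrite -[X in _ --> X]addr0 -(scale0r N).
apply: cvgD; first exact: cvg_cst.
by apply: cvgZr_tmp; exact: h.
Qed.

Lemma cvg_path_coord (M N : 'rV[K]_k) i :
  (M + t *: N) 0 i @[t --> (0 : K)^'] --> M 0 i.
Proof.
exact: cvg_entry (@cvg_path M N).
Qed.

End Path.

Section Main.
Variables (R : realType) (k n : nat).
Local Notation K := (R[i]).
Hypothesis n_gt0 : (0 < n)%N.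

Lemma cvg_rhs_sum_path (A B C D : 'rV[K]_k) : rhs_domain (A, B, C, D) ->
  rhs_sum n (pathA A t, pathB B t, C, pathD D t) @[t --> (0 : K)^'] -->
  rhs_sum n (A, B, C, D).
Proof.
move=> dom; have FF : Filter ((0 : K)^') := @dnbhs_filter _ (0 : K).
apply: cvg_sumr => S _; apply: cvg_sumr => T /eqP ST.
rewrite summandE (_ : (fun t : K => summand _ _ _ _ _ _ _) = (fun t =>
  setterm n (fun i => row_mx (pathA A t) (pathD D t) 0 i) (fun i => pathB B t 0 i)
    (fun i => C 0 i) S T)); last by apply/funext => t; rewrite summandE.
have [S0 T0 ZS ZCD ZEB] := dom S T ST.
have memE i : i \in ~: S -> row_mx A D 0 i \in swapE A B D S T.
  by move=> iS; rewrite mem_cat /subfamily fintype.image_f.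
have memS i : i \in S -> (row_mx A D 0 i)^-1 \in swapB A B D S T.
  by move=> iS; rewrite mem_cat /inv_family map_f ?orbT // /subfamily fintype.image_f.
have memB i : i \in ~: T -> B 0 i \in swapB A B D S T.
  by move=> iS; rewrite mem_cat /subfamily fintype.image_f.
have memT i : i \in T -> (B 0 i)^-1 \in swapE A B D S T.
  by move=> iS; rewrite mem_cat /inv_family map_f ?orbT // /subfamily fintype.image_f.
have memF (M : 'rV[K]_k) i : M 0 i \in Defs.family M by exact: fintype.image_f.
apply: cvg_setterm.
- move=> i; case: (split_ordP i) => j ->.
    rewrite row_mxEl (_ : (fun t : K => _) = (fun t => pathA A t 0 j)); first exact: cvg_path_coord.
    by apply/funext => t; rewrite row_mxEl.
  rewrite row_mxEr (_ : (fun t : K => _) = (fun t => pathD D t 0 j)); first exact: cvg_path_coord.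
  by apply/funext => t; rewrite row_mxEr.
- by move=> i; exact: cvg_path_coord.
- by move=> i; exact: cvg_cst.
- by move=> i iS; apply: contraNneq S0 => <-; exact: fintype.image_f.
- by move=> i iS; apply: contraNneq T0 => <-; exact: fintype.image_f.
- move=> i j; rewrite !row_mxEr.
  have fE (l : 'I_k) : exists2 u : 'I_(size (Defs.family D)), u = l :> nat & (Defs.family D)`_u = D 0 l.
    have ll : (l < size (Defs.family D))%N by rewrite size_image card_ord.
    exists (Ordinal ll) => //=; rewrite /Defs.family /image_mem.
    by rewrite (nth_map l) ?size_enum_ord // nth_ord_enum.
  have [u _ <-] := fE i; have [v _ <-] := fE j.
  by case: (leqP u v) => [/ZS //|/ltnW/ZS]; rewrite mulrC.
- by move=> i j; rewrite row_mxEr; exact: ZCD.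
- by move=> i j iS jT; apply: ZEB; [exact: memE | exact: memB].
- by move=> i j iS jT; apply: ZEB; [exact: memE | exact: memS].
- by move=> i j iS jT; apply: ZEB; [exact: memT | exact: memB].
- by move=> i j iS jT; apply: ZEB; [exact: memT | exact: memS].
Qed.

Variables A B C D : 'rV[K]_k.
Hypothesis C1 : forall i, `|C 0 i| < 1.
Hypothesis D1 : forall i, `|D 0 i| < 1.

Lemma near_path : \forall t \near (0 : K)^',
  rhs_domain (pathA A t, pathB B t, C, pathD D t) /\
  \det (toeplitz_plus_hankel n (symbol (pathA A t) (pathB B t) C (pathD D t))) =
  rhs_sum n (pathA A t, pathB B t, C, pathD D t).
Proof.
have FF : Filter ((0 : K)^') := @dnbhs_filter _ (0 : K).
have cC i : (fun=> C) t 0 i @[t --> (0 : K)^'] --> C 0 i by exact: cvg_cst.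
have cD i : pathD D t 0 i @[t --> (0 : K)^'] --> D 0 i by exact: cvg_path_coord.
apply: filterS2 (near_path_generic A B C D) (near_rows_lt1 cC cD C1 D1) => t gen [_ Dt1].
by split; [exact: generic_rhs_domain | exact: det_generic].
Qed.

Lemma cvg_det_path :
  \det (toeplitz_plus_hankel n (symbol (pathA A t) (pathB B t) C (pathD D t)))
    @[t --> (0 : K)^'] --> \det (toeplitz_plus_hankel n (symbol A B C D)).
Proof.
have FF : Filter ((0 : K)^') := @dnbhs_filter _ (0 : K).
apply: (@cvg_det_toeplitz_plus_hankel _ _ _ _ FF (pathA A) (pathB B) (fun=> C) (pathD D)) => // i;
  by [exact: cvg_path_coord | exact: cvg_cst].
Qed.

(** Both sides are continuous along the path, on which they agree for small nonzero
    t. *)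
Lemma det_rhs_domain : rhs_domain (A, B, C, D) ->
  \det (toeplitz_plus_hankel n (symbol A B C D)) = rhs_sum n (A, B, C, D).
Proof.
move=> dom; have PF : ProperFilter ((0 : K)^') := @Proper_dnbhs_numFieldType _ (0 : K).
have FF : Filter ((0 : K)^') := @dnbhs_filter _ (0 : K).
have c1 := cvg_rhs_sum_path dom.
apply: (@cvg_unique _ (@norm_hausdorff _ _) _ (fmap_proper_filter _ PF) _ _ cvg_det_path).
apply: cvg_trans c1; apply: near_eq_cvg.
by apply: filterS near_path => t [].
Qed.

End Main.

Section Closure.
Variables (R : realType) (k n : nat).
Local Notation K := (R[i]).
Hypothesis n_gt0 : (0 < n)%N.
Variables A B C D : 'rV[K]_k.
Hypothesis C1 : forall i, `|C 0 i| < 1.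
Hypothesis D1 : forall i, `|D 0 i| < 1.

Lemma cvg_pair_nbhs (T : Type) (U V : topologicalType) (F : set_system T)
    (FF : Filter F) (f : T -> U) (g : T -> V) (u : U) (v : V) :
  f x @[x --> F] --> u -> g x @[x --> F] --> v -> (f x, g x) @[x --> F] --> (u, v).
Proof. exact: cvg_pair. Qed.

Lemma closure_rhs_domain : closure (rhs_domain (R := R)) (A, B, C, D).
Proof.
have PF : ProperFilter ((0 : K)^') := @Proper_dnbhs_numFieldType _ (0 : K).
have FF : Filter ((0 : K)^') := @dnbhs_filter _ (0 : K).
have c : (pathA A t, pathB B t, C, pathD D t) @[t --> (0 : K)^'] --> (A, B, C, D).
  have cA : pathA A t @[t --> (0 : K)^'] --> A by exact: cvg_path.
  have cB : pathB B t @[t --> (0 : K)^'] --> B by exact: cvg_path.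
  have cC : (fun=> C) t @[t --> (0 : K)^'] --> C by exact: cvg_cst.
  have cD : pathD D t @[t --> (0 : K)^'] --> D by exact: cvg_path.
  have cAB := cvg_pair_nbhs FF cA cB.
  have cABC := cvg_pair_nbhs FF cAB cC.
  exact: (cvg_pair_nbhs FF cABC cD).
move=> U /c Un.
have Un' : \forall t \near (0 : K)^', U (pathA A t, pathB B t, C, pathD D t) by [].
have := @filterI _ _ FF _ _ Un' (near_path n_gt0 A B C1 D1).
by move=> /filter_ex [t [Ut [dt _]]]; exists (pathA A t, pathB B t, C, pathD D t).
Qed.

(** Near the given point the moduli of C and D stay below 1, so that on the domain
    the sum is the determinant, which is continuous. *)
Lemma cvg_rhs_sum_within :
  rhs_sum n q @[q --> within rhs_domain (nbhs (A, B, C, D))] -->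
  \det (toeplitz_plus_hankel n (symbol A B C D)).
Proof.
set p := (A, B, C, D).
have FF : Filter (within rhs_domain (nbhs p)) by exact: within_filter.
have coord (g : 'rV[K]_k * 'rV[K]_k * 'rV[K]_k * 'rV[K]_k -> 'rV[K]_k) i :
    g q @[q --> nbhs p] --> g p ->
    g q 0 i @[q --> within rhs_domain (nbhs p)] --> g p 0 i.
  move=> gp; apply: cvg_within_filter => //.
  exact: cvg_entry gp.
have f1 : fst q @[q --> nbhs p] --> fst p by exact: cvg_fst.
have f2 : fst (fst q) @[q --> nbhs p] --> fst (fst p) by apply: cvg_comp f1 _; exact: cvg_fst.
have cA (i : 'I_k) : (q.1.1.1 : 'rV[K]_k) 0 i @[q --> within rhs_domain (nbhs p)] --> A 0 i.
  by apply: (coord (fun q => q.1.1.1)); apply: cvg_comp f2 _; exact: cvg_fst.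
have cB (i : 'I_k) : (q.1.1.2 : 'rV[K]_k) 0 i @[q --> within rhs_domain (nbhs p)] --> B 0 i.
  by apply: (coord (fun q => q.1.1.2)); apply: cvg_comp f2 _; exact: cvg_snd.
have cC (i : 'I_k) : (q.1.2 : 'rV[K]_k) 0 i @[q --> within rhs_domain (nbhs p)] --> C 0 i.
  by apply: (coord (fun q => q.1.2)); apply: cvg_comp f1 _; exact: cvg_snd.
have cD (i : 'I_k) : (q.2 : 'rV[K]_k) 0 i @[q --> within rhs_domain (nbhs p)] --> D 0 i.
  by apply: (coord (fun q => q.2)); exact: cvg_snd.
have := @cvg_det_toeplitz_plus_hankel _ _ _ _ FF
  (fun q => q.1.1.1) (fun q => q.1.1.2) (fun q => q.1.2) (fun q => q.2) A B C D cA cB cC cD C1 D1 n.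
apply: cvg_trans; apply: near_eq_cvg.
have lt1 := near_rows_lt1 (FF := FF) cC cD C1 D1.
have dom : \forall q \near within rhs_domain (nbhs p), rhs_domain q by exact: withinT.
have h : \forall q \near within rhs_domain (nbhs p),
    \det (toeplitz_plus_hankel n (symbol q.1.1.1 q.1.1.2 q.1.2 q.2)) = rhs_sum n q.
  refine (@filterS _ _ FF _ _ _ (@filterI _ _ FF _ _ lt1 dom)).
  by move=> [[[a b] c] d] /= [[c1 d1] dom']; rewrite det_rhs_domain.
exact: h.
Qed.

End Closure.

Unset Implicit Arguments.

Theorem theorem4p6 (R : realType) (k n : nat) (A B C D : 'rV[R[i]]_k)
    (hk : (1 <= k)%N) (hn : (1 <= n)%N)
    (hC : forall i, `|C 0 i| < 1) (hD : forall i, `|D 0 i| < 1)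
    (hDdist : forall i j, D 0 i = D 0 j -> i = j) :
  (rhs_domain (A, B, C, D) ->
     \det (toeplitz_plus_hankel n (symbol A B C D)) = rhs_sum n (A, B, C, D))
  /\
  continuous_extension_value (rhs_sum n) rhs_domain (A, B, C, D)
    (\det (toeplitz_plus_hankel n (symbol A B C D))).
Proof.
split; first exact: det_rhs_domain.
by split; [exact: (closure_rhs_domain (n := n)) | exact: cvg_rhs_sum_within].
Qed.
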